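(* Let $k\in\{1,2\}$ and let $\Delta_k(n)$ be defined by \[\sum_{n=0}^{\infty}\Delta_k(n)q^n=\prod_{n=1}^{\infty}\frac{(1-q^{2n})(1-q^{(2k+1)n})}{(1-q^n)^3(1-q^{(4k+2)n})}.\] Put $x_k(n)=\frac{\pi\sqrt{24n-(2k+2)}}{6}$. Then, as $n\to\infty$, \[\Delta_k(n)=\frac{(5k+2)\pi^3}{18(2k+1)x_k^2(n)}\,I_2\!\left(\sqrt{\frac{5k+2}{2k+1}}\,x_k(n)\right)+O\!\left(x_k(n)^{-7/2}\exp\!\left(\frac{\sqrt{5k+2}}{2\sqrt{2k+1}}\,x_k(n)\right)\right),\] where $I_2$ is the modified Bessel function of the first kind of order $2$.
   Context: $\Delta_k(n)$ is the number of broken $k$-diamond partitions of $n$ (in the sense of Andrews and Paule), whose generating function is the product displayed. The modified Bessel function of the first kind is $I_\nu(s)=\sum_{r\ge0}\frac{1}{r!\,\Gamma(r+\nu+1)}(s/2)^{2r+\nu}$. *)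

(* Defs.v *)
From HB Require Import structures.
From mathcomp Require Import all_boot all_order all_algebra.
From mathcomp Require Import all_classical all_reals all_analysis.

Set Implicit Arguments.
Unset Strict Implicit.
Unset Printing Implicit Defensive.

Import Order.TTheory GRing.Theory Num.Theory.
Import numFieldNormedType.Exports.

Local Open Scope ring_scope.

(* Formal power series over the integers, given by their coefficients. *)
Definition fps := nat -> int.

Definition fps_one : fps := fun n => (n == 0%N)%:R.

Definition fps_mul (f g : fps) : fps :=
  fun n => \sum_(i < n.+1) f i * g (n - i)%N.

Definition fps_exp (f : fps) (e : nat) : fps := iter e (fps_mul f) fps_one.

(* 1 - q^m *)
Definition fps_1mX (m : nat) : fps := fun n => (n == 0%N)%:R - (n == m)%:R.

(* 1 / (1 - q^m) for m > 0, see fps_1mXK *)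
Definition fps_1mXV (m : nat) : fps := fun n => (m %| n)%N%:R.

Lemma fps_1mXK (m : nat) : (0 < m)%N ->
  fps_mul (fps_1mX m) (fps_1mXV m) =1 fps_one.
Proof.
move=> m0 n; rewrite /fps_mul /fps_1mX /fps_1mXV /fps_one.
under eq_bigr do rewrite mulrBl.
rewrite sumrB big_ord_recl /= subn0 mul1r big1 ?addr0; last first.
  by move=> i _; rewrite mul0r.
have [nm|mn] := ltnP n m.
  rewrite big1 ?subr0; last first.
    by move=> [i /= ilt] _; rewrite ltn_eqF ?mul0r// (leq_ltn_trans _ nm).
  by case: n nm => [|n] nm; rewrite ?dvdn0 // gtnNdvd.
have mn1 : (m < n.+1)%N by [].
rewrite (bigD1 (Ordinal mn1)) //= eqxx mul1r big1 ?addr0; last first.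
  move=> i /eqP ne; case: eqP => [e|_]; rewrite ?mul0r//.
  by case: ne; apply: val_inj.
rewrite -{1}(subnK mn) dvdn_addl ?dvdnn// subrr gtn_eqF//.
exact: leq_trans m0 mn.
Qed.

Fixpoint fps_pprod (F : nat -> fps) (N : nat) : fps :=
  if N is N'.+1 then fps_mul (fps_pprod F N') (F N'.+1) else fps_one.

(* The infinite product of F 1, F 2, ... when F m = 1 + O(q^m): the coefficient
   of q^n in the partial products is constant from the n-th one on, see
   fps_pprod_stable. *)
Definition fps_prod (F : nat -> fps) : fps := fun n => fps_pprod F n n.

Definition fps_eq1_below (m : nat) (f : fps) :=
  forall i, (i < m)%N -> f i = fps_one i.

Lemma fps_mulr_eq1_below (m : nat) (f g : fps) :
  fps_eq1_below m g -> forall n, (n < m)%N -> fps_mul f g n = f n.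
Proof.
move=> g1 n nm; rewrite /fps_mul big_ord_recr /= subnn g1 ?(leq_ltn_trans _ nm)//.
rewrite mulr1 big1 ?add0r// => i _.
rewrite g1 ?(leq_ltn_trans (leq_subr _ _) nm)//.
by rewrite /fps_one subn_eq0 leqNgt ltn_ord mulr0.
Qed.

Lemma fps_eq1_belowM (m : nat) (f g : fps) :
  fps_eq1_below m f -> fps_eq1_below m g -> fps_eq1_below m (fps_mul f g).
Proof. by move=> f1 g1 i im; rewrite (fps_mulr_eq1_below _ g1) ?f1. Qed.

Lemma fps_pprod_stable (F : nat -> fps) :
  (forall m, (0 < m)%N -> fps_eq1_below m (F m)) ->
  forall n N, (n <= N)%N -> fps_pprod F N n = fps_prod F n.
Proof.
move=> F1 n; elim=> [|N IH]; first by rewrite leqn0 => /eqP ->.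
rewrite leq_eqVlt => /predU1P[-> //|nN] /=.
by rewrite (fps_mulr_eq1_below _ (F1 N.+1 _)) ?IH.
Qed.

Definition brokenDiamond_factor (k m : nat) : fps :=
  fps_mul (fps_mul (fps_1mX (2 * m)) (fps_1mX ((2 * k + 1) * m)))
          (fps_mul (fps_exp (fps_1mXV m) 3) (fps_1mXV ((4 * k + 2) * m))).

Definition Delta (k : nat) : nat -> int := fps_prod (brokenDiamond_factor k).

Lemma fps_1mX_eq1_below (m p : nat) : (m <= p)%N -> fps_eq1_below m (fps_1mX p).
Proof.
by move=> mp i im; rewrite /fps_1mX (ltn_eqF (leq_trans im mp)) subr0.
Qed.

Lemma fps_1mXV_eq1_below (m p : nat) :
  (m <= p)%N -> fps_eq1_below m (fps_1mXV p).
Proof.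
move=> mp [|i] im; rewrite /fps_1mXV /fps_one ?dvdn0//.
by rewrite gtnNdvd// (leq_trans im mp).
Qed.

Lemma brokenDiamond_factor_eq1_below (k m : nat) :
  fps_eq1_below m (brokenDiamond_factor k m).
Proof.
have le c : (m <= c.+1 * m)%N by rewrite leq_pmull.
have one : fps_eq1_below m fps_one by [].
have V := fps_1mXV_eq1_below (leqnn m).
rewrite /brokenDiamond_factor addn1 addn2.
apply: fps_eq1_belowM; apply: fps_eq1_belowM.
- exact: fps_1mX_eq1_below.
- exact: fps_1mX_eq1_below.
- by do 3 apply: fps_eq1_belowM => //.
- exact: fps_1mXV_eq1_below.
Qed.

Lemma Delta_pprod (k n N : nat) : (n <= N)%N ->
  fps_pprod (brokenDiamond_factor k) N n = Delta k n.
Proof.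
by apply: fps_pprod_stable => m _; exact: brokenDiamond_factor_eq1_below.
Qed.

Definition xk (R : realType) (k n : nat) : R :=
  pi * Num.sqrt (24 * n%:R - (2 * k%:R + 2)) / 6.

Definition Gamma (R : realType) (z : R) : R :=
  Rintegral lebesgue_measure `]0, +oo[%classic
    (fun t => t `^ (z - 1) * expR (- t)).

(* Meaningful for 0 < s only: powR is not the real power for a negative base. *)
Definition besselI (R : realType) (nu s : R) : R :=
  limn (series (fun r : nat =>
    (r`!%:R * Gamma (r%:R + nu + 1))^-1 * (s / 2) `^ (2 * r%:R + nu))).

(* Main.v *)
Require Import Defs.
From HB Require Import structures.
From mathcomp Require Import all_boot all_order all_algebra.
From mathcomp Require Import all_classical all_reals all_analysis.
From mathcomp Require Import measurable_realfun.
From mathcomp Require Import complex ring lra zify.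

Set Implicit Arguments.
Unset Strict Implicit.
Unset Printing Implicit Defensive.

Import Order.TTheory GRing.Theory Num.Theory.
Import numFieldNormedType.Exports.

Local Open Scope classical_set_scope.
Local Open Scope ring_scope.

(* With q = e^{-z}, the logarithm of the generating function is a combination of the series
   f(w) = sum_l 1 / (l (e^{lw} - 1)) at w = z, 2z, (2k+1)z, (4k+2)z.  The partial fraction
   expansion of 1 / (e^w - 1) and an exchange of a double sum give the modular transformation
     f(z) = (pi^2 / 6) / z - z / 24 + log (z / 2 pi) / 2 + f(4 pi^2 / z),
   so that for Re (1/z) >= 1 the generating function is e^{- nu z} (z / 2 pi) e^{A / z} + O(1)
   with A = (pi^2 / 6) (5k+2) / (2k+1) and nu = (2k+2) / 24.  The Bessel terms have a generating
   function with the same behaviour there.  For Re (1/z) <= 1 both are O(e^{B / Re z}) for some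
   B < A / 4: split the logarithm as sum_l kap_l / l * Re (1 / (e^{lz} - 1)), where the terms
   l = 1 and, for k = 2, one of l = 2, 3 are bounded, and each other one is at most
   |kap_l| / (l^2 Re z).  Cauchy's estimate on the circle |q| = e^{-y} bounds the difference of the
   coefficients by O(e^{n y + B / y}), and y = sqrt (B / n) gives an exponent 2 sqrt (B n) which
   is smaller than that of the error term, sqrt (A n), by a constant factor. *)

(** Comparing two generating functions avoids integration along an arc and any asymptotics of the
    Bessel function: the Bessel terms are chosen so that their generating function has the singular
    part (z / 2 pi) e^{A/z} at z = 0. Where Re (1/z) >= 1, the transformed series contribute e^{A/z}
    (e^h - 1) with h = O(e^{- c Re (1/z)}) and c = 4 pi^2 / (4k+2). This stays bounded because A <=
    c, which is an equality for k = 2. The other singularities of the unit circle need no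
    transformation of their own: the exponent of the error term is half that of the main term, so a
    crude bound suffices there, provided that its constant is below A / 4. This makes the numerical
    value of pi^2 / 6 matter. The obstacle in the modular transformation is that the double series
    of a / (a^2 l^2 + j^2), which is symmetric under (a, l, j) -> (1/a, j, l), diverges
    logarithmically. The term log (z / 2 pi) / 2 is the discrepancy left by two different
    rectangular cutoffs. *)

Notation re := complex.Re.
Notation im := complex.Im.
Notation normc := Normc.normc.

(** * Modulus, real and imaginary parts of complex numbers *)

Section ComplexModulus.
Variable R : realType.
Local Notation C := R[i].
Implicit Types (x y z : C) (r s : R).

Lemma normc_ge0 z : 0 <= normc z.
Proof. by case: z => a b; exact: sqrtr_ge0. Qed.

Lemma normcD x y : normc (x + y) <= normc x + normc y.
Proof. exact: le_normcD. Qed.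

Lemma normcN x : normc (- x) = normc x.
Proof. exact: complex.normcN. Qed.

Lemma normcBC x y : normc (x - y) = normc (y - x).
Proof. by rewrite -normcN opprB. Qed.

Lemma normcB x y : normc (x - y) <= normc x + normc y.
Proof. by rewrite -(normcN y) normcD. Qed.

Lemma normcB_ge x y : normc x - normc y <= normc (x - y).
Proof. by rewrite lerBlDr -{1}(subrK y x) normcD. Qed.

Lemma normcM x y : normc (x * y) = normc x * normc y.
Proof. exact: Normc.normcM. Qed.

Lemma normcV x : normc x^-1 = (normc x)^-1.
Proof. exact: Normc.normcV. Qed.

Lemma normc0 : normc (0 : C) = 0.
Proof. exact: Normc.normc0. Qed.

Lemma normc1 : normc (1 : C) = 1.
Proof. exact: Normc.normc1. Qed.

Lemma normc_eq0 x : (normc x == 0) = (x == 0).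
Proof. by apply/eqP/eqP => [/Normc.eq0_normc//|->]; rewrite normc0. Qed.

Lemma normc_gt0 x : (0 < normc x) = (x != 0).
Proof. by rewrite lt_neqAle normc_ge0 andbT eq_sym normc_eq0. Qed.

Lemma normcX x n : normc (x ^+ n) = normc x ^+ n.
Proof. by elim: n => [|n IH]; rewrite ?expr0 ?normc1// !exprS normcM IH. Qed.

Lemma normcR r : normc r%:C%C = `|r|.
Proof. by rewrite /= expr0n /= addr0 sqrtr_sqr. Qed.

Lemma normcR_ge0 r : 0 <= r -> normc r%:C%C = r.
Proof. by move=> r0; rewrite normcR ger0_norm. Qed.

Lemma realc_nat n : (n%:R : R)%:C%C = n%:R :> C.
Proof. exact: rmorph_nat. Qed.

Lemma normc_nat n : normc (n%:R : C) = n%:R.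
Proof. by rewrite -realc_nat normcR_ge0. Qed.

Lemma normc_sum (I : Type) (l : seq I) (P : pred I) (F : I -> C) :
  normc (\sum_(i <- l | P i) F i) <= \sum_(i <- l | P i) normc (F i).
Proof.
elim/big_ind2: _ => [|a b c d ab cd|//]; first by rewrite normc0.
exact: le_trans (normcD _ _) (lerD ab cd).
Qed.

Lemma normc_sqr z : normc z ^+ 2 = re z ^+ 2 + im z ^+ 2.
Proof. by case: z => a b /=; rewrite sqr_sqrtr// addr_ge0 ?sqr_ge0. Qed.

Lemma normr_re_le z : `|re z| <= normc z.
Proof.
case: z => a b /=; rewrite -sqrtr_sqr ler_sqrt ?lerDl ?sqr_ge0//.
by rewrite addr_ge0 ?sqr_ge0.
Qed.

Lemma normr_im_le z : `|im z| <= normc z.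
Proof.
case: z => a b /=; rewrite -sqrtr_sqr ler_sqrt ?lerDr ?sqr_ge0//.
by rewrite addr_ge0 ?sqr_ge0.
Qed.

Lemma re_le_normc z : re z <= normc z.
Proof. exact: le_trans (ler_norm _) (normr_re_le z). Qed.

Lemma reD x y : re (x + y) = re x + re y.
Proof. by case: x => a b; case: y. Qed.

Lemma imD x y : im (x + y) = im x + im y.
Proof. by case: x => a b; case: y. Qed.

Lemma reN x : re (- x) = - re x.
Proof. by case: x. Qed.

Lemma imN x : im (- x) = - im x.
Proof. by case: x. Qed.

Lemma reB x y : re (x - y) = re x - re y.
Proof. by rewrite reD reN. Qed.

Lemma imB x y : im (x - y) = im x - im y.
Proof. by rewrite imD imN. Qed.

Lemma reM x y : re (x * y) = re x * re y - im x * im y.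
Proof. by case: x => a b; case: y. Qed.

Lemma imM x y : im (x * y) = re x * im y + im x * re y.
Proof. by case: x => a b; case: y. Qed.

Lemma re_sum (I : Type) (l : seq I) (P : pred I) (F : I -> C) :
  re (\sum_(i <- l | P i) F i) = \sum_(i <- l | P i) re (F i).
Proof. by elim/big_ind2: _ => // a b c d <- <-; rewrite reD. Qed.

Lemma im_sum (I : Type) (l : seq I) (P : pred I) (F : I -> C) :
  im (\sum_(i <- l | P i) F i) = \sum_(i <- l | P i) im (F i).
Proof. by elim/big_ind2: _ => // a b c d <- <-; rewrite imD. Qed.

Lemma rmulE r z : r%:C%C * z = (r * re z +i* (r * im z))%C.
Proof. by case: z => a b; congr Complex => /=; ring. Qed.

Lemma re_rmul r z : re (r%:C%C * z) = r * re z.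
Proof. by rewrite rmulE. Qed.

Lemma im_rmul r z : im (r%:C%C * z) = r * im z.
Proof. by rewrite rmulE. Qed.

Lemma reV z : re z^-1 = re z / normc z ^+ 2.
Proof. by rewrite normc_sqr; case: z => a b. Qed.

Lemma imV z : im z^-1 = - im z / normc z ^+ 2.
Proof. by rewrite normc_sqr; case: z => a b /=; rewrite mulNr. Qed.

Lemma re_gt0_neq0 z : 0 < re z -> z != 0.
Proof. by move=> z0; apply/eqP => zE; move: z0; rewrite zE ltxx. Qed.

Lemma reV_gt0 z : 0 < re z -> 0 < re z^-1.
Proof.
move=> z0; rewrite reV divr_gt0// exprn_gt0// normc_gt0.
exact: re_gt0_neq0.
Qed.

Lemma complex_ext z w : re z = re w -> im z = im w -> z = w.
Proof. by case: z => a b; case: w => c d /= -> ->. Qed.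

End ComplexModulus.

Lemma sum_ord_cat (V : zmodType) (u : nat -> V) (J m : nat) : (J <= m)%N ->
  \sum_(i < m) u i = \sum_(i < J) u i + \sum_(J <= i < m) u i.
Proof. by move=> Jm; rewrite -!(big_mkord predT u) [LHS](big_cat_nat _ Jm). Qed.

(** * Limits and series of complex numbers, dominated convergence, exchange of double sums *)

Section Limits.
Variable R : realType.
Local Notation C := R[i].
Implicit Types (u v : nat -> C) (l : C).

(** Only an upper bound: it is applied to moduli and to majorants of moduli, so no absolute value is
    needed. *)
Definition rlim0 (v : nat -> R) :=
  forall e : R, 0 < e -> exists N, forall n, (N <= n)%N -> v n <= e.

Definition clim u l := rlim0 (fun n => normc (u n - l)).

Lemma rlim0D (v w : nat -> R) : rlim0 v -> rlim0 w -> rlim0 (fun n => v n + w n).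
Proof.
move=> v0 w0 e e0; have e2 : 0 < e / 2 by lra.
have [N1 h1] := v0 _ e2; have [N2 h2] := w0 _ e2.
exists (maxn N1 N2) => n; rewrite geq_max => /andP[n1 n2].
by have := h1 n n1; have := h2 n n2; lra.
Qed.

Lemma rlim0_le (N0 : nat) (v w : nat -> R) :
  (forall n, (N0 <= n)%N -> v n <= w n) -> rlim0 w -> rlim0 v.
Proof.
move=> vw w0 e e0; have [N h] := w0 _ e0.
exists (maxn N N0) => n; rewrite geq_max => /andP[n1 n2].
exact: le_trans (vw n n2) (h n n1).
Qed.

Lemma rlim0Z (k : R) (v : nat -> R) : 0 <= k -> rlim0 v -> rlim0 (fun n => k * v n).
Proof.
move=> k0 v0 e e0; have [|N h] := v0 (e / (k + 1)); first by apply: divr_gt0; lra.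
exists N => n Nn; have := h n Nn.
rewrite ler_pdivlMr; last lra.
move=> h1; have [vp|vn] := leP 0 (v n); first by nra.
by apply: le_trans (ltW e0); rewrite mulr_ge0_le0// ltW.
Qed.

Lemma rlim0_invn (k : R) : rlim0 (fun n => k / n.+1%:R).
Proof.
move=> e e0; exists (Num.bound (k / e)) => n Nn.
have [k0|k0] := leP 0 k; last first.
  by apply: le_trans (ltW e0); rewrite pmulr_lle0 ?invr_gt0 ?ltr0n// ltW.
rewrite ler_pdivrMr ?ltr0n// -ler_pdivrMl// mulrC.
have := archi_boundP (divr_ge0 k0 (ltW e0)) => /ltW h.
by apply: le_trans h _; rewrite ler_nat leqW.
Qed.

Lemma bernoulli_le (x : R) n : 0 <= x -> 1 + n%:R * x <= (1 + x) ^+ n.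
Proof.
move=> x0; elim: n => [|n IH]; first by rewrite mul0r addr0 expr0.
rewrite exprS -natr1; have : 0 <= n%:R :> R by []. nra.
Qed.

(** Bernoulli's inequality for 1 / r = 1 + x. The case [n = 0] is apart because division by zero
    gives 0 there. *)
Lemma geo_le_invn (r : R) n : 0 < r < 1 -> r ^+ n <= (r^-1 - 1)^-1 / n%:R \/ n = 0%N.
Proof.
move=> /andP[r0 r1]; case: n => [|n]; [by right | left].
have x0 : 0 < r^-1 - 1 by rewrite subr_gt0 invf_gt1.
have := bernoulli_le n.+1 (ltW x0); rewrite [X in _ <= X ^+ _]addrC subrK => h.
rewrite -invfM -[leLHS]invrK -exprVn lef_pV2 ?posrE; last 2 first.
- by rewrite exprn_gt0// invr_gt0.
- by rewrite mulr_gt0// ltr0n.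
by rewrite mulrC; apply: le_trans h; lra.
Qed.

Lemma rlim0_geo (k r : R) : 0 <= r < 1 -> rlim0 (fun n => k * r ^+ n).
Proof.
move=> /andP[r0 r1].
have [->|rn0] := eqVneq r 0.
  move=> e e0; exists 1%N => n n1; rewrite expr0n (gtn_eqF n1) mulr0; exact: ltW.
have rp : 0 < r < 1 by rewrite r1 lt_neqAle eq_sym rn0 r0.
have x0 : 0 < r^-1 - 1 by rewrite subr_gt0 invf_gt1//; case/andP: rp.
apply: (@rlim0_le 1 _ (fun n => `|k| * (2 * (r^-1 - 1)^-1 / n.+1%:R))); last first.
  by apply: rlim0Z => //; exact: rlim0_invn.
move=> n n1; apply: le_trans (ler_wpM2r _ (ler_norm k)) _; first by rewrite exprn_ge0.
rewrite ler_wpM2l//; have [h|/eqP] := geo_le_invn n rp; last by rewrite gtn_eqF.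
apply: le_trans h _; rewrite [2 * _]mulrC -mulrA ler_wpM2l ?invr_ge0 ?(ltW x0)//.
rewrite ler_pdivlMr ?ltr0n// ler_pdivrMl ?ltr0n// mulr_natr -mulrnA ler_nat.
by rewrite muln2 -addnn -addn1 leq_add2l.
Qed.

Lemma clim_eq (N0 : nat) u v l :
  (forall n, (N0 <= n)%N -> u n = v n) -> clim u l -> clim v l.
Proof. by move=> uv; apply: (@rlim0_le N0) => n /uv ->. Qed.

Lemma clim_cst l : clim (fun=> l) l.
Proof. by move=> e e0; exists 0%N => n _; rewrite subrr normc0 ltW. Qed.

Lemma climD u v l m : clim u l -> clim v m -> clim (fun n => u n + v n) (l + m).
Proof.
move=> ul vm; apply: (@rlim0_le 0) (rlim0D ul vm) => n _.
by rewrite opprD addrACA normcD.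
Qed.

Lemma climZ (k : C) u l : clim u l -> clim (fun n => k * u n) (k * l).
Proof.
move=> ul; apply: (@rlim0_le 0) (rlim0Z (normc_ge0 k) ul) => n _.
by rewrite -mulrBr normcM.
Qed.

Lemma climN u l : clim u l -> clim (fun n => - u n) (- l).
Proof. by apply: (@rlim0_le 0) => n _; rewrite -opprD normcN. Qed.

Lemma climB u v l m : clim u l -> clim v m -> clim (fun n => u n - v n) (l - m).
Proof. by move=> ul /climN; exact: climD. Qed.

Lemma climM u v l m : clim u l -> clim v m -> clim (fun n => u n * v n) (l * m).
Proof.
move=> ul vm.
have b1 : 0 <= normc l + 1 by rewrite addr_ge0 ?normc_ge0.
have [N hN] := ul 1 ltr01.
apply: (@rlim0_le N) (rlim0D (rlim0Z b1 vm) (rlim0Z (normc_ge0 m) ul)) => n Nn.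
have -> : u n * v n - l * m = u n * (v n - m) + m * (u n - l) by ring.
apply: le_trans (normcD _ _) _; rewrite !normcM lerD2r ler_wpM2r ?normc_ge0//.
have := hN n Nn; have := normcB_ge (u n) l; lra.
Qed.

Lemma clim_sum (J : nat) (a : nat -> nat -> C) (b : nat -> C) :
  (forall j, (j < J)%N -> clim (a^~ j) (b j)) ->
  clim (fun n => \sum_(j < J) a n j) (\sum_(j < J) b j).
Proof.
elim: J => [_|J IH h].
  by rewrite big_ord0; apply: (@clim_eq 0) (clim_cst 0) => n _; rewrite big_ord0.
rewrite big_ord_recr /=; apply: (@clim_eq 0 (fun n => \sum_(j < J) a n j + a n J)).
  by move=> n _; rewrite big_ord_recr.
by apply: climD; [apply: IH => j jJ; exact: h (ltnW jJ) | exact: h].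
Qed.

Lemma clim_norm_le (N0 : nat) u l (B : R) :
  (forall n, (N0 <= n)%N -> normc (u n) <= B) -> clim u l -> normc l <= B.
Proof.
move=> uB ul; rewrite leNgt; apply/negP => Bl.
have [|N h] := ul ((normc l - B) / 2); first lra.
have /h := leq_maxl N N0; have /uB := leq_maxr N N0.
set n := maxn _ _; rewrite normcBC; have := normcB_ge l (u n); lra.
Qed.

Lemma clim_unique u l m : clim u l -> clim u m -> l = m.
Proof.
move=> ul um; apply/eqP; rewrite -subr_eq0 -normc_eq0 eq_le normc_ge0 andbT.
apply: (@clim_norm_le 0 (fun n => u n - u n) _ 0); last exact: climB.
by move=> n _; rewrite subrr normc0.
Qed.

Lemma clim_re_le (N0 : nat) u l (B : R) :
  (forall n, (N0 <= n)%N -> re (u n) <= B) -> clim u l -> re l <= B.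
Proof.
move=> uB ul; rewrite leNgt; apply/negP => Bl.
have [|N h] := ul ((re l - B) / 2); first lra.
have /h := leq_maxl N N0; have /uB := leq_maxr N N0.
set n := maxn _ _; rewrite normcBC; have := re_le_normc (l - u n).
rewrite reB; lra.
Qed.

Lemma clim_sub (g : nat -> nat) u l :
  (forall n, (n <= g n)%N) -> clim u l -> clim (u \o g) l.
Proof.
move=> gn ul e e0; have [N h] := ul e e0; exists N => n Nn /=.
by apply: h; exact: leq_trans (gn n).
Qed.

Definition has_csum u l := clim (fun n => \sum_(i < n) u i) l.

(** Absolute convergence, encoded by bounded partial sums so that comparisons need no limit. *)
Definition csummable u := exists B : R, forall n, \sum_(i < n) normc (u i) <= B.

(** The default value is 0 when there is no sum; [csumP] is the only access to the actual value. *)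
Definition csum u : C := xget 0 [set l | has_csum u l].

Lemma has_csum_unique u l m : has_csum u l -> has_csum u m -> l = m.
Proof. exact: clim_unique. Qed.

Lemma rcvg_clim (w : nat -> R) : cvgn w -> clim (fun n => (w n)%:C%C) (limn w)%:C%C.
Proof.
move=> cw e e0; move/cvgrPdist_le : cw => /(_ e e0)[N _ h]; exists N => n Nn.
by rewrite -rmorphB normcR distrC; exact: h.
Qed.

Lemma ler_sum_nonneg (v : nat -> R) (n m : nat) : (forall i, 0 <= v i) ->
  (n <= m)%N -> \sum_(i < n) v i <= \sum_(i < m) v i.
Proof.
move=> v0 nm; rewrite (sum_ord_cat _ nm).
by rewrite lerDl sumr_ge0.
Qed.

Lemma real_abs_cvg (v : nat -> R) (B : R) : (forall n, \sum_(i < n) `|v i| <= B) ->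
  cvgn (series v).
Proof.
move=> vB; apply: normed_cvg.
have -> : [normed series v] = (fun n => \sum_(i < n) `|v i|).
  by apply/funext => n; rewrite /= /series /= big_mkord.
apply: nondecreasing_is_cvgn.
  move=> n m nm; exact: (@ler_sum_nonneg (fun i => `|v i|)).
by exists B => _ [n _ <-].
Qed.

Lemma csummable_ex u : csummable u -> exists l, has_csum u l.
Proof.
move=> [B uB].
have cr : cvgn (series (fun i => re (u i))).
  apply: (@real_abs_cvg _ B) => n; apply: le_trans (uB n).
  by apply: ler_sum => i _; exact: normr_re_le.
have ci : cvgn (series (fun i => im (u i))).
  apply: (@real_abs_cvg _ B) => n; apply: le_trans (uB n).
  by apply: ler_sum => i _; exact: normr_im_le.
exists ((limn (series (fun i => re (u i))))%:C%C
        + 'i%C * (limn (series (fun i => im (u i))))%:C%C).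
apply: (clim_eq (N0 := 0)) (climD (rcvg_clim cr) (climZ 'i%C (rcvg_clim ci))) => n _.
by rewrite [RHS]complexE re_sum im_sum /series /= !big_mkord.
Qed.

Lemma csumP u : csummable u -> has_csum u (csum u).
Proof. by move=> /csummable_ex[l ul]; rewrite /csum; case: xgetP => [? ->//|/(_ l)]. Qed.

Lemma has_csum_norm_le u l (B : R) :
  (forall n, \sum_(i < n) normc (u i) <= B) -> has_csum u l -> normc l <= B.
Proof.
by move=> uB; apply: (@clim_norm_le 0) => n _; exact: le_trans (normc_sum _ _ _) (uB n).
Qed.

Lemma has_csum_finite u N : (forall j, (N <= j)%N -> u j = 0) ->
  has_csum u (\sum_(i < N) u i).
Proof.
move=> u0; apply: (@clim_eq N) (clim_cst _) => n Nn.
rewrite (sum_ord_cat _ Nn) [X in _ + X]big_nat_cond.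
by rewrite [X in _ + X]big1 ?addr0// => i; rewrite andbT => /andP[/u0].
Qed.

Lemma has_csumD u v l m : has_csum u l -> has_csum v m ->
  has_csum (fun i => u i + v i) (l + m).
Proof. by move=> ul vm; apply: (clim_eq (N0 := 0)) (climD ul vm) => n _; rewrite big_split. Qed.

Lemma has_csumZ (k : C) u l : has_csum u l -> has_csum (fun i => k * u i) (k * l).
Proof. by move=> ul; apply: (clim_eq (N0 := 0)) (climZ k ul) => n _; rewrite mulr_sumr. Qed.

Lemma has_csumN u l : has_csum u l -> has_csum (fun i => - u i) (- l).
Proof. by move=> ul; apply: (clim_eq (N0 := 0)) (climN ul) => n _; rewrite sumrN. Qed.

Lemma has_csumB u v l m : has_csum u l -> has_csum v m ->
  has_csum (fun i => u i - v i) (l - m).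
Proof. by move=> ul /has_csumN; exact: has_csumD. Qed.

Lemma has_csum_sum (J : nat) (a : nat -> nat -> C) (b : nat -> C) :
  (forall j, (j < J)%N -> has_csum (a j) (b j)) ->
  has_csum (fun i => \sum_(j < J) a j i) (\sum_(j < J) b j).
Proof.
move=> h; apply: (clim_eq (N0 := 0)) (clim_sum (a := fun n j => \sum_(i < n) a j i) h) => n _.
by rewrite exchange_big.
Qed.

Lemma has_csum_shift (p : nat) u l : has_csum u l ->
  has_csum (fun i => u (p + i)%N) (l - \sum_(i < p) u i).
Proof.
move=> ul; apply: (clim_eq (N0 := 0) _ (climB (clim_sub (g := addn p) _ ul) (clim_cst _))).
  by move=> n _ /=; rewrite big_split_ord /= [X in X - _]addrC addrK.
by move=> n; exact: leq_addl.
Qed.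

Lemma has_csum_unshift (p : nat) u l : has_csum (fun i => u (p + i)%N) l ->
  has_csum u (\sum_(i < p) u i + l).
Proof.
move=> ul e e0; have [N h] := ul e e0; exists (p + N)%N => n pn.
have -> : n = (p + (n - p))%N by rewrite subnKC// (leq_trans (leq_addr _ _) pn).
rewrite big_split_ord /= opprD addrACA subrr add0r; apply: h.
by rewrite leq_subRL// (leq_trans (leq_addr _ _) pn).
Qed.

Lemma has_csum_pad (p : nat) u l : has_csum u l ->
  has_csum (fun i => if (i < p)%N then 0 else u (i - p)%N) l.
Proof.
move=> ul; set w := (fun i => _).
have w0 : \sum_(i < p) w i = 0 by rewrite big1// => i _; rewrite /w ltn_ord.
rewrite -[l]add0r -w0; apply: has_csum_unshift.
apply: (clim_eq (N0 := 0)) ul => n _.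
by apply: eq_bigr => i _; rewrite /w ltnNge leq_addr /= addKn.
Qed.

Lemma eq_has_csum u v l : (forall i, u i = v i) -> has_csum u l -> has_csum v l.
Proof. by move=> /funext ->. Qed.

Lemma csummable_le u (v : nat -> R) (B : R) : (forall i, normc (u i) <= v i) ->
  (forall n, \sum_(i < n) v i <= B) -> csummable u.
Proof. by move=> uv vB; exists B => n; apply: le_trans (vB n); apply: ler_sum. Qed.

Lemma bounded_tail (v : nat -> R) (B e : R) : (forall i, 0 <= v i) ->
  (forall n, \sum_(i < n) v i <= B) -> 0 < e ->
  exists J, forall m, (J <= m)%N -> \sum_(i < m) v i - \sum_(i < J) v i <= e.
Proof.
move=> v0 vB e0.
have cv : cvgn (series v).
  by apply: (@real_abs_cvg _ B) => n; under eq_bigr do rewrite ger0_norm//.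
have [|J hJ] := rcvg_clim cv (e := e / 2); first lra.
exists J => m Jm; have := hJ m Jm; have := hJ J (leqnn J).
rewrite -!rmorphB !normcR /series /= !big_mkord.
rewrite !ler_norml => /andP[? ?] /andP[? ?]; lra.
Qed.

Lemma has_csum_tail_le u l (v : nat -> R) (J : nat) (e : R) :
  (forall i, normc (u i) <= v i) ->
  (forall m, (J <= m)%N -> \sum_(i < m) v i - \sum_(i < J) v i <= e) ->
  has_csum u l -> normc (l - \sum_(i < J) u i) <= e.
Proof.
move=> uv ve ul.
apply: (@clim_norm_le J (fun m => \sum_(i < m) u i - \sum_(i < J) u i)); last first.
  exact: climB ul (clim_cst _).
move=> m Jm; apply: le_trans (ve m Jm).
rewrite !(sum_ord_cat _ Jm) [X in normc (X - _)]addrC addrK [X in _ <= X - _]addrC addrK.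
by apply: le_trans (normc_sum _ _ _) _; apply: ler_sum.
Qed.


(** Dominated convergence for series. A rank [J] makes the tails of both [a n] and [b] at most e /
    4, since both are dominated by [v]; the first [J] terms converge one by one. *)
Lemma tannery (N0 : nat) (a : nat -> nat -> C) (b s : nat -> C) (l : C)
    (v : nat -> R) (B : R) :
  (forall n j, (N0 <= n)%N -> normc (a n j) <= v j) ->
  (forall n, \sum_(j < n) v j <= B) ->
  (forall j, clim (a^~ j) (b j)) ->
  (forall n, (N0 <= n)%N -> has_csum (a n) (s n)) ->
  has_csum b l -> clim s l.
Proof.
move=> av vB ab asn bl e e0.
have v0 i : 0 <= v i by exact: le_trans (normc_ge0 _) (av N0 i (leqnn _)).
have bv i : normc (b i) <= v i by apply: (clim_norm_le (N0 := N0)) (ab i) => n Nn; exact: av.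
have e4 : 0 < e / 4 by lra.
have [J hJ] := bounded_tail v0 vB e4.
have [N hN] := clim_sum (fun j (_ : (j < J)%N) => ab j) e4.
exists (maxn N N0) => n; rewrite geq_max => /andP[n1 n2].
have h1 := has_csum_tail_le (av n ^~ n2) hJ (asn n n2).
have h2 := has_csum_tail_le bv hJ bl.
have h3 := hN n n1.
have -> : s n - l = (s n - \sum_(j < J) a n j) +
   ((\sum_(j < J) a n j - \sum_(j < J) b j) - (l - \sum_(j < J) b j)) by ring.
have := normcD (s n - \sum_(j < J) a n j)
   ((\sum_(j < J) a n j - \sum_(j < J) b j) - (l - \sum_(j < J) b j)).
have := normcB (\sum_(j < J) a n j - \sum_(j < J) b j) (l - \sum_(j < J) b j).
lra.
Qed.

(** Fubini for absolutely summable double series, obtained from [tannery]: the partial sums over the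
    rows are, column by column, dominated by the column sums of moduli. *)
Lemma csum_exchange (a : nat -> nat -> C) (r c : nat -> C) (B : R) :
  (forall I J, \sum_(i < I) \sum_(j < J) normc (a i j) <= B) ->
  (forall i, has_csum (a i) (r i)) -> (forall j, has_csum (a^~ j) (c j)) ->
  exists l, has_csum r l /\ has_csum c l.
Proof.
move=> aB ar ac.
pose nn i j : C := (normc (a i j))%:C%C.
have nE i j : normc (nn i j) = normc (a i j) by rewrite normcR_ge0 ?normc_ge0.
have sn j : csummable (nn^~ j).
  exists B => n; under eq_bigr do rewrite nE.
  apply: le_trans (aB n j.+1); apply: ler_sum => i _.
  by rewrite big_ord_recr /= lerDr sumr_ge0// => k _; exact: normc_ge0.
(* The sum of the moduli in column [j], taken as a complex sum whose imaginary part is shown to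
   vanish. *)
pose v j := re (csum (nn^~ j)).
have lev n j : \sum_(i < n) normc (a i j) <= v j.
  have : normc (csum (nn^~ j) - \sum_(i < n) nn i j) <= v j - \sum_(i < n) normc (a i j).
    rewrite /v; have -> : \sum_(i < n) normc (a i j) = re (\sum_(i < n) nn i j).
      by rewrite re_sum.
    rewrite -reB; have := has_csum_shift n (csumP (sn j)).
    set X := _ - _ => hX; have imX : im X = 0.
      apply: (@complexI R); apply: clim_unique (clim_cst _).
      move=> e e0; have [N h] := hX e e0; exists N => m Nm.
      rewrite -rmorphB normcR; apply: le_trans (h m Nm).
      rewrite normcBC; apply: le_trans (normr_im_le _).
      by rewrite sub0r normrN (imB X) im_sum [X in _ - X]big1// subr0.
    have -> : X = (re X)%:C%C by apply: complex_ext.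
    rewrite normcR ger0_norm//.
    rewrite -oppr_le0 -reN; apply: (clim_re_le (N0 := 0)) (climN hX) => m _.
    rewrite reN re_sum oppr_le0 sumr_ge0// => i _; exact: normc_ge0.
  by have := normc_ge0 (csum (nn^~ j) - \sum_(i < n) nn i j); lra.
have vB J : \sum_(j < J) v j <= B.
  have -> : \sum_(j < J) v j = re (\sum_(j < J) csum (nn^~ j)) by rewrite re_sum.
  apply: (clim_re_le (N0 := 0)) (clim_sum (a := fun n j => \sum_(i < n) nn i j)
     (fun j (_ : (j < J)%N) => csumP (sn j))) => n _.
  by rewrite re_sum; under eq_bigr do rewrite re_sum; rewrite exchange_big; exact: aB.
have cv j : normc (c j) <= v j.
  apply: (clim_norm_le (N0 := 0)) (ac j) => n _.
  exact: le_trans (normc_sum _ _ _) (lev n j).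
have hc : csummable c by exists B => n; apply: le_trans (vB n); apply: ler_sum.
exists (csum c); split; last exact: csumP.
apply: (tannery (N0 := 0) (a := fun n j => \sum_(i < n) a i j) _ vB ac) => [n j _|n _|].
- exact: le_trans (normc_sum _ _ _) (lev n j).
- by apply: has_csum_sum => i _; exact: ar.
- exact: csumP.
Qed.

(** [csum_exchange] for the triangular array [a i n] that is zero for n < i: row [i] is a shifted
    copy of [g] times [f i], and each column is a finite sum. *)
Lemma cauchy_product (f g : nat -> C) (F G : C) :
  csummable f -> csummable g -> has_csum f F -> has_csum g G ->
  has_csum (fun n => \sum_(i < n.+1) f i * g (n - i)%N) (F * G).
Proof.
move=> [Bf fB] [Bg gB] fF gG.
pose a i n := if (n < i)%N then 0 else f i * g (n - i)%N.
have [|i|n|l [h1 h2]] := @csum_exchange a (fun i => f i * G)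
    (fun n => \sum_(i < n.+1) f i * g (n - i)%N) (Bf * Bg).
- move=> I J.
  have gB0 : 0 <= Bg by apply: le_trans (gB 0%N); rewrite big_ord0.
  apply: le_trans (ler_wpM2r gB0 (fB I)); rewrite mulr_suml.
  apply: ler_sum => i _; apply: le_trans (_ : \sum_(j < (i + J)%N) normc (a i j) <= _).
    by apply: (@ler_sum_nonneg (fun j => normc (a i j))) (leq_addl _ _) => j; exact: normc_ge0.
  rewrite big_split_ord /= big1 ?add0r; last by move=> j _; rewrite /a ltn_ord normc0.
  apply: le_trans (ler_wpM2l (normc_ge0 _) (gB J)); rewrite mulr_sumr.
  by apply: ler_sum => j _; rewrite /a ltnNge leq_addr /= addKn normcM.
- apply: (eq_has_csum _ (has_csum_pad i (has_csumZ (f i) gG))) => n.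
  by rewrite /a.
- have -> : \sum_(i < n.+1) f i * g (n - i)%N = \sum_(i < n.+1) a i n.
    by apply: eq_bigr => i _; rewrite /a ltnNge -ltnS ltn_ord.
  by apply: has_csum_finite => j jn; rewrite /a jn.
have h3 : has_csum (fun i => f i * G) (F * G).
  by rewrite mulrC; apply: eq_has_csum (has_csumZ G fF) => i; rewrite mulrC.
by rewrite (has_csum_unique h3 h1).
Qed.

End Limits.

(** * Derivatives of complex curves with a real parameter, and the mean value inequality *)

Section Derivative.
Variable R : realType.
Local Notation C := R[i].

Definition cder (h : R -> C) (t : R) (d : C) :=
  is_derive t 1 (fun s => re (h s)) (re d) /\ is_derive t 1 (fun s => im (h s)) (im d).

Lemma cder_eq (h g : R -> C) t d d' : (forall s, h s = g s) -> d = d' ->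
  cder h t d -> cder g t d'.
Proof. by move=> /funext -> ->. Qed.

Lemma cder_cst (c : C) t : cder (fun=> c) t 0.
Proof. by split; exact: is_derive_cst. Qed.

Lemma cder_id t : cder (fun s => s%:C%C) t 1.
Proof. by split; [exact: is_derive_id | exact: is_derive_cst]. Qed.

Lemma cderD h g t d e : cder h t d -> cder g t e ->
  cder (fun s => h s + g s) t (d + e).
Proof.
move=> [h1 h2] [g1 g2]; split; rewrite (reD, imD).
- have -> : (fun s => re (h s + g s)) = (fun s => re (h s)) + (fun s => re (g s)).
    by apply/funext => s; rewrite reD.
  exact: is_deriveD.
- have -> : (fun s => im (h s + g s)) = (fun s => im (h s)) + (fun s => im (g s)).
    by apply/funext => s; rewrite imD.
  exact: is_deriveD.
Qed.

Lemma cderM h g t d e : cder h t d -> cder g t e ->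
  cder (fun s => h s * g s) t (d * g t + h t * e).
Proof.
move=> [h1 h2] [g1 g2]; split.
- have -> : (fun s => re (h s * g s)) =
     (fun s => re (h s)) * (fun s => re (g s)) - (fun s => im (h s)) * (fun s => im (g s)).
    by apply/funext => s; rewrite reM.
  apply: is_derive_eq (is_deriveB (is_deriveM h1 g1) (is_deriveM h2 g2)) _.
  rewrite reD !reM /GRing.scale /=; ring.
- have -> : (fun s => im (h s * g s)) =
     (fun s => re (h s)) * (fun s => im (g s)) + (fun s => im (h s)) * (fun s => re (g s)).
    by apply/funext => s; rewrite imM.
  apply: is_derive_eq (is_deriveD (is_deriveM h1 g2) (is_deriveM h2 g1)) _.
  rewrite imD !imM /GRing.scale /=; ring.
Qed.

Lemma cderZ (k : C) h t d : cder h t d -> cder (fun s => k * h s) t (k * d).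
Proof.
move=> hd; apply: cder_eq (cderM (cder_cst k t) hd) => //.
by rewrite mul0r add0r.
Qed.

Lemma cderN h t d : cder h t d -> cder (fun s => - h s) t (- d).
Proof.
move=> /(cderZ (-1)); apply: cder_eq => [s|]; by rewrite mulN1r.
Qed.

Lemma cderB h g t d e : cder h t d -> cder g t e ->
  cder (fun s => h s - g s) t (d - e).
Proof. by move=> hd /cderN; exact: cderD. Qed.

Lemma cder_sum (n : nat) (h : nat -> R -> C) t (d : nat -> C) :
  (forall i, (i < n)%N -> cder (h i) t (d i)) ->
  cder (fun s => \sum_(i < n) h i s) t (\sum_(i < n) d i).
Proof.
elim: n => [_|n IH hd].
  by rewrite big_ord0; apply: cder_eq (cder_cst 0 t) => // s; rewrite big_ord0.
rewrite big_ord_recr /=.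
apply: cder_eq (cderD (IH _) (hd n (ltnSn n))) => [s|//|i ni].
  by rewrite big_ord_recr.
exact: hd (ltnW ni).
Qed.

Lemma cderX (n : nat) h t d : cder h t d ->
  cder (fun s => h s ^+ n.+1) t (n.+1%:R * h t ^+ n * d).
Proof.
move=> hd; elim: n => [|n IH]; first by apply: cder_eq hd => [//|]; rewrite expr0 !mul1r.
apply: cder_eq (cderM hd IH) => [s|]; first by rewrite -exprS.
by rewrite !exprS -[n.+2%:R]natr1; ring.
Qed.

Lemma cderV h t d : h t != 0 -> cder h t d ->
  cder (fun s => (h s)^-1) t (- d / h t ^+ 2).
Proof.
move=> h0 [h1 h2].
pose n2 := (fun s => re (h s)) * (fun s => re (h s)) +
           (fun s => im (h s)) * (fun s => im (h s)).
have n2E s : normc (h s) ^+ 2 = n2 s by rewrite normc_sqr /n2.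
have n20 : n2 t != 0 by rewrite -n2E expf_eq0/= normc_eq0.
have dn := is_deriveV n20 (is_deriveD (is_deriveM h1 h1) (is_deriveM h2 h2)).
have n20' : re (h t) * re (h t) + im (h t) * im (h t) != 0 by [].
have n2t : n2 t = re (h t) * re (h t) + im (h t) * im (h t) by [].
split.
- have -> : (fun s => re (h s)^-1) = (fun s => re (h s)) * (fun s => (n2 s)^-1).
    by apply/funext => s; rewrite reV n2E.
  apply: is_derive_eq (is_deriveM h1 dn) _.
  rewrite [h t ^+ 2]expr2 (invfM (h t)) !reM !imM !reV !imV reN imN n2E n2t /GRing.scale /=.
  by field.
- have -> : (fun s => im (h s)^-1) = - (fun s => im (h s)) * (fun s => (n2 s)^-1).
    by apply/funext => s; rewrite imV n2E.
  apply: is_derive_eq (is_deriveM (is_deriveN h2) dn) _.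
  rewrite [h t ^+ 2]expr2 (invfM (h t)) !imM !reM !reV !imV reN imN n2E n2t /GRing.scale /=.
  have -> : (- (fun s => im (h s))) t = - im (h t) by [].
  by field.
Qed.

Lemma mvt_le0 (f df : R -> R) : (forall t : R, 0 <= t <= 1 -> is_derive t 1 f (df t)) ->
  (forall t : R, 0 <= t <= 1 -> df t <= 0) -> f 1 <= f 0.
Proof.
move=> fd df0; have [||c] := @MVT R f df 0 1 ltr01.
- by move=> x; rewrite in_itv /= => /andP[x0 x1]; apply: fd; rewrite !ltW.
- apply: derivable_within_continuous => x; rewrite in_itv /= => x01.
  by have [] := fd x x01.
rewrite in_itv /= subr0 mulr1 => /andP[c0 c1] h.
by rewrite -subr_le0 h df0// !ltW.
Qed.

(* The real mean value theorem is applied to the component of [h] along [h 1 - h 0]. *)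
Lemma mean_value_le (h dh : R -> C) (g dg : R -> R) :
  (forall t : R, 0 <= t <= 1 -> cder h t (dh t)) ->
  (forall t : R, 0 <= t <= 1 -> is_derive t 1 g (dg t)) ->
  (forall t : R, 0 <= t <= 1 -> normc (dh t) <= dg t) ->
  normc (h 1 - h 0) <= g 1 - g 0.
Proof.
move=> hd gd hg; set D := h 1 - h 0.
have g01 : g 0 <= g 1.
  rewrite -lerN2; apply: (@mvt_le0 (- g) (- dg)) => t t01.
    by apply: is_deriveN; exact: gd.
  by rewrite oppr_le0; apply: le_trans (hg t t01); exact: normc_ge0.
have [D0|D0] := eqVneq D 0; first by rewrite D0 normc0; lra.
have nD : 0 < normc D by rewrite normc_gt0.
pose f (s : R) : R := re D * re (h s) + im D * im (h s) - normc D * g s.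
pose df t := re D * re (dh t) + im D * im (dh t) - normc D * dg t.
have : f 1 <= f 0.
  apply: (@mvt_le0 f df) => t t01.
    have [h1 h2] := hd t t01.
    have H := is_deriveB (is_deriveD (is_deriveZ (re D) h1) (is_deriveZ (im D) h2))
                (is_deriveZ (normc D) (gd t t01)).
    exact: is_derive_eq H erefl.
  rewrite /df subr_le0; apply: le_trans (ler_wpM2l (ltW nD) (hg t t01)).
  (* With the conjugate of [D], the Cauchy-Schwarz inequality becomes [re_le_normc] for the product
     of [x] and [dh t]. *)
  pose x : C := (re D -i* im D)%C.
  have -> : normc D = normc x by rewrite /x; case: (D) => a b /=; rewrite sqrrN.
  rewrite -normcM; apply: le_trans (re_le_normc _); rewrite reM /=; lra.
have -> : f 1 = re D * re (h 1) + im D * im (h 1) - normc D * g 1 by [].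
have -> : f 0 = re D * re (h 0) + im D * im (h 0) - normc D * g 0 by [].
move=> f01; rewrite -(ler_pM2l nD) -expr2 normc_sqr.
have -> : re D ^+ 2 + im D ^+ 2 = re D * (re (h 1) - re (h 0)) + im D * (im (h 1) - im (h 0)).
  by rewrite /D reB imB; ring.
lra.
Qed.

Lemma is_derive_rX (n : nat) (k t : R) :
  is_derive t 1 (fun s : R => k * s ^+ n.+1) (k * n.+1%:R * t ^+ n).
Proof.
have -> : (fun s : R => k * s ^+ n.+1) = k \*: (id ^+ n.+1).
  by apply/funext => s; rewrite /= fctE.
apply: is_derive_eq (is_deriveZ k (is_deriveX n.+1 (is_derive_id t 1))) _.
by rewrite /GRing.scale /=; ring.
Qed.

End Derivative.

(** * The complex exponential, its Taylor remainder, geometric and logarithmic series *)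

Section ComplexExponential.
Variable R : realType.
Local Notation C := R[i].
Implicit Types z w q : C.

Definition cexp z : C := (expR (re z) * cos (im z) +i* (expR (re z) * sin (im z)))%C.

Lemma cexpD z w : cexp (z + w) = cexp z * cexp w.
Proof.
rewrite /cexp reD imD expRD cosD sinD; apply: complex_ext; rewrite ?reM ?imM /=; ring.
Qed.

Lemma cexpR (r : R) : cexp r%:C%C = (expR r)%:C%C.
Proof. by rewrite /cexp /= cos0 sin0 mulr1 mulr0. Qed.

Lemma cexp0 : cexp 0 = 1.
Proof. by rewrite (cexpR 0) expR0. Qed.

Lemma normc_cexp z : normc (cexp z) = expR (re z).
Proof.
rewrite /= !exprMn -mulrDr cos2Dsin2 mulr1 sqrtr_sqr ger0_norm//; exact: expR_ge0.
Qed.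

Lemma cexp_neq0 z : cexp z != 0.
Proof. by rewrite -normc_eq0 normc_cexp gt_eqF// expR_gt0. Qed.

Lemma cexpN z : cexp (- z) = (cexp z)^-1.
Proof. by apply: (mulfI (cexp_neq0 z)); rewrite -cexpD subrr cexp0 mulfV// cexp_neq0. Qed.

Lemma cexpB z w : cexp (z - w) = cexp z / cexp w.
Proof. by rewrite cexpD cexpN. Qed.

Lemma cexpXn z n : cexp (n%:R * z) = cexp z ^+ n.
Proof.
elim: n => [|n IH]; first by rewrite mul0r cexp0.
by rewrite -natr1 mulrDl mul1r cexpD IH exprSr.
Qed.

Lemma cexp_sum (n : nat) (u : nat -> C) :
  cexp (\sum_(i < n) u i) = \prod_(i < n) cexp (u i).
Proof. by elim: n => [|n IH]; rewrite ?big_ord0 ?cexp0// !big_ord_recr /= cexpD IH. Qed.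

Lemma cexp2pi : cexp (0 +i* (2 * pi))%C = 1.
Proof.
rewrite /cexp /= expR0 !mul1r.
have -> : 2 * pi = pi *+ 2 :> R by rewrite mulr_natl.
by rewrite cos2pi sin2pi.
Qed.

Lemma cder_exp (h : R -> C) t d : cder h t d ->
  cder (fun s => cexp (h s)) t (cexp (h t) * d).
Proof.
move=> [h1 h2].
have e1 := is_derive1_comp (is_derive_expR (re (h t))) h1.
have c1 := is_derive1_comp (is_derive_cos (im (h t))) h2.
have s1 := is_derive1_comp (is_derive_sin (im (h t))) h2.
split.
- apply: is_derive_eq (is_deriveM e1 c1) _.
  by rewrite reM /= /GRing.scale /=; ring.
- apply: is_derive_eq (is_deriveM e1 s1) _.
  by rewrite imM /= /GRing.scale /=; ring.
Qed.

Definition cexp_rem (n : nat) z := cexp z - \sum_(i < n) z ^+ i / i`!%:R.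

Lemma cder_cexp_rem n z t :
  cder (fun s => cexp_rem n.+1 (s%:C%C * z)) t (z * cexp_rem n (t%:C%C * z)).
Proof.
have hz s : cder (fun s => s%:C%C * z) s z.
  by apply: cder_eq (cderM (cder_id s) (cder_cst z s)) => //; rewrite mul1r mulr0 addr0.
rewrite /cexp_rem mulrBr mulrC mulr_sumr.
apply: cder_eq (cderB (cder_exp (hz t)) (cderD (cder_cst 1 t)
  (@cder_sum _ n (fun i s => i.+1`!%:R^-1 * (s%:C%C * z) ^+ i.+1) t
    (fun i => i.+1`!%:R^-1 * (i.+1%:R * (t%:C%C * z) ^+ i * z)) _))) => [s||i _].
- rewrite big_ord_recl /= expr0 fact0 divr1; congr (_ - (_ + _)).
  by apply: eq_bigr => i _; rewrite mulrC.
- congr (_ - _); rewrite add0r; apply: eq_bigr => i _.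
  have n0 : (i.+1%:R : C) != 0 by rewrite pnatr_eq0.
  have f0 : (i`!%:R : C) != 0 by rewrite pnatr_eq0 -lt0n fact_gt0.
  rewrite factS natrM; move: n0 f0; move: (i.+1%:R : C) (i`!%:R : C) => a b a0 b0.
  by field; rewrite a0 b0.
- by apply: cderZ; apply: cderX; exact: hz.
Qed.

(** Induction on [n]: along s -> s z the derivative of a remainder is [z] times the previous one,
    and [mean_value_le] integrates the bound. *)
Lemma normc_cexp_rem n z : normc (cexp_rem n z) <= normc z ^+ n / n`!%:R * expR (normc z).
Proof.
elim: n z => [|n IH] z.
  rewrite /cexp_rem big_ord0 subr0 expr0 fact0 divr1 mul1r normc_cexp ler_expR.
  exact: re_le_normc.
pose k := normc z ^+ n.+1 / n.+1`!%:R * expR (normc z).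
have -> : normc z ^+ n.+1 / n.+1`!%:R * expR (normc z) =
  (fun s : R => k * s ^+ n.+1) 1 - (fun s : R => k * s ^+ n.+1) 0.
  by rewrite /= expr1n expr0n /= mulr1 mulr0 subr0.
have -> : cexp_rem n.+1 z = cexp_rem n.+1 ((1 : R)%:C%C * z) - cexp_rem n.+1 ((0 : R)%:C%C * z).
  rewrite mul1r mul0r [cexp_rem _ 0]/cexp_rem cexp0 big_ord_recl expr0 fact0 divr1.
  by rewrite big1 ?addr0 ?subrr ?subr0// => i _; rewrite expr0n /= mul0r.
apply: (mean_value_le (fun t _ => cder_cexp_rem n z t) (fun t _ => is_derive_rX n k t)).
move=> t /andP[t0 t1]; rewrite normcM.
apply: le_trans (ler_wpM2l (normc_ge0 z) (IH _)) _.
rewrite normcM normcR_ge0//.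
have -> : k * n.+1%:R * t ^+ n =
   normc z * ((t * normc z) ^+ n / n`!%:R * expR (normc z)).
  have n0 : (n.+1%:R : R) != 0 by rewrite pnatr_eq0.
  have f0 : (n`!%:R : R) != 0 by rewrite pnatr_eq0 -lt0n fact_gt0.
  rewrite /k factS natrM exprMn exprS.
  move: n0 f0; move: (n.+1%:R : R) (n`!%:R : R) => a b a0 b0.
  by field; rewrite a0 b0.
rewrite ler_wpM2l ?normc_ge0// ler_wpM2l//.
  by rewrite divr_ge0// exprn_ge0// mulr_ge0 ?normc_ge0.
rewrite ler_expR; have := normc_ge0 z; nra.
Qed.

Lemma normc_cexpB1 z : normc (cexp z - 1) <= normc z * expR (normc z).
Proof.
have := normc_cexp_rem 1 z; rewrite /cexp_rem big_ord_recl big_ord0 expr0 fact0 divr1.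
by rewrite addr0 expr1 divr1.
Qed.

Lemma clim_cexp (u : nat -> C) l : clim u l -> clim (fun n => cexp (u n)) (cexp l).
Proof.
move=> ul; have [N hN] := ul 1 ltr01.
have k0 : 0 <= expR (re l) * expR 1 by rewrite mulr_ge0 ?expR_ge0.
apply: (@rlim0_le _ N _ (fun n => expR (re l) * expR 1 * normc (u n - l)));
  last exact: rlim0Z k0 ul.
move=> n Nn; have -> : cexp (u n) - cexp l = cexp l * (cexp (u n - l) - 1).
  by rewrite mulrBr mulr1 -cexpD [l + _]addrC subrK.
rewrite normcM normc_cexp -mulrA ler_wpM2l ?expR_ge0//.
apply: le_trans (normc_cexpB1 _) _; rewrite mulrC ler_wpM2r ?normc_ge0//.
by rewrite ler_expR; exact: hN.
Qed.

Lemma sum_exp_le (r : R) n : 0 <= r -> \sum_(i < n) r ^+ i / i`!%:R <= expR r.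
Proof.
move=> r0; have cr := is_cvg_series_exp_coeff r.
have -> : expR r = limn (series (exp_coeff r)) by [].
have -> : \sum_(i < n) r ^+ i / i`!%:R = series (exp_coeff r) n.
  by rewrite /series /= big_mkord; apply: eq_bigr => i _; rewrite /exp_coeff.
apply: nondecreasing_cvgn_le => // a b ab; rewrite /series /= !big_mkord.
apply: ler_sum_nonneg => // i; rewrite /exp_coeff /=.
by rewrite divr_ge0 ?exprn_ge0.
Qed.

Lemma fact_ge_exp (r : R) n : 0 <= r -> r ^+ n / n`!%:R <= expR r.
Proof.
move=> r0; apply: le_trans (sum_exp_le n.+1 r0); rewrite big_ord_recr /= lerDr.
by apply: sumr_ge0 => i _; rewrite divr_ge0 ?exprn_ge0.
Qed.

Lemma has_csum_exp z : has_csum (fun i => z ^+ i / i`!%:R) (cexp z).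
Proof.
pose r := normc z; have r0 : 0 <= r := normc_ge0 z.
(* [fact_ge_exp] at [2 * r] instead of [r] gains the factor 2^-n. *)
apply: (@rlim0_le _ 0 _ (fun n => (expR (2 * r) * expR r) * (2^-1) ^+ n)).
  move=> n _; rewrite normcBC; apply: le_trans (normc_cexp_rem n z) _.
  rewrite [leRHS]mulrAC ler_wpM2r ?expR_ge0//.
  have r20 : 0 <= 2 * r by lra.
  have := fact_ge_exp n r20; rewrite exprMn exprVn => h.
  by rewrite ler_pdivlMr ?exprn_gt0// mulrC mulrA.
by apply: rlim0_geo; lra.
Qed.

Lemma sum_geo_le (r : R) n : 0 <= r < 1 -> \sum_(i < n) r ^+ i <= (1 - r)^-1.
Proof.
move=> /andP[r0 r1]; have p : 0 < 1 - r by lra.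
rewrite -[leRHS]mul1r ler_pdivlMr// mulrC -opprB mulNr -subrX1 opprB.
by rewrite lerBlDr lerDl exprn_ge0.
Qed.

Lemma has_csum_geo q : normc q < 1 -> has_csum (fun i => q ^+ i) (1 - q)^-1.
Proof.
move=> q1; have q0 : 1 - q != 0.
  by rewrite subr_eq0; apply/eqP => qE; move: q1; rewrite -qE normc1 ltxx.
apply: (@rlim0_le _ 0 _ (fun n => (normc (1 - q))^-1 * normc q ^+ n)); last first.
  by apply: rlim0_geo; rewrite normc_ge0.
move=> n _; have -> : \sum_(i < n) q ^+ i - (1 - q)^-1 = - ((1 - q)^-1 * q ^+ n).
  apply: (mulfI q0); rewrite mulrBr mulfV// mulrN mulrA mulfV// mul1r -[1 - q]opprB.
  by rewrite mulNr -subrX1; ring.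
by rewrite normcN normcM normcV normcX.
Qed.

Lemma has_csum_geoS q : normc q < 1 -> has_csum (fun i => q ^+ i.+1) (q / (1 - q)).
Proof.
by move=> q1; apply: eq_has_csum (has_csumZ q (has_csum_geo q1)) => i; rewrite exprS.
Qed.

Lemma csummable_logseries q : normc q < 1 -> csummable (fun i => q ^+ i.+1 / i.+1%:R).
Proof.
move=> q1; exists (1 - normc q)^-1 => n; apply: le_trans (sum_geo_le n _); last first.
  by rewrite normc_ge0.
apply: ler_sum => i _; rewrite normcM normcX normcV normc_nat.
rewrite ler_pdivrMr ?ltr0n// exprSr ler_wpM2l ?exprn_ge0 ?normc_ge0//.
by apply: le_trans (ltW q1) _; rewrite ler1n.
Qed.

(** No branch of the logarithm is needed: for the truncated series L_n, the derivative of (1 - t q)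
    exp (L_n (t q)) in t telescopes to - q (t q)^n exp (L_n (t q)), so this product stays within
    O(|q|^n) of its value 1 at t = 0. *)
Lemma cexp_logseries q l : normc q < 1 -> has_csum (fun i => q ^+ i.+1 / i.+1%:R) l ->
  cexp l = (1 - q)^-1.
Proof.
move=> q1 ql; have q0 : 1 - q != 0.
  by rewrite subr_eq0; apply/eqP => qE; move: q1; rewrite -qE normc1 ltxx.
have nq0 := normc_ge0 q.
apply: (mulfI q0); rewrite mulfV//.
pose L n w := \sum_(i < n) w ^+ i.+1 / (i.+1%:R : C).
apply: (@clim_unique _ (fun n => (1 - q) * cexp (L n q))).
  by apply: climZ; exact: clim_cexp ql.
pose K := expR (1 - normc q)^-1.
apply: (@rlim0_le _ 0 _ (fun n => K * normc q * normc q ^+ n)); last first.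
  by apply: rlim0_geo; rewrite normc_ge0.
move=> n _.
pose h (t : R) : C := (1 - t%:C%C * q) * cexp (L n (t%:C%C * q)).
pose g (t : R) : R := K * normc q * normc q ^+ n * t ^+ 1.
have -> : (1 - q) * cexp (L n q) - 1 = h 1 - h 0.
  rewrite /h mul1r mul0r subr0 mul1r; congr (_ - _).
  by rewrite /L big1 ?cexp0// => i _; rewrite expr0n /= mul0r.
have -> : K * normc q * normc q ^+ n = g 1 - g 0.
  by rewrite /g expr1n expr0n /= mulr1 mulr0 subr0.
apply: (@mean_value_le _ h (fun t => - (q * (t%:C%C * q) ^+ n * cexp (L n (t%:C%C * q))))
  g (fun t => K * normc q * normc q ^+ n * 1%:R * t ^+ 0)) => t /andP[t0 t1].
- have hq s : cder (fun s => s%:C%C * q) s q.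
    by apply: cder_eq (cderM (cder_id s) (cder_cst q s)) => //; rewrite mul1r mulr0 addr0.
  have hL : cder (fun s => L n (s%:C%C * q)) t (\sum_(i < n) q * (t%:C%C * q) ^+ i).
    apply: cder_eq (@cder_sum _ n (fun i s => i.+1%:R^-1 * (s%:C%C * q) ^+ i.+1) t
      (fun i => i.+1%:R^-1 * (i.+1%:R * (t%:C%C * q) ^+ i * q)) _) => [s||i _].
    + by apply: eq_bigr => i _; rewrite mulrC.
    + apply: eq_bigr => i _; rewrite -mulrA mulKf ?pnatr_eq0// mulrC//.
    + by apply: cderZ; apply: cderX; exact: hq.
  apply: cder_eq (cderM (cderB (cder_cst 1 t) (hq t)) (cder_exp hL)) => //.
  set x := t%:C%C * q; rewrite sub0r -mulr_sumr.
  have -> : (1 - x) * (cexp (L n x) * (q * \sum_(i < n) x ^+ i)) =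
    cexp (L n x) * q * (- ((x - 1) * \sum_(i < n) x ^+ i)) by ring.
  by rewrite -subrX1; ring.
- rewrite expr0 !mulr1 normcN !normcM normcX normc_cexp normcM normcR_ge0//.
  rewrite -[leRHS]mulrA mulrC; apply: ler_pM; rewrite ?expR_ge0//.
  + by rewrite mulr_ge0// exprn_ge0// mulr_ge0.
  + rewrite ler_expR; apply: le_trans (re_le_normc _) _.
    apply: le_trans (normc_sum _ _ _) _; apply: le_trans (sum_geo_le n _); last first.
      by rewrite normc_ge0.
    apply: ler_sum => i _; rewrite normcM normcX normcV normc_nat normcM normcR_ge0//.
    rewrite ler_pdivrMr ?ltr0n// exprSr; apply: ler_pM.
    * by rewrite exprn_ge0// mulr_ge0.
    * by rewrite mulr_ge0.
    * by rewrite lerXn2r ?nnegrE ?mulr_ge0//; nra.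
    * by apply: (@le_trans _ _ 1); [nra | rewrite ler1n].
  + by rewrite ler_wpM2l// lerXn2r ?nnegrE ?mulr_ge0//; nra.
Qed.

End ComplexExponential.

(** * Roots of unity and Cauchy's estimate *)

Section RootsOfUnity.
Variable R : realType.
Local Notation C := R[i].

Lemma cos_half (t : R) : cos t = 1 - 2 * sin (t / 2) ^+ 2.
Proof.
rewrite {1}(_ : t = (t / 2) *+ 2) ?cos_mulr2n ?cos2sin2; first by ring.
by rewrite -mulr_natr mulfVK.
Qed.

Lemma sin_half (t : R) : sin t = 2 * (cos (t / 2) * sin (t / 2)).
Proof.
rewrite {1}(_ : t = (t / 2) *+ 2) ?sin_mulr2n ?mulr_natl//.
by rewrite -mulr_natr mulfVK.
Qed.

Definition cexpi (t : R) : C := cexp (0 +i* t)%C.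

Lemma cexpiD s t : cexpi (s + t) = cexpi s * cexpi t.
Proof. by rewrite /cexpi -cexpD; congr cexp; apply: complex_ext; rewrite /= ?addr0. Qed.

Lemma cexpi0 : cexpi 0 = 1.
Proof. exact: cexp0. Qed.

Lemma cexpiN t : cexpi (- t) = (cexpi t)^-1.
Proof. by rewrite /cexpi -cexpN; congr cexp; apply: complex_ext; rewrite /= ?oppr0. Qed.

Lemma normc_cexpi t : normc (cexpi t) = 1.
Proof. by rewrite normc_cexp expR0. Qed.

Lemma cexpi_neq0 t : cexpi t != 0.
Proof. exact: cexp_neq0. Qed.

Lemma cexpiX t n : cexpi (n%:R * t) = cexpi t ^+ n.
Proof.
elim: n => [|n IH]; first by rewrite mul0r cexpi0.
by rewrite -natr1 mulrDl mul1r cexpiD IH exprSr.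
Qed.

Lemma cexpi_2pi : cexpi (2 * pi) = 1.
Proof. exact: cexp2pi. Qed.

Lemma cexpi_neq1 (t : R) : 0 < t < 2 * pi -> cexpi t != 1.
Proof.
move=> /andP[t0 t2]; apply/eqP => /(congr1 (@complex.Re R)); rewrite /= expR0 mul1r => ct.
have s0 : 0 < sin (t / 2) by apply: sin_gt0_pi; lra.
have := cos_half t; rewrite ct => h.
have : sin (t / 2) ^+ 2 = 0 by lra.
by move/eqP; rewrite expf_eq0 /= gt_eqF.
Qed.

Definition zeta (N : nat) : C := cexpi (2 * pi / N%:R).

Lemma zetaX N : (0 < N)%N -> zeta N ^+ N = 1.
Proof.
by move=> N0; rewrite -cexpiX mulrC mulfVK ?cexpi_2pi// pnatr_eq0 -lt0n.
Qed.

Lemma zeta_neq0 N : zeta N != 0.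
Proof. exact: cexpi_neq0. Qed.

Lemma normc_zeta N : normc (zeta N) = 1.
Proof. exact: normc_cexpi. Qed.

Lemma zeta_neq1 N m : (0 < m < N)%N -> zeta N ^+ m != 1.
Proof.
move=> /andP[m0 mN]; rewrite -cexpiX; apply: cexpi_neq1.
have N0 : 0 < N%:R :> R by rewrite ltr0n; exact: leq_ltn_trans mN.
have p0 := pi_gt0 R; have m0' : 0 < m%:R :> R by rewrite ltr0n.
rewrite mulrCA mulr_gt0 ?divr_gt0//=; last by rewrite mulr_gt0.
by rewrite -[ltRHS]mulr1 ltr_pM2l ?mulr_gt0// ltr_pdivrMr// mul1r ltr_nat.
Qed.

Lemma zeta_inj N m p : (m < N)%N -> (p < N)%N -> m != p -> zeta N ^+ m != zeta N ^+ p.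
Proof.
move=> mN pN; wlog mp : m p mN pN / (m < p)%N.
  move=> W; rewrite neq_ltn => /orP[h|h]; first by apply: W; rewrite ?ltn_eqF.
  by rewrite eq_sym; apply: W; rewrite ?ltn_eqF.
move=> _; rewrite -(subnK (ltnW mp)) exprD -subr_eq0 -{1}[zeta N ^+ m]mul1r -mulrBl.
rewrite mulf_neq0 ?expf_neq0 ?zeta_neq0// subr_eq0 eq_sym zeta_neq1// subn_gt0 mp.
exact: leq_ltn_trans (leq_subr _ _) pN.
Qed.

Lemma sum_root_eq0 (x : C) N : x != 1 -> x ^+ N = 1 -> \sum_(j < N) x ^+ j = 0.
Proof.
move=> x1 xN; apply/eqP; have := subrX1 x N; rewrite xN subrr => /esym/eqP.
by rewrite mulf_eq0 subr_eq0 (negbTE x1).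
Qed.

Lemma zeta_orthogonal N m p : (m < N)%N -> (p < N)%N ->
  \sum_(j < N) (zeta N ^+ m / zeta N ^+ p) ^+ j = if m == p then N%:R else 0.
Proof.
move=> mN pN; have N0 : (0 < N)%N by exact: leq_ltn_trans mN.
case: eqVneq => [->|mp].
  rewrite mulfV ?expf_neq0 ?zeta_neq0//; under eq_bigr do rewrite expr1n.
  by rewrite sumr_const card_ord.
apply: sum_root_eq0.
  have zp : zeta N ^+ p != 0 by rewrite expf_neq0// zeta_neq0.
  apply/eqP => /(congr1 ( *%R^~ (zeta N ^+ p))); rewrite mulfVK// mul1r.
  by apply/eqP; exact: zeta_inj.
by rewrite exprMn exprVn -!exprM ![(_ * N)%N]mulnC !exprM zetaX// !expr1n invr1 mulr1.
Qed.

(** An average over the N-th roots of unity replaces the contour integral. The series is cut at a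
    rank [N] beyond [p] where its tail is at most [e]; for the remaining polynomial of degree below
    [N] the average extracts coefficient [p] exactly. *)
Lemma cauchy_estimate (c : nat -> C) (r S : R) : 0 < r ->
  csummable (fun p => c p * r%:C%C ^+ p) ->
  (forall (t : R) l, `|t| <= pi ->
    has_csum (fun p => c p * (r%:C%C * cexpi t) ^+ p) l -> normc l <= S) ->
  forall p, normc (c p) * r ^+ p <= S.
Proof.
move=> r0 [B cB] cS p; apply/ler_addgt0Pr => e e0.
have nE t i : normc (c i * (r%:C%C * cexpi t) ^+ i) = normc (c i) * r ^+ i.
  by rewrite normcM normcX normcM normc_cexpi mulr1 normcR_ge0// ltW.
have cB' n : \sum_(i < n) normc (c i) * r ^+ i <= B.
  apply: le_trans (cB n); apply: ler_sum => i _.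
  by rewrite normcM normcX normcR_ge0// ltW.
have c0 i : 0 <= normc (c i) * r ^+ i by rewrite mulr_ge0 ?normc_ge0// exprn_ge0// ltW.
have [J hJ] := bounded_tail c0 cB' e0.
pose N := maxn J p.+1.
have pN : (p < N)%N by rewrite leq_maxr.
have N0 : (0 < N)%N by exact: leq_ltn_trans pN.
have hN m : (N <= m)%N -> \sum_(i < m) normc (c i) * r ^+ i -
    \sum_(i < N) normc (c i) * r ^+ i <= e.
  move=> Nm; have JN : (J <= N)%N by rewrite leq_maxl.
  apply: le_trans (hJ m (leq_trans JN Nm)); rewrite lerD2l lerN2.
  exact: (@ler_sum_nonneg _ (fun i => normc (c i) * r ^+ i)).
pose V j := \sum_(m < N) c m * (r%:C%C * zeta N ^+ j) ^+ m.
have hV j : (j < N)%N -> normc (V j) <= S + e.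
  move=> jN.
  (* The angle of a root of unity lies in [0, 2 pi]; a shift by 2 pi brings it into [- pi, pi], the
     range on which the bound is assumed. *)
  have [t tpi tz] : exists2 t, `|t| <= pi & cexpi t = zeta N ^+ j.
    pose t := j%:R * (2 * pi / N%:R) : R.
    have t0 : 0 <= t by rewrite mulr_ge0// divr_ge0// mulr_ge0// pi_ge0.
    have t2 : t <= 2 * pi.
      rewrite /t mulrCA -[leRHS]mulr1 ler_wpM2l ?mulr_ge0 ?pi_ge0//.
      by rewrite ler_pdivrMr ?ltr0n// mul1r ler_nat ltnW.
    have [tp|tp] := leP t pi; first by exists t; rewrite ?ger0_norm// cexpiX.
    exists (t - 2 * pi); last by rewrite cexpiD cexpiN cexpi_2pi invr1 mulr1 cexpiX.
    by rewrite ler_norml; apply/andP; split; lra.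
  have sm : csummable (fun i => c i * (r%:C%C * cexpi t) ^+ i).
    by exists B => n; under eq_bigr do rewrite nE.
  have h1 := cS t _ tpi (csumP sm).
  have nv i : normc (c i * (r%:C%C * cexpi t) ^+ i) <= normc (c i) * r ^+ i by rewrite nE.
  have := has_csum_tail_le nv hN (csumP sm); rewrite tz -/(V j) normcBC => h2.
  have := normcB_ge (V j) (csum (fun i => c i * (r%:C%C * cexpi t) ^+ i)).
  by rewrite tz => h3; move: h1; rewrite tz; lra.
have : \sum_(j < N) (zeta N ^+ p)^-1 ^+ j * V j = N%:R * (c p * r%:C%C ^+ p).
  under eq_bigr do rewrite mulr_sumr.
  rewrite exchange_big /= (bigD1 (Ordinal pN)) //= [X in _ + X]big1 ?addr0.
    transitivity (\sum_(j < N) (c p * r%:C%C ^+ p) * (zeta N ^+ p / zeta N ^+ p) ^+ j).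
      apply: eq_bigr => j _; rewrite !exprMn -!exprM [(j * p)%N]mulnC; ring.
    by rewrite -mulr_sumr zeta_orthogonal// eqxx mulrC.
  move=> m mp; transitivity (\sum_(j < N) (c m * r%:C%C ^+ m) * (zeta N ^+ m / zeta N ^+ p) ^+ j).
    apply: eq_bigr => j _; rewrite !exprMn -!exprM [(j * m)%N]mulnC; ring.
  rewrite -mulr_sumr zeta_orthogonal ?ltn_ord//; case: eqP => [mE|_]; last by rewrite mulr0.
  by case/eqP: mp; apply: val_inj.
move/(congr1 (@Normc.normc R)); rewrite !normcM normcX normcR_ge0 ?(ltW r0)// normc_nat => h.
have Nr : 0 < N%:R :> R by rewrite ltr0n.
rewrite -(ler_pM2l Nr) -h; apply: le_trans (normc_sum _ _ _) _.
rewrite mulr_natl -[in leRHS](card_ord N) -sumr_const; apply: ler_sum => j _.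
by rewrite normcM normcX normcV normcX normc_cexpi expr1n invr1 expr1n mul1r hV.
Qed.

End RootsOfUnity.

(** * Lower bounds for e^w - 1, and the function 1 / (e^w - 1) *)

Section ExpLowerBound.
Variable R : realType.
Local Notation C := R[i].

Lemma nonneg_deriv (f df : R -> R) (b : R) :
  (forall s : R, 0 <= s -> is_derive s 1 f (df s)) ->
  (forall s : R, 0 <= s -> 0 <= df s) -> 0 <= b -> f 0 <= f b.
Proof.
move=> fd df0; rewrite le_eqVlt => /predU1P[<-//|b0].
have [||c] := @MVT R f df 0 b b0.
- by move=> x; rewrite in_itv /= => /andP[x0 x1]; apply: fd; rewrite ltW.
- apply: derivable_within_continuous => x; rewrite in_itv /= => /andP[x0 _].
  by have [] := fd x x0.
rewrite in_itv /= subr0 => /andP[c0 c1] h.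
by rewrite -subr_ge0 h mulr_ge0 ?df0// ltW.
Qed.

(** Integrate cos <= 1 three times by [nonneg_deriv]. *)
Lemma sin_ge_cubic (b : R) : 0 <= b -> b - b ^+ 3 / 6 <= sin b.
Proof.
have h1 (s : R) : 0 <= s -> sin s <= s.
  move=> s0; pose f := id - sin : R -> R; pose df (x : R) : R := 1 - cos x.
  have fd (x : R) : 0 <= x -> is_derive x 1 f (df x) by move=> _; exact: is_deriveB.
  have df0 (x : R) : 0 <= x -> 0 <= df x by move=> _; rewrite subr_ge0 cos_le1.
  have := nonneg_deriv fd df0 s0.
  have -> : f 0 = 0 - sin 0 by []. have -> : f s = s - sin s by [].
  by rewrite sin0; lra.
have h2 (s : R) : 0 <= s -> 1 - s ^+ 2 / 2 <= cos s.
  move=> s0; pose f := cos + (fun x : R => 2^-1 * x ^+ 2) : R -> R.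
  pose df (x : R) : R := - sin x + (2^-1 * 2%:R * x ^+ 1).
  have fd (x : R) : 0 <= x -> is_derive x 1 f (df x).
    by move=> _; apply: is_deriveD; exact: is_derive_rX.
  have df0 (x : R) : 0 <= x -> 0 <= df x by move=> /h1; rewrite /df expr1; lra.
  have := nonneg_deriv fd df0 s0.
  have -> : f 0 = cos 0 + 2^-1 * 0 ^+ 2 by [].
  have -> : f s = cos s + 2^-1 * s ^+ 2 by [].
  by rewrite cos0; lra.
move=> b0; pose f := sin - id + (fun x : R => 6^-1 * x ^+ 3) : R -> R.
pose df (x : R) : R := cos x - 1 + (6^-1 * 3%:R * x ^+ 2).
have fd (x : R) : 0 <= x -> is_derive x 1 f (df x).
  by move=> _; apply: is_deriveD; exact: is_derive_rX.
have df0 (x : R) : 0 <= x -> 0 <= df x by move=> /h2; rewrite /df; lra.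
have := nonneg_deriv fd df0 b0.
have -> : f 0 = sin 0 - 0 + 6^-1 * 0 ^+ 3 by [].
have -> : f b = sin b - b + 6^-1 * b ^+ 3 by [].
by rewrite sin0; lra.
Qed.

(** On [0, 2] the cubic term b^3 / 6 is at most 2 b / 3. *)
Lemma sin_sqr_ge (b : R) : `|b| <= 2 -> (b / 3) ^+ 2 <= sin b ^+ 2.
Proof.
wlog b0 : b / 0 <= b.
  move=> W; have [|b0] := leP 0 b; first exact: W.
  move=> b2; have := W (- b); rewrite sinN mulNr !sqrrN normrN; apply => //; lra.
rewrite ger0_norm// => b2; have := sin_ge_cubic b0.
have : b / 3 <= b - b ^+ 3 / 6.
  have : b ^+ 2 <= 2 ^+ 2 by rewrite lerXn2r ?nnegrE.
  by rewrite exprS; nra.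
move=> h1 h2; rewrite lerXn2r ?nnegrE//; lra.
Qed.

Lemma normc_cexpB1_sqr (w : C) : normc (cexp w - 1) ^+ 2 =
  (expR (re w) - 1) ^+ 2 + 4 * expR (re w) * sin (im w / 2) ^+ 2.
Proof.
rewrite normc_sqr reB imB /= subr0.
rewrite (cos_half (im w)) (sin_half (im w)).
rewrite !exprMn cos2sin2; ring.
Qed.

Lemma ler_sqr_nonneg (x y : R) : 0 <= y -> x ^+ 2 <= y ^+ 2 -> x <= y.
Proof.
move=> y0 xy; have [x0|x0] := leP 0 x; last by apply: le_trans y0; exact: ltW.
by rewrite leNgt; apply/negP => yx; move: xy; rewrite leNgt ltrXn2r ?nnegrE.
Qed.

(** The strip |im w| <= 4 contains |im w| <= pi and avoids the zeros of e^w - 1 at 2 pi i and - 2 pi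
    i. The bound on sin (im w / 2) needs |im w / 2| <= 2. *)
Lemma normc_cexpB1_ge (w : C) : 0 <= re w -> `|im w| <= 4 ->
  normc w / 3 <= normc (cexp w - 1).
Proof.
move=> w0 w4; apply: ler_sqr_nonneg; first exact: normc_ge0.
rewrite normc_cexpB1_sqr expr_div_n normc_sqr.
have X1 := expR_ge1Dx (re w).
have s1 : (im w / 2 / 3) ^+ 2 <= sin (im w / 2) ^+ 2.
  by apply: sin_sqr_ge; rewrite normrM [`|2^-1|]ger0_norm//; lra.
have : re w ^+ 2 <= (expR (re w) - 1) ^+ 2 by rewrite lerXn2r ?nnegrE//; lra.
have : sin (im w / 2) ^+ 2 <= expR (re w) * sin (im w / 2) ^+ 2.
  by rewrite -[leLHS]mul1r ler_wpM2r ?sqr_ge0//; lra.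
move: s1; rewrite !expr_div_n; have := sqr_ge0 (re w); lra.
Qed.

(** The Bose-Einstein factor, the sum of e^{-n w} over n >= 1 when re w > 0. *)
Definition bose (w : C) : C := (cexp w - 1)^-1.

Lemma cexpB1_neq0 (w : C) : 0 < re w -> cexp w - 1 != 0.
Proof.
move=> w0; rewrite subr_eq0; apply/eqP => /(congr1 (@Normc.normc R)).
by rewrite normc1 normc_cexp => /eqP; rewrite gt_eqF// expR_gt1.
Qed.

Lemma normc_cexpB1_ge_re (w : C) : expR (re w) - 1 <= normc (cexp w - 1).
Proof. by have := normcB_ge (cexp w) 1; rewrite normc1 normc_cexp. Qed.

Lemma normc_bose_le (w : C) : 0 < re w -> normc (bose w) <= (expR (re w) - 1)^-1.
Proof.
move=> w0; rewrite normcV lef_pV2 ?posrE ?normc_cexpB1_ge_re//.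
  by rewrite normc_gt0 cexpB1_neq0.
by rewrite subr_gt0 expR_gt1.
Qed.

Lemma normc_bose_leV (w : C) : 0 < re w -> normc (bose w) <= (re w)^-1.
Proof.
move=> w0; apply: le_trans (normc_bose_le w0) _.
rewrite lef_pV2 ?posrE ?subr_gt0 ?expR_gt1//; have := expR_ge1Dx (re w); lra.
Qed.

(** A one-sided gain: for [w] small and almost imaginary the modulus of [bose w] has order 1 / |w|,
    while this upper bound for the real part has order re w / |w|^2. *)
Lemma re_bose_le (w : C) : 0 < re w ->
  re (bose w) <= (expR (re w) - 1) / normc (cexp w - 1) ^+ 2.
Proof.
move=> w0; rewrite /bose reV ler_wpM2r ?invr_ge0 ?sqr_ge0// reB /= lerB//.
by rewrite -[leRHS]mulr1 ler_wpM2l ?expR_ge0// cos_le1.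
Qed.

End ExpLowerBound.

(** * Partial fraction expansion of 1 / (e^w - 1) *)

Section PartialFractions.
Variable R : realType.
Local Notation C := R[i].

Lemma climV (u : nat -> C) (l : C) : l != 0 -> clim u l -> clim (fun n => (u n)^-1) l^-1.
Proof.
move=> l0 ul; have nl : 0 < normc l by rewrite normc_gt0.
have [|N hN] := ul (normc l / 2); first lra.
have k0 : 0 <= 2 / normc l ^+ 2 by rewrite divr_ge0// sqr_ge0.
apply: (@rlim0_le _ N _ (fun n => 2 / normc l ^+ 2 * normc (u n - l)));
  last exact: rlim0Z k0 ul.
move=> n /hN h; have un : normc l / 2 <= normc (u n).
  by have := normcB_ge l (u n); rewrite normcBC; lra.
have u0 : u n != 0 by rewrite -normc_gt0; lra.
have -> : (u n)^-1 - l^-1 = (l - u n) / (u n * l) by field; rewrite u0 l0.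
rewrite normcM normcV normcM normcBC mulrC ler_wpM2r ?normc_ge0//.
rewrite invfM expr2 invfM mulrA ler_wpM2r ?invr_ge0 ?normc_ge0//.
by rewrite -invf_div lef_pV2 ?posrE//; lra.
Qed.

Lemma sum_inv_sqr_le n : \sum_(i < n) (i.+1%:R : R) ^- 2 <= 2.
Proof.
suff : forall n, \sum_(i < n.+1) (i.+1%:R : R) ^- 2 <= 2 - n.+1%:R^-1.
  case: n => [|n] h; first by rewrite big_ord0.
  by apply: le_trans (h n) _; rewrite gerBl invr_ge0.
elim=> [|m IH]; first by rewrite big_ord_recl big_ord0 invr1 expr1n invr1; lra.
rewrite big_ord_recr /=; apply: le_trans (lerD IH (lexx _)) _.
have a0 : 0 < m.+1%:R :> R by rewrite ltr0n.
rewrite -[m.+2%:R]natr1; move: (m.+1%:R) a0 => a a0.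
have b0 : 0 < a + 1 by lra.
rewrite -subr_ge0.
have -> : 2 - (a + 1)^-1 - (2 - a^-1 + (a + 1) ^- 2) = (a * (a + 1) ^+ 2)^-1.
  by field; rewrite !gt_eqF.
by rewrite invr_ge0 mulr_ge0 ?sqr_ge0// ltW.
Qed.

(** The lattice points j + i a l are comparable with (j, l), uniformly for [a] in a half strip: the
    imaginary part l re a controls l, and then the real part j - l im a controls j. *)
Lemma sqr_sum_le_normc (a : C) (al be l j : R) : 0 < al -> al <= re a -> `|im a| <= be ->
  j ^+ 2 + l ^+ 2 <= (2 + (2 * be ^+ 2 + 1) / al ^+ 2) *
    normc (j%:C%C + 'i%C * a * l%:C%C) ^+ 2.
Proof.
move=> al0 a1 b1; rewrite normc_sqr.
have -> : re (j%:C%C + 'i%C * a * l%:C%C) = j - l * im a.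
  by rewrite reD !reM !imM /=; ring.
have -> : im (j%:C%C + 'i%C * a * l%:C%C) = l * re a.
  by rewrite imD !imM !reM /=; ring.
have b0 : 0 <= be by exact: le_trans (normr_ge0 _) b1.
have b2 : im a ^+ 2 <= be ^+ 2 by rewrite -real_normK ?num_real// lerXn2r ?nnegrE.
have a2 : al ^+ 2 <= re a ^+ 2 by rewrite lerXn2r ?nnegrE//; lra.
set u := j - l * im a; set v := l * re a.
have e0 : 0 < al ^+ 2 by rewrite exprn_gt0.
have l2 : l ^+ 2 <= v ^+ 2 / al ^+ 2.
  by rewrite ler_pdivlMr// /v exprMn ler_wpM2l ?sqr_ge0.
have j2 : j ^+ 2 <= 2 * u ^+ 2 + 2 * (l ^+ 2 * im a ^+ 2).
  have : 0 <= (j - 2 * (l * im a)) ^+ 2 by exact: sqr_ge0.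
  rewrite /u; nra.
have lb : l ^+ 2 * im a ^+ 2 <= v ^+ 2 / al ^+ 2 * be ^+ 2.
  by apply: ler_pM; rewrite ?sqr_ge0.
have p1 : 0 <= (2 * be ^+ 2 + 1) / al ^+ 2 * u ^+ 2.
  rewrite mulr_ge0 ?sqr_ge0// divr_ge0 ?sqr_ge0//; have := sqr_ge0 be; lra.
have p2 : 0 <= v ^+ 2 by exact: sqr_ge0.
have -> : (2 + (2 * be ^+ 2 + 1) / al ^+ 2) * (u ^+ 2 + v ^+ 2) =
  2 * u ^+ 2 + 2 * v ^+ 2 + (2 * be ^+ 2 + 1) / al ^+ 2 * u ^+ 2
   + 2 * (v ^+ 2 / al ^+ 2 * be ^+ 2) + v ^+ 2 / al ^+ 2.
  by field; rewrite gt_eqF.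
lra.
Qed.

(** Factor j^2 + a^2 l^2 as (j + i a l) (j - i a l) and multiply the bounds for [l] and [- l]. *)
Lemma sqr_sum_le_normcM (a : C) (al be l j : R) : 0 < al -> al <= re a -> `|im a| <= be ->
  j ^+ 2 + l ^+ 2 <= (2 + (2 * be ^+ 2 + 1) / al ^+ 2) *
    normc (j%:C%C ^+ 2 + a ^+ 2 * l%:C%C ^+ 2).
Proof.
move=> al0 a1 b1; have h1 := sqr_sum_le_normc l j al0 a1 b1.
have h2 := sqr_sum_le_normc (- l) j al0 a1 b1; move: h1 h2.
have -> : j%:C%C ^+ 2 + a ^+ 2 * l%:C%C ^+ 2 =
  (j%:C%C + 'i%C * a * l%:C%C) * (j%:C%C + 'i%C * a * (- l)%:C%C).
  rewrite rmorphN /=.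
  have -> : (j%:C%C + 'i%C * a * l%:C%C) * (j%:C%C + 'i%C * a * - l%:C%C) =
    j%:C%C ^+ 2 - 'i%C ^+ 2 * (a ^+ 2 * l%:C%C ^+ 2) by ring.
  by rewrite sqr_i mulN1r opprK.
rewrite normcM sqrrN.
set K := 2 + _; set x := normc _; set y := normc _.
have x0 : 0 <= x by exact: normc_ge0.
have y0 : 0 <= y by exact: normc_ge0.
have K0 : 0 <= K.
  by rewrite addr_ge0// divr_ge0 ?sqr_ge0// addr_ge0// mulr_ge0// sqr_ge0.
set s := _ + _ => h1 h2; have s0 : 0 <= s by rewrite addr_ge0 ?sqr_ge0.
apply: ler_sqr_nonneg; first by rewrite !mulr_ge0.
have -> : (K * (x * y)) ^+ 2 = (K * x ^+ 2) * (K * y ^+ 2) by ring.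
by rewrite expr2; apply: ler_pM.
Qed.

Lemma clim_scaled_exp (x : C) (g : nat -> nat) : (forall n, (n <= g n)%N) ->
  clim (fun n => (g n).+1%:R * (cexp (x / (g n).+1%:R) - 1)) x.
Proof.
move=> gn; apply: (@rlim0_le _ 0 _ (fun n => (normc x ^+ 2 * expR (normc x)) / n.+1%:R));
  last exact: rlim0_invn.
move=> n _; set N := (g n).+1; have N0 : (N%:R : C) != 0 by rewrite pnatr_eq0.
have Nr : 0 < N%:R :> R by rewrite ltr0n.
have -> : N%:R * (cexp (x / N%:R) - 1) - x = N%:R * cexp_rem 2 (x / N%:R).
  rewrite /cexp_rem !big_ord_recl big_ord0 expr0 expr1 fact0 factS fact0 !divr1 addr0.
  by field.
rewrite normcM normc_nat; apply: le_trans (ler_wpM2l (ltW Nr) (normc_cexp_rem 2 _)) _.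
rewrite normcM normcV normc_nat !factS fact0.
have x0 := normc_ge0 x.
have -> : N%:R * ((normc x / N%:R) ^+ 2 / (2 * (1 * 1))%:R * expR (normc x / N%:R)) =
  normc x ^+ 2 * expR (normc x / N%:R) / 2 / N%:R :> R.
  by rewrite !muln1; field; rewrite gt_eqF.
apply: ler_pM.
- by rewrite divr_ge0// mulr_ge0 ?sqr_ge0 ?expR_ge0.
- by rewrite invr_ge0 ltW.
- rewrite -mulrA ler_wpM2l ?sqr_ge0//.
  have : expR (normc x / N%:R) <= expR (normc x).
    by rewrite ler_expR ler_pdivrMr// ler_peMr// ler1n.
  have := expR_ge0 (normc x); lra.
- by rewrite lef_pV2 ?posrE ?ltr0n// ler_nat ltnS.
Qed.

Lemma sum_odd_pairs (g : nat -> C) n :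
  \sum_(j < n.*2.+1) g j = g 0%N + \sum_(j < n) (g j.+1 + g (n.*2.+1 - j.+1)%N).
Proof.
rewrite big_ord_recl /=; congr (_ + _); rewrite big_split /=.
have -> : \sum_(i < n.*2) g (bump 0 i) = \sum_(i < n + n) g i.+1.
  by rewrite addnn; apply: eq_bigr => i _.
rewrite big_split_ord /=; congr (_ + _).
rewrite (reindex_inj rev_ord_inj) /=; apply: eq_bigr => i _; congr g.
have := ltn_ord i; lia.
Qed.

(** The finite partial fraction of 1 / (Y^N - 1): expand (Y^N - 1) / (Y zeta^j - 1) as a geometric
    sum; summation over [j] leaves only the constant power of Y. *)
Lemma bose_average (w : C) N : (0 < N)%N -> 0 < re w ->
  bose w = N%:R^-1 * \sum_(j < N) (cexp (w / N%:R) * zeta R N ^+ j - 1)^-1.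
Proof.
move=> N0 w0; set Y := cexp _.
have Nc : (N%:R : C) != 0 by rewrite pnatr_eq0 -lt0n.
have YN : Y ^+ N = cexp w by rewrite /Y -cexpXn mulrC mulfVK.
have Y1 j : Y * zeta R N ^+ j - 1 != 0.
  have h : 1 < normc (Y * zeta R N ^+ j).
    rewrite (normcM Y) (normcX (zeta R N)) normc_zeta expr1n mulr1 normc_cexp.
    have -> : re (w / N%:R) = re w / N%:R.
      by rewrite -realc_nat -fmorphV /= mulrC re_rmul mulrC.
    by rewrite expR_gt1 divr_gt0// ltr0n.
  by rewrite subr_eq0; apply: contraTneq h => ->; rewrite normc1 ltxx.
have W1 : cexp w - 1 != 0 by exact: cexpB1_neq0.
apply: (mulfI W1); rewrite mulfV// mulrCA mulr_sumr.
have -> : \sum_(j < N) (cexp w - 1) * (Y * zeta R N ^+ j - 1)^-1 =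
          \sum_(j < N) \sum_(m < N) Y ^+ m * (zeta R N ^+ m / zeta R N ^+ 0) ^+ j.
  apply: eq_bigr => j _.
  have -> : cexp w - 1 = (Y * zeta R N ^+ j) ^+ N - 1.
    by rewrite exprMn YN -exprM mulnC exprM zetaX// expr1n mulr1.
  rewrite subrX1 mulrAC mulfV// mul1r; apply: eq_bigr => m _.
  by rewrite expr0 divr1 exprMn -!exprM mulnC.
rewrite exchange_big /=.
under eq_bigr do rewrite -mulr_sumr.
rewrite (bigD1 (Ordinal N0)) //= [X in _ + X]big1 ?addr0.
  by rewrite zeta_orthogonal//= expr0 mul1r mulVf.
by move=> m m0; rewrite zeta_orthogonal// ifN ?mulr0.
Qed.

Lemma bose_pair (u v : C) : cexp u - 1 != 0 -> cexp v - 1 != 0 ->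
  (cexp u - 1)^-1 + (cexp v - 1)^-1 =
  -1 + (cexp (u + v) - 1) / ((cexp u - 1) * (cexp v - 1)).
Proof. by move=> u0 v0; rewrite cexpD; field; rewrite u0 v0. Qed.

Definition pf_term (w : C) (j : nat) : C :=
  2 * w / (w ^+ 2 + ((2 * pi : R)%:C%C * j.+1%:R) ^+ 2).

Lemma normc_pf_den (w : C) : 0 < re w -> exists2 K : R, 0 <= K &
  forall j : nat, j.+1%:R ^+ 2 <= K * normc (w ^+ 2 + ((2 * pi : R)%:C%C * j.+1%:R) ^+ 2).
Proof.
move=> w0; exists (2 + (2 * normc w ^+ 2 + 1) / re w ^+ 2).
  by rewrite addr_ge0// divr_ge0 ?sqr_ge0// addr_ge0// mulr_ge0// sqr_ge0.
move=> j; have := @sqr_sum_le_normcM w (re w) (normc w) 1 (2 * pi * j.+1%:R) w0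
  (lexx _) (normr_im_le w).
rewrite expr1n expr1n mulr1 [w ^+ 2 + _]addrC rmorphM /= realc_nat; apply: le_trans.
rewrite exprMn.
have p2 := pi_ge2 R.
have p4 : 1 <= (2 * pi) ^+ 2 :> R by rewrite expr2; nra.
have := sqr_ge0 (j.+1%:R : R); nra.
Qed.

Lemma normc_pf_term (w : C) : 0 < re w -> exists2 K : R, 0 <= K &
  forall j, normc (pf_term w j) <= K * j.+1%:R ^- 2.
Proof.
move=> w0; have [K K0 h] := normc_pf_den w0; exists (2 * normc w * K).
  by rewrite mulr_ge0// mulr_ge0// normc_ge0.
move=> j; rewrite /pf_term normcM normcV normcM normc_nat -[leRHS]mulrA ler_wpM2l//.
  by rewrite mulr_ge0// normc_ge0.
have := h j; set x := normc _ => hj.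
have j0 : 0 < j.+1%:R ^+ 2 :> R by rewrite exprn_gt0// ltr0n.
have x0 : 0 < x.
  rewrite lt_neqAle normc_ge0 andbT eq_sym; apply/eqP => xE; move: hj; rewrite xE mulr0.
  by rewrite leNgt j0.
by rewrite -[leLHS]mul1r ler_pdivrMr// mulrAC ler_pdivlMr// mul1r.
Qed.

Lemma csummable_pf_term (w : C) : 0 < re w -> csummable (pf_term w).
Proof.
move=> w0; have [K K0 h] := normc_pf_term w0.
apply: (csummable_le (B := K * 2) h) => n.
by rewrite -mulr_sumr ler_wpM2l// sum_inv_sqr_le.
Qed.

(** Limit of [bose_average] for odd N = 2n + 1. The roots [j] and [N - j] are joined by [bose_pair],
    because single terms would not be summable; each pair is -1 plus a term that tends to [pf_term].
    The limit is taken by [tannery], with [normc_cexpB1_ge] for the domination. *)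
Lemma bose_partial_fraction (w : C) : 0 < re w ->
  has_csum (pf_term w) (bose w - w^-1 + 2^-1).
Proof.
move=> w0; have wn0 := re_gt0_neq0 w0.
have [K K0 hK] := normc_pf_den w0.
have Kj j : j.+1%:R ^+ 2 <= K * normc (w ^+ 2 + ((2 * pi : R)%:C%C * j.+1%:R) ^+ 2) by [].
pose N n := n.*2.+1.
pose U j : C := (0 +i* (2 * pi * j.+1%:R))%C.
have UE (j : nat) : U j ^+ 2 = - ((2 * pi : R)%:C%C * j.+1%:R) ^+ 2.
  by rewrite -realc_nat; apply: complex_ext; rewrite expr2 ?reM ?imM ?reN ?imN /=; ring.
have UU j : (w + U j) * (w - U j) = w ^+ 2 + ((2 * pi : R)%:C%C * j.+1%:R) ^+ 2.
  have -> : ((2 * pi : R)%:C%C * j.+1%:R) ^+ 2 = - U j ^+ 2 by rewrite UE opprK.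
  by ring.
have den0 j : (w + U j) * (w - U j) != 0.
  rewrite UU -normc_gt0 ltNge; apply/negP => h.
  have := Kj j; rewrite (_ : normc _ = 0); last by apply/eqP; rewrite eq_le h normc_ge0.
  by rewrite mulr0 leNgt exprn_gt0// ltr0n.
have [wU wU'] : (forall j, w + U j != 0) /\ (forall j, w - U j != 0).
  by split=> j; apply: contraNneq (den0 j) => ->; rewrite ?mul0r ?mulr0.
have Nc n : ((N n)%:R : C) != 0 by rewrite pnatr_eq0.
have Nr n : 0 < (N n)%:R :> R by rewrite ltr0n.
pose E n (x : C) : C := (N n)%:R * (cexp (x / (N n)%:R) - 1).
have reU (j : nat) : re (U j) = 0 by [].
have E0 n x : re x = re w -> E n x != 0.
  move=> xw; rewrite mulf_neq0// cexpB1_neq0//.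
  by rewrite -realc_nat -fmorphV /= mulrC re_rmul mulr_gt0// ?xw// invr_gt0.
pose a n j : C := if (j < n)%N then E n (2 * w) / (E n (w + U j) * E n (w - U j)) else 0.
have aE n j : (j < n)%N -> a n j = E n (2 * w) / (E n (w + U j) * E n (w - U j)).
  by rewrite /a => ->.
have limE x : clim (fun n => E n x) x.
  by apply: (@clim_scaled_exp x double) => n; rewrite -addnn leq_addr.
have E2 n : normc (E n (2 * w)) <= normc (2 * w) * expR (normc (2 * w)).
  rewrite /E normcM normc_nat; apply: le_trans (ler_wpM2l (ltW (Nr n)) (normc_cexpB1 _)) _.
  have -> : normc (2 * w / (N n)%:R) = normc (2 * w) / (N n)%:R by rewrite normcM normcV normc_nat.
  have -> : (N n)%:R * (normc (2 * w) / (N n)%:R * expR (normc (2 * w) / (N n)%:R)) =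
     normc (2 * w) * expR (normc (2 * w) / (N n)%:R) by field; rewrite gt_eqF.
  by rewrite ler_wpM2l ?normc_ge0// ler_expR ler_pdivrMr// ler_peMr ?normc_ge0// ler1n.
(* [normc_cexpB1_ge] needs |im w| + 2 pi j <= 4 N = 8 n + 4 for j <= n; the room D n, positive as pi
   < 4, absorbs |im w| from [N0] on. *)
pose D := 8 - 2 * pi : R.
have D0 : 0 < D by have := pihalf_lt2 R; rewrite /D; lra.
pose N0 := Num.bound (`|im w| / D).
have imb n j : (N0 <= n)%N -> (j < n)%N -> `|im w| + 2 * pi * j.+1%:R <= 4 * (N n)%:R.
  move=> nN jn; have h1 : `|im w| / D <= n%:R.
    apply: le_trans (ltW (archi_boundP _)) _; first by rewrite divr_ge0// ltW.
    by rewrite ler_nat.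
  move: h1; rewrite ler_pdivrMr// /D => h1.
  have h2 : 2 * pi * j.+1%:R <= 2 * pi * n%:R :> R.
    by rewrite ler_wpM2l ?ler_nat// mulr_ge0// pi_ge0.
  have -> : (N n)%:R = 2 * n%:R + 1 :> R by rewrite /N -natr1 -mul2n natrM.
  lra.
have Ege n x : re x = re w -> `|im x| <= 4 * (N n)%:R -> normc x / 3 <= normc (E n x).
  move=> xw xi; rewrite /E normcM normc_nat.
  have -> : normc x / 3 = (N n)%:R * (normc (x / (N n)%:R) / 3).
    by rewrite normcM normcV normc_nat; field; rewrite gt_eqF.
  apply: ler_wpM2l; [exact: ltW | apply: normc_cexpB1_ge].
    by rewrite -realc_nat -fmorphV /= mulrC re_rmul mulr_ge0// ?xw ltW// invr_gt0.
  rewrite -realc_nat -fmorphV /= mulrC im_rmul normrM [`|_^-1|]ger0_norm; last by rewrite invr_ge0.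
  by rewrite mulrC ler_pdivrMr.
pose M := 9 * (normc (2 * w) * expR (normc (2 * w))) * K.
have M0 : 0 <= M by rewrite !mulr_ge0 ?expR_ge0 ?normc_ge0.
apply: (@eq_has_csum _ (fun j => 2 * w / ((w + U j) * (w - U j)))).
  by move=> j; rewrite /pf_term UU.
have sumb : csummable (fun j => 2 * w / ((w + U j) * (w - U j))).
  have [B hB] := csummable_pf_term w0; exists B => n; apply: le_trans (hB n).
  by apply: ler_sum => j _; rewrite /pf_term UU.
suff -> : bose w - w^-1 + 2^-1 = csum (fun j => 2 * w / ((w + U j) * (w - U j))).
  exact: csumP.
have lim1 : clim (fun n => \sum_(j < n) a n j) (csum (fun j => 2 * w / ((w + U j) * (w - U j)))).
  apply: (@tannery _ N0 a (fun j => 2 * w / ((w + U j) * (w - U j))) _ _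
     (fun j => M * j.+1%:R ^- 2) (M * 2)).
  - move=> n j nN; rewrite /a; case: ifP => jn; last first.
      by rewrite normc0 mulr_ge0// invr_ge0 sqr_ge0.
    rewrite normcM normcV normcM.
    have iU : `|im (U j)| = 2 * pi * j.+1%:R.
      by rewrite /= ger0_norm// mulr_ge0// mulr_ge0// pi_ge0.
    have g1 := Ege n (w + U j); have g2 := Ege n (w - U j).
    have {}g1 : normc (w + U j) / 3 <= normc (E n (w + U j)).
      apply: g1; first by rewrite reD reU addr0.
      rewrite imD; apply: le_trans (ler_normD _ _) _; rewrite iU; exact: imb.
    have {}g2 : normc (w - U j) / 3 <= normc (E n (w - U j)).
      apply: g2; first by rewrite reB reU subr0.
      rewrite imB; apply: le_trans (ler_normB _ _) _; rewrite iU; exact: imb.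
    have w1 : 0 < normc (w + U j) by rewrite normc_gt0.
    have w2 : 0 < normc (w - U j) by rewrite normc_gt0.
    have W : normc (w + U j) * normc (w - U j) / 9 <=
        normc (E n (w + U j)) * normc (E n (w - U j)).
      have -> : normc (w + U j) * normc (w - U j) / 9 =
         (normc (w + U j) / 3) * (normc (w - U j) / 3) by field.
      by apply: ler_pM => //; rewrite divr_ge0 ?normc_ge0.
    have Wp : 0 < normc (w + U j) * normc (w - U j) / 9 by rewrite divr_gt0// mulr_gt0.
    have j0 : 0 < j.+1%:R ^+ 2 :> R by rewrite exprn_gt0// ltr0n.
    apply: (@le_trans _ _ ((normc (2 * w) * expR (normc (2 * w))) *
        (normc (w + U j) * normc (w - U j) / 9)^-1)).
      apply: ler_pM; rewrite ?normc_ge0 ?E2//.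
        by rewrite invr_ge0 mulr_ge0 ?normc_ge0.
      by rewrite lef_pV2 ?posrE//; exact: lt_le_trans W.
    rewrite /M ler_pdivrMr//.
    set X := normc (2 * w) * _; have X0 : 0 <= X by rewrite mulr_ge0 ?normc_ge0 ?expR_ge0.
    have := Kj j; rewrite -UU normcM => kj.
    have aux (x y : R) : x != 0 -> 9 * X * K / x * (y / 9) = X * (K * y / x).
      by move=> x0; field.
    rewrite aux ?gt_eqF//.
    by rewrite -[leLHS]mulr1 ler_wpM2l// ler_pdivlMr// mul1r.
  - by move=> n; rewrite -mulr_sumr ler_wpM2l// sum_inv_sqr_le.
  - move=> j; apply: (@clim_eq _ j.+1 (fun n => E n (2 * w) / (E n (w + U j) * E n (w - U j)))).
      by move=> n jn; rewrite aE.
    by apply: climM => //; apply: climV => //; exact: climM.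
  - by move=> n _; apply: has_csum_finite => j nj; rewrite /a ltnNge nj.
  - exact: csumP.
suff lim2 : clim (fun n => \sum_(j < n) a n j) (bose w - w^-1 + 2^-1).
  exact: clim_unique lim2 lim1.
(* The -1 of each of the [n] pairs, divided by N = 2n + 1, is the source of the 1/2. *)
apply: (@clim_eq _ 0 (fun n => bose w - (E n w)^-1 + n%:R / (N n)%:R)).
  move=> n _; rewrite (@bose_average w (N n))// (@sum_odd_pairs (fun j => (cexp (w / (N n)%:R) * zeta R (N n) ^+ j - 1)^-1)).
  rewrite expr0 mulr1.
  have zU j : (j < n)%N ->
    (cexp (w / (N n)%:R) * zeta R (N n) ^+ j.+1 - 1)^-1 +
    (cexp (w / (N n)%:R) * zeta R (N n) ^+ (N n - j.+1) - 1)^-1 = -1 + (N n)%:R * a n j.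
    move=> jn; have zE : zeta R (N n) ^+ j.+1 = cexp (U j / (N n)%:R).
      rewrite -cexpiX /cexpi; congr cexp; rewrite -realc_nat -fmorphV [RHS]mulrC rmulE /U /= mulr0.
      by congr Complex; field; rewrite gt_eqF.
    have zE' : zeta R (N n) ^+ (N n - j.+1) = cexp (- U j / (N n)%:R).
      have z0 := zeta_neq0 R (N n).
      have jN : (j.+1 <= N n)%N by rewrite /N -addnn; lia.
      have h : zeta R (N n) ^+ (N n - j.+1) * zeta R (N n) ^+ j.+1 = 1.
        by rewrite -exprD subnK// zetaX.
      rewrite mulNr cexpN -zE -[LHS](mulfK (expf_neq0 j.+1 z0)) h.
      by rewrite mul1r.
    rewrite zE zE' -!cexpD -!mulrDl.
    have nz x : re x = re w -> cexp (x / (N n)%:R) - 1 != 0.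
      by move=> /(E0 n); rewrite mulf_eq0 negb_or => /andP[].
    have r1 : re (w + U j) = re w by rewrite reD reU addr0.
    have r2 : re (w - U j) = re w by rewrite reB reU subr0.
    rewrite bose_pair ?nz//; congr (_ + _); rewrite aE// /E -mulrDl.
    have -> : w + U j + (w - U j) = 2 * w by ring.
    by field; rewrite Nc !nz.
  rewrite (eq_bigr (fun j : 'I_n => -1 + (N n)%:R * a n j)); last by move=> j _; exact: zU.
  rewrite big_split /= sumr_const card_ord -mulr_sumr mulrDr mulrDr mulKf//.
  rewrite /E invfM mulNrn mulrN.
  by rewrite [n%:R / _]mulrC; ring.
apply: climD; first by apply: climB; [exact: clim_cst | exact: climV].
apply: (@rlim0_le _ 0 _ (fun n => 1 / n.+1%:R)); last exact: rlim0_invn.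
move=> n _; have -> : n%:R / (N n)%:R - 2^-1 = - (2^-1 / (N n)%:R) :> C.
  by have := Nc n; rewrite /N -natr1 -mul2n natrM => h; field.
rewrite normcN normcM !normcV !normc_nat; apply: ler_pM; rewrite ?invr_ge0//.
  by lra.
by rewrite lef_pV2 ?posrE ?ltr0n// ler_nat /N ltnS -addnn leq_addr.
Qed.

End PartialFractions.

(** * The value of the sum of 1 / j^2 *)

Section Basel.
Variable R : realType.
Local Notation C := R[i].

Lemma pf_termR (r : R) j :
  pf_term r%:C%C j = (2 * r / (r ^+ 2 + (2 * pi * j.+1%:R) ^+ 2))%:C%C.
Proof.
by rewrite /pf_term fmorph_div rmorphD !rmorphXn !rmorphM /= !realc_nat.
Qed.

Lemma boseR (r : R) : bose r%:C%C = ((expR r - 1)^-1)%:C%C.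
Proof. by rewrite /bose cexpR fmorphV rmorphB. Qed.

Lemma expR_taylor3 (r : R) : 0 <= r <= 1 ->
  `|expR r - (1 + r + r ^+ 2 / 2 + r ^+ 3 / 6)| <= r ^+ 4 / 24 * expR 1.
Proof.
move=> /andP[r0 r1]; have := normc_cexp_rem 4 r%:C%C.
have sR : \sum_(i < 4) r ^+ i / i`!%:R = 1 + r + r ^+ 2 / 2 + r ^+ 3 / 6.
  by rewrite !big_ord_recr big_ord0 /= !factS fact0 expr0 expr1; field.
have sC : \sum_(i < 4) r%:C%C ^+ i / i`!%:R = (\sum_(i < 4) r ^+ i / i`!%:R)%:C%C :> C.
  by rewrite rmorph_sum; apply: eq_bigr => i _; rewrite fmorph_div rmorphXn /= realc_nat.
rewrite (normcR_ge0 r0) /cexp_rem cexpR sC sR -rmorphB normcR.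
have -> : (4`!)%:R = 24 :> R by [].
move=> h; apply: le_trans h _; apply: ler_pM; rewrite ?expR_ge0//.
- by rewrite divr_ge0// exprn_ge0.
- by rewrite ler_expR.
Qed.

Lemma bose_real_expansion (r : R) : 0 < r <= 1 ->
  `|(expR r - 1)^-1 - r^-1 + 2^-1 - r / 12| <= (1 + expR 1) * r ^+ 2.
Proof.
move=> /andP[r0 r1]; have r01 : 0 <= r <= 1 by rewrite r1 ltW.
have := expR_taylor3 r01; set rho := expR r - _ => hrho.
pose E := expR r - 1; have EE : E = r + r ^+ 2 / 2 + r ^+ 3 / 6 + rho.
  by rewrite /E /rho; ring.
have Er : r <= E by rewrite /E; have := expR_ge1Dx r; lra.
have E0 : 0 < E by lra.
have -> : E^-1 - r^-1 + 2^-1 - r / 12 =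
  (r ^+ 4 / 24 - r ^+ 5 / 72 - rho * (1 - r / 2 + r ^+ 2 / 12)) / (r * E).
  have -> : r ^+ 4 / 24 - r ^+ 5 / 72 - rho * (1 - r / 2 + r ^+ 2 / 12) =
     r - E + r * E / 2 - r ^+ 2 * E / 12 by rewrite EE; field.
  by field; rewrite !gt_eqF.
rewrite normrM normfV [`|r * E|]ger0_norm; last by rewrite mulr_ge0 ?ltW.
rewrite ler_pdivrMr ?mulr_gt0//.
have r2 : r ^+ 2 <= r * E by rewrite expr2 ler_pM2l.
have e1 : 0 <= expR 1 :> R by exact: expR_ge0.
have r4 : 0 <= r ^+ 4 by rewrite exprn_ge0// ltW.
have r54 : r ^+ 5 <= r ^+ 4 by rewrite exprS -[leRHS]mul1r ler_wpM2r.
have r5 : 0 <= r ^+ 5 by rewrite exprn_ge0// ltW.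
have q1 : 0 <= 1 - r / 2 + r ^+ 2 / 12 <= 1.
  by apply/andP; split; [have := sqr_ge0 r; lra | nra].
have hr : `|rho * (1 - r / 2 + r ^+ 2 / 12)| <= r ^+ 4 / 24 * expR 1.
  rewrite normrM; case/andP: q1 => q0 q1.
  rewrite [`|1 - _ + _|]ger0_norm//; apply: le_trans hrho.
  by rewrite -[leRHS]mulr1 ler_wpM2l.
have a1 : `|r ^+ 4 / 24 - r ^+ 5 / 72 - rho * (1 - r / 2 + r ^+ 2 / 12)| <=
   r ^+ 4 / 24 + r ^+ 4 / 24 * expR 1.
  apply: le_trans (ler_normB _ _) _; apply: lerD hr.
  by rewrite ger0_norm; lra.
apply: le_trans a1 _; apply: le_trans (_ : (1 + expR 1) * r ^+ 2 * r ^+ 2 <= _); last first.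
  by apply: ler_wpM2l r2; rewrite mulr_ge0 ?sqr_ge0//; lra.
have -> : (1 + expR 1) * r ^+ 2 * r ^+ 2 = r ^+ 4 + r ^+ 4 * expR 1 by ring.
have := mulr_ge0 r4 e1; lra.
Qed.

(** Compare the coefficients of r as r -> 0 in the partial fraction expansion at a real point r: it
    is r / 12 by the Taylor expansion of e^r, and r / (2 pi^2) times the sum of 1 / j^2 by the
    series. *)
Lemma basel : has_csum (fun j => (j.+1%:R ^- 2 : C)) (pi ^+ 2 / 6)%:C%C.
Proof.
have sm : csummable (fun j => (j.+1%:R ^- 2 : C)).
  exists 2 => n; apply: le_trans (sum_inv_sqr_le R n).
  by apply: ler_sum => i _; rewrite normcV normcX normc_nat.
have hZ := csumP sm; set Z := csum _ in hZ.
suff -> : (pi ^+ 2 / 6)%:C%C = Z by exact: hZ.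
have p0 := pi_gt0 R; have p2 := pi_ge2 R.
(* [c * r / j^2] is 2 r / (2 pi j)^2, the first-order part of [pf_term]. *)
pose c : R := (2 * pi ^+ 2)^-1.
have cl (r : R) : 0 < r <= 1 -> normc (Z * (c * r)%:C%C - (r / 12)%:C%C) <= (5 + expR 1) * r ^+ 2.
  move=> r01; have /andP[r0 r1] := r01.
  have := bose_real_expansion r01; set y := (expR r - 1)^-1 - r^-1 + 2^-1 => hy.
  have r0' : 0 < re r%:C%C by [].
  have hb := bose_partial_fraction r0'.
  have hb' : has_csum (pf_term r%:C%C) y%:C%C.
    have -> : y%:C%C = bose r%:C%C - r%:C%C^-1 + 2^-1 => //.
    by rewrite boseR /y !rmorphD rmorphN !fmorphV rmorph_nat.
  have hd := has_csumB (has_csumZ (c * r)%:C%C hZ) hb'.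
  have h1 : normc ((c * r)%:C%C * Z - y%:C%C) <= 4 * r ^+ 3.
    apply: has_csum_norm_le hd => n.
    apply: le_trans (_ : 2 * r ^+ 3 * \sum_(i < n) (i.+1%:R : R) ^- 2 <= _); last first.
      have -> : 4 * r ^+ 3 = 2 * r ^+ 3 * 2 by ring.
      apply: ler_wpM2l (sum_inv_sqr_le R n); by rewrite mulr_ge0// exprn_ge0// ltW.
    rewrite mulr_sumr; apply: ler_sum => i _.
    rewrite pf_termR -realc_nat -rmorphXn -fmorphV -rmorphM -rmorphB normcR.
    have j1 : 1 <= i.+1%:R :> R by rewrite ler1n.
    move: (i.+1%:R : R) j1 => j j1.
    have j2 : 1 <= j ^+ 2 by rewrite expr2; nra.
    have D0 : 0 < r ^+ 2 + (2 * pi * j) ^+ 2.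
      by rewrite ltr_wpDl ?sqr_ge0// exprn_gt0// !mulr_gt0//; lra.
    have j0 : 0 < j by lra.
    have -> : c * r * j ^- 2 - 2 * r / (r ^+ 2 + (2 * pi * j) ^+ 2) =
      (2 * r ^+ 3 * j ^- 2) * ((2 * pi) ^+ 2 * (r ^+ 2 + (2 * pi * j) ^+ 2))^-1.
      have aux (D : R) : D != 0 -> c * r * j ^- 2 - 2 * r / D =
          2 * (r * (D - (2 * pi * j) ^+ 2)) * j ^- 2 * ((2 * pi) ^+ 2 * D)^-1.
        have jn : j != 0 by rewrite gt_eqF.
        have pn : (pi : R) != 0 by rewrite gt_eqF.
        move=> Dn0; rewrite /c; move: (pi : R) pn => p pn.
        by field; rewrite Dn0 pn jn.
      by rewrite aux ?gt_eqF// addrK exprS.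
    have X0 : 0 <= 2 * r ^+ 3 * j ^- 2.
      by rewrite divr_ge0 ?sqr_ge0// mulr_ge0// exprn_ge0// ltW.
    have Y1 : 1 <= (2 * pi) ^+ 2 * (r ^+ 2 + (2 * pi * j) ^+ 2).
      have A1 : 1 <= (2 * pi) ^+ 2 :> R by rewrite expr2; nra.
      rewrite [(2 * pi * j) ^+ 2]exprMn; have r2 := sqr_ge0 r.
      move: ((2 * pi) ^+ 2 : R) A1 => A A1.
      have A2 : 1 <= A * j ^+ 2 by nra.
      by nra.
    rewrite ger0_norm; last by rewrite mulr_ge0// invr_ge0; lra.
    by rewrite -[leRHS]mulr1 ler_wpM2l// invf_le1//; lra.
  have -> : Z * (c * r)%:C%C - (r / 12)%:C%C =
    ((c * r)%:C%C * Z - y%:C%C) + (y - r / 12)%:C%C by rewrite rmorphB /=; ring.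
  apply: le_trans (normcD _ _) _; rewrite normcR.
  have r3 : r ^+ 3 <= r ^+ 2 by rewrite exprS -[leRHS]mul1r ler_wpM2r ?sqr_ge0.
  have := sqr_ge0 r; lra.
have cE : Z * c%:C%C = (12^-1 : R)%:C%C.
  apply: (@clim_unique _ (fun=> Z * c%:C%C)); first exact: clim_cst.
  apply: (@rlim0_le _ 0 _ (fun n => (5 + expR 1) / n.+1%:R)); last exact: rlim0_invn.
  move=> n _; have r01 : 0 < (n.+1%:R^-1 : R) <= 1.
    by rewrite invr_gt0 ltr0n invf_le1 ?ltr0n// ler1n.
  have := cl _ r01; case/andP: r01; move: (n.+1%:R^-1) => r r0 r1.
  have -> : Z * (c * r)%:C%C - (r / 12)%:C%C = (Z * c%:C%C - (12^-1)%:C%C) * r%:C%C.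
    by rewrite !rmorphM /=; ring.
  by rewrite normcM (normcR_ge0 (ltW r0)) expr2 mulrA ler_pM2r.
have c0 : c%:C%C != 0 by rewrite fmorph_eq0 invr_eq0 gt_eqF// mulr_gt0// exprn_gt0.
apply: (mulIf c0); rewrite cE -rmorphM /=; congr real_complex_def.
have pn : (pi : R) != 0 by rewrite gt_eqF.
by rewrite /c; move: (pi : R) pn => p pn; field.
Qed.

End Basel.

(** * The logarithm on the right half plane, and the kernel a / (pi (a^2 l^2 + j^2)) *)

Section Kernel.
Variable R : realType.
Local Notation C := R[i].

(** The principal branch, restricted to re z > 0, where the arctangent of im z / re z is the
    argument. *)
Definition clog (z : C) : C := (ln (re z ^+ 2 + im z ^+ 2) / 2 +i* atan (im z / re z))%C.

Lemma cexp_clog (z : C) : 0 < re z -> cexp (clog z) = z.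
Proof.
move=> z0; have n0 : 0 < normc z by rewrite normc_gt0 re_gt0_neq0.
have e1 : expR (ln (re z ^+ 2 + im z ^+ 2) / 2) = normc z.
  have -> : ln (re z ^+ 2 + im z ^+ 2) / 2 = ln (normc z).
    by rewrite -normc_sqr lnXn//; lra.
  by rewrite lnK// posrE.
have c1 : cos (atan (im z / re z)) = re z / normc z.
  rewrite cos_atan; have -> : 1 + (im z / re z) ^+ 2 = (normc z / re z) ^+ 2.
    by rewrite !expr_div_n normc_sqr; field; rewrite gt_eqF.
  by rewrite sqrtr_sqr ger0_norm ?invf_div// divr_ge0 ?normc_ge0 ?ltW.
have s1 : sin (atan (im z / re z)) = im z / normc z.
  have c0 : cos (atan (im z / re z)) != 0 by rewrite c1 gt_eqF// divr_gt0.
  have := atanK (im z / re z); rewrite /tan => /(congr1 ( *%R^~ (cos (atan (im z / re z))))).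
  by rewrite mulfVK// => ->; rewrite c1; field; rewrite !gt_eqF.
apply: complex_ext; rewrite /cexp /= e1 (c1, s1) mulrC mulfVK// gt_eqF//.
Qed.

Lemma clog1 : clog 1 = 0.
Proof.
by rewrite /clog /= expr1n expr0n /= addr0 ln1 mul0r mul0r atan0.
Qed.

Lemma clogM (r : R) (z : C) : 0 < r -> 0 < re z -> clog (r%:C%C * z) = (ln r)%:C%C + clog z.
Proof.
move=> r0 z0; have n0 : 0 < re z ^+ 2 + im z ^+ 2.
  by rewrite -normc_sqr exprn_gt0// normc_gt0 re_gt0_neq0.
have e1 : ln ((r * re z) ^+ 2 + (r * im z) ^+ 2) / 2 =
    ln r + ln (re z ^+ 2 + im z ^+ 2) / 2.
  by rewrite !exprMn -mulrDr lnM ?posrE ?exprn_gt0// lnXn//; lra.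
have e2 : r * im z / (r * re z) = im z / re z by field; rewrite !gt_eqF.
by rewrite /clog re_rmul im_rmul e2; apply: complex_ext; rewrite /= ?add0r.
Qed.

Lemma cder_clog (h : R -> C) t d : 0 < re (h t) -> cder h t d ->
  cder (fun s => clog (h s)) t (d / h t).
Proof.
move=> h0 [h1 h2].
have n0 : 0 < re (h t) * re (h t) + im (h t) * im (h t).
  by rewrite -!expr2 -normc_sqr exprn_gt0// normc_gt0 re_gt0_neq0.
have r0 : re (h t) != 0 by rewrite gt_eqF.
have r0' : (fun s => re (h s)) t != 0 by [].
have dn := is_deriveD (is_deriveM h1 h1) (is_deriveM h2 h2).
have n0' : 0 < ((fun s => re (h s)) * (fun s => re (h s)) +
            (fun s => im (h s)) * (fun s => im (h s))) t by [].
have nE : re (h t) * re (h t) + im (h t) * im (h t) != 0 by rewrite gt_eqF.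
split.
- have dl := is_deriveZ 2^-1 (is_derive1_comp (is_derive1_ln n0') dn).
  rewrite (_ : (fun s => re (clog (h s))) = 2^-1 \*: (@ln R \o
     ((fun s => re (h s)) * (fun s => re (h s)) + (fun s => im (h s)) * (fun s => im (h s))))).
    apply: is_derive_eq dl _.
    rewrite reM reV imV normc_sqr !expr2 /GRing.scale /= !fctE.
    by field.
  by apply/funext => s; rewrite /= /GRing.scale /= mulrC !expr2.
- have dq := is_deriveM h2 (is_deriveV r0' h1).
  have dl := is_derive1_comp (is_derive1_atan _) dq.
  rewrite (_ : (fun s => im (clog (h s))) = (@atan R \o
     ((fun s => im (h s)) * (fun s => (re (h s))^-1)))).
    apply: is_derive_eq dl _.
    rewrite imM reV imV normc_sqr !expr2 /GRing.scale /= !fctE.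
    have mE : re (h t) * re (h t) + im (h t) * im (h t) != 0 by [].
    have -> : 1 + im (h t) * (re (h t))^-1 * (im (h t) * (re (h t))^-1) =
      (re (h t) * re (h t) + im (h t) * im (h t)) / (re (h t) * re (h t)).
      by field.
    by field; rewrite r0 mE.
  by [].
Qed.

(** The constant of [sqr_sum_le_normcM], uniform over al <= re a and |im a| <= be. *)
Definition quad_cst (al be : R) : R := 2 + (2 * be ^+ 2 + 1) / al ^+ 2.

Lemma quad_cst_ge2 al be : 2 <= quad_cst al be.
Proof.
by rewrite /quad_cst lerDl divr_ge0 ?sqr_ge0// addr_ge0// mulr_ge0// sqr_ge0.
Qed.

Definition ker_den (a : C) (l j : nat) : C := a ^+ 2 * l%:R ^+ 2 + j%:R ^+ 2.

(** With z = 2 pi a these are the partial fraction terms of (bose (l z) - 1 / (l z) + 1/2) / l. The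
    symmetry [ker_inv] under a -> 1/a with [l] and [j] exchanged carries the modular
    transformation. *)
Definition ker (a : C) (l j : nat) : C := (pi^-1 : R)%:C%C * a / ker_den a l j.

Definition ker' (a : C) (l j : nat) : C :=
  (pi^-1 : R)%:C%C * (j%:R ^+ 2 - a ^+ 2 * l%:R ^+ 2) / ker_den a l j ^+ 2.

Section Cone.
Variables (al be : R).
Hypothesis al0 : 0 < al.

Local Notation K := (quad_cst al be).

Let K0 : 0 < K.
Proof. by apply: lt_le_trans (quad_cst_ge2 al be). Qed.

Lemma ker_den_ge (a : C) (l j : nat) : al <= re a -> `|im a| <= be ->
  j%:R ^+ 2 + l%:R ^+ 2 <= K * normc (ker_den a l j).
Proof.
move=> a1 a2; have := sqr_sum_le_normcM l%:R j%:R al0 a1 a2.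
by rewrite !realc_nat addrC [_ + a ^+ 2 * _]addrC addrC.
Qed.

Lemma ker_den_gt0 (a : C) (l j : nat) : al <= re a -> `|im a| <= be -> (0 < j)%N ->
  0 < normc (ker_den a l j).
Proof.
move=> a1 a2 j0; rewrite -(pmulr_rgt0 _ K0); apply: lt_le_trans (ker_den_ge l j a1 a2).
by rewrite ltr_wpDr ?sqr_ge0// exprn_gt0// ltr0n.
Qed.

Lemma lin_ge (a : C) (l j : nat) : al <= re a -> `|im a| <= be ->
  j%:R + l%:R <= 2 * K * normc (j%:R + 'i%C * a * l%:R).
Proof.
move=> a1 a2; have := sqr_sum_le_normc l%:R j%:R al0 a1 a2.
rewrite !realc_nat -/K; set x := normc _ => h.
have x0 : 0 <= x by exact: normc_ge0.
apply: ler_sqr_nonneg; first by rewrite mulr_ge0// mulr_ge0// ltW.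
apply: le_trans (_ : 2 * (K * x ^+ 2) <= _).
  apply: le_trans (_ : 2 * (j%:R ^+ 2 + l%:R ^+ 2) <= _).
    by have := sqr_ge0 (j%:R - l%:R : R); nra.
  by rewrite ler_pM2l.
have K2 := quad_cst_ge2 al be.
have -> : (2 * K * x) ^+ 2 = 4 * K * (K * x ^+ 2) by ring.
rewrite ler_wpM2r ?mulr_ge0 ?sqr_ge0 ?(ltW K0)//; lra.
Qed.

Lemma lin_geN (a : C) (l j : nat) : al <= re a -> `|im a| <= be ->
  j%:R + l%:R <= 2 * K * normc (j%:R - 'i%C * a * l%:R).
Proof.
move=> a1 a2; have := sqr_sum_le_normc (- l%:R) j%:R al0 a1 a2.
rewrite rmorphN /= !realc_nat mulrN sqrrN -/K; set x := normc _ => h.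
have x0 : 0 <= x by exact: normc_ge0.
apply: ler_sqr_nonneg; first by rewrite mulr_ge0// mulr_ge0// ltW.
apply: le_trans (_ : 2 * (K * x ^+ 2) <= _).
  apply: le_trans (_ : 2 * (j%:R ^+ 2 + l%:R ^+ 2) <= _).
    by have := sqr_ge0 (j%:R - l%:R : R); nra.
  by rewrite ler_pM2l.
have K2 := quad_cst_ge2 al be.
have -> : (2 * K * x) ^+ 2 = 4 * K * (K * x ^+ 2) by ring.
rewrite ler_wpM2r ?mulr_ge0 ?sqr_ge0 ?(ltW K0)//; lra.
Qed.

Lemma normc_ker_le (a : C) (l j : nat) : al <= re a -> `|im a| <= be -> (0 < j)%N ->
  normc (ker a l j) <= normc a * K * j%:R ^- 2.
Proof.
move=> a1 a2 j0; have := ker_den_ge l j a1 a2; have := ker_den_gt0 l a1 a2 j0.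
rewrite /ker normcM normcV normcM normcR; set x := normc (ker_den _ _ _) => x0 h.
have p2 := pi_ge2 R.
rewrite ger0_norm ?invr_ge0 ?pi_ge0//.
have j2 : 0 < j%:R ^+ 2 :> R by rewrite exprn_gt0// ltr0n.
rewrite ler_pdivrMr// mulrAC ler_pdivlMr// -[leRHS]mulrA.
have -> : pi^-1 * normc a * j%:R ^+ 2 = normc a * (pi^-1 * j%:R ^+ 2) by ring.
rewrite ler_wpM2l ?normc_ge0//.
apply: le_trans h; apply: le_trans (_ : j%:R ^+ 2 <= _); last by rewrite lerDl sqr_ge0.
by rewrite -[leRHS]mul1r ler_wpM2r ?(ltW j2)// invf_le1; lra.
Qed.

End Cone.

Lemma cder_ker (h : R -> C) t d l j : ker_den (h t) l j != 0 -> cder h t d ->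
  cder (fun s => ker (h s) l j) t (d * ker' (h t) l j).
Proof.
move=> D0 hd; rewrite /ker.
have hden : cder (fun s => ker_den (h s) l j) t (2 * h t * d * l%:R ^+ 2).
  rewrite /ker_den; apply: cder_eq (cderD (cderM (cderX 1 hd) (cder_cst _ t)) (cder_cst _ t)).
    by [].
  by rewrite expr1 mulr0 !addr0.
apply: cder_eq (cderM (cderZ _ hd) (cderV D0 hden)) => //.
rewrite /ker'.
have -> : j%:R ^+ 2 - h t ^+ 2 * l%:R ^+ 2 = ker_den (h t) l j - 2 * h t ^+ 2 * l%:R ^+ 2.
  by rewrite /ker_den; ring.
by move: ((pi^-1 : R)%:C%C) => p; field.
Qed.

(** The derivative in [a] is, up to 1 / pi, a mean of two inverse squares of linear forms in [j], so
    its sum over [j] nearly telescopes. *)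
Lemma ker'_split (a : C) (l j : nat) :
  j%:R + 'i%C * a * l%:R != 0 -> j%:R - 'i%C * a * l%:R != 0 ->
  ker' a l j = (pi^-1 : R)%:C%C * (2^-1 * ((j%:R + 'i%C * a * l%:R) ^- 2 +
               (j%:R - 'i%C * a * l%:R) ^- 2)).
Proof.
set x := 'i%C * a * l%:R => x1 x2.
have xE : a ^+ 2 * l%:R ^+ 2 = - x ^+ 2.
  by rewrite /x !exprMn sqr_i; ring.
rewrite /ker' /ker_den xE.
have -> : - x ^+ 2 + j%:R ^+ 2 = (j%:R + x) * (j%:R - x) by ring.
by move: ((pi^-1 : R)%:C%C) => p; field; rewrite x1 x2.
Qed.

Lemma inv_split (a : C) (l N : nat) :
  N%:R + 'i%C * a * l%:R != 0 -> N%:R - 'i%C * a * l%:R != 0 ->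
  2^-1 * ((N%:R + 'i%C * a * l%:R)^-1 + (N%:R - 'i%C * a * l%:R)^-1) =
  N%:R / ker_den a l N.
Proof.
set x := 'i%C * a * l%:R => x1 x2.
have xE : a ^+ 2 * l%:R ^+ 2 = - x ^+ 2.
  by rewrite /x !exprMn sqr_i; ring.
rewrite /ker_den xE.
have -> : - x ^+ 2 + N%:R ^+ 2 = (N%:R + x) * (N%:R - x) by ring.
by field; rewrite x1 x2.
Qed.

(** The inverse square differs from 1 / (j + x) - 1 / (j + 1 + x) by a cubic term, which is small
    enough to be summed over both [j] and [l]. *)
Lemma telescope_inv_sqr (x : C) (l : nat) (K : R) (N M : nat) : (0 < l)%N -> 0 <= K ->
  (forall j : nat, j%:R + l%:R <= K * normc (j%:R + x)) -> (N <= M)%N ->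
  normc (\sum_(N <= j < M) (j.+1%:R + x) ^- 2 - ((N%:R + x)^-1 - (M%:R + x)^-1)) <=
  K ^+ 3 * \sum_(N <= j < M) (j%:R + l%:R) ^- 3.
Proof.
move=> l0 K0 h NM.
have l0' : 0 < l%:R :> R by rewrite ltr0n.
have jl (j : nat) : 0 < j%:R + l%:R :> R by rewrite ltr_wpDl.
have n0 (j : nat) : 0 < normc (j%:R + x).
  rewrite lt_neqAle normc_ge0 andbT eq_sym; apply/eqP => jE.
  by have := h j; rewrite jE mulr0 leNgt jl.
have x0 (j : nat) : j%:R + x != 0 by rewrite -normc_gt0.
have -> : (N%:R + x)^-1 - (M%:R + x)^-1 =
   \sum_(N <= j < M) ((j%:R + x)^-1 - (j.+1%:R + x)^-1).
  rewrite -opprB -(telescope_sumr (fun j => (j%:R + x)^-1) NM) -sumrN.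
  by apply: eq_bigr => j _; rewrite opprB.
rewrite -sumrB mulr_sumr; apply: le_trans (normc_sum _ _ _) _; apply: ler_sum => j _.
have -> : (j.+1%:R + x) ^- 2 - ((j%:R + x)^-1 - (j.+1%:R + x)^-1) =
   - ((j.+1%:R + x) ^- 2 * (j%:R + x)^-1).
  have := x0 j.+1; have := x0 j; rewrite -[j.+1%:R]natr1; move: (j%:R : C) => y y0 y1.
  by field; rewrite y0 y1.
have hV (i : nat) : normc (i%:R + x)^-1 <= K / (i%:R + l%:R).
  by rewrite normcV ler_pdivlMr// mulrC ler_pdivrMr.
have hV' : normc (j.+1%:R + x)^-1 <= K / (j%:R + l%:R).
  apply: le_trans (hV j.+1) _; rewrite ler_wpM2l// lef_pV2 ?posrE// lerD2r.
  by rewrite ler_nat.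
rewrite normcN normcM -[(j.+1%:R + x) ^- 2]exprVn normcX.
have -> : K ^+ 3 * (j%:R + l%:R) ^- 3 = (K / (j%:R + l%:R)) ^+ 2 * (K / (j%:R + l%:R)) :> R.
  by rewrite -exprSr expr_div_n.
have Kj : 0 <= K / (j%:R + l%:R) by rewrite divr_ge0// ltW.
apply: ler_pM; rewrite ?normc_ge0 ?sqr_ge0//.
by rewrite lerXn2r ?nnegrE ?normc_ge0.
Qed.

(** With y = j + l, the inverse cube is at most 2 / (y (y^2 - 1)) = 1 / ((y - 1) y) - 1 / (y (y +
    1)), which telescopes. *)
Lemma sum_inv_cube_le (l N M : nat) : (0 < l)%N -> (0 < N)%N -> (N <= M)%N ->
  \sum_(N <= j < M) (j%:R + l%:R : R) ^- 3 <= ((N%:R + l%:R - 1) * (N%:R + l%:R))^-1.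
Proof.
move=> l0 N0 NM; have l1 : 1 <= l%:R :> R by rewrite ler1n.
have N1 : 1 <= N%:R :> R by rewrite ler1n.
suff H : \sum_(N <= j < M) (j%:R + l%:R : R) ^- 3 <= ((N%:R + l%:R - 1) * (N%:R + l%:R))^-1
    - ((M%:R + l%:R - 1) * (M%:R + l%:R))^-1.
  apply: le_trans H _; rewrite gerBl invr_ge0.
  have : N%:R <= M%:R :> R by rewrite ler_nat.
  by move=> ?; rewrite mulr_ge0//; lra.
rewrite -opprB -(telescope_sumr (fun j => ((j%:R + l%:R - 1) * (j%:R + l%:R) : R)^-1) NM).
rewrite -sumrN big_nat [leRHS]big_nat; apply: ler_sum => j /andP[Nj _].
have j1 : 1 <= j%:R :> R by rewrite ler1n (leq_trans N0 Nj).
rewrite -[j.+1%:R]natr1; set y := j%:R + l%:R.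
have -> : j%:R + 1 + l%:R - 1 = y by rewrite /y; ring.
have -> : j%:R + 1 + l%:R = y + 1 by rewrite /y; ring.
have y2 : 2 <= y by rewrite /y; lra.
have -> : - ((y * (y + 1))^-1 - ((y - 1) * y)^-1) = 2 / (y * (y ^+ 2 - 1)).
  have y0 : y != 0 by rewrite gt_eqF//; lra.
  have y1 : y + 1 != 0 by rewrite gt_eqF//; lra.
  have y1' : y - 1 != 0 by rewrite gt_eqF//; lra.
  have -> : y ^+ 2 - 1 = (y - 1) * (y + 1) by ring.
  by field; rewrite y0 y1 y1'.
have p : 0 < y * (y ^+ 2 - 1) by rewrite mulr_gt0//; nra.
rewrite ler_pdivlMr// mulrC ler_pdivrMr; last by rewrite exprn_gt0//; lra.
by rewrite exprS; have := sqr_ge0 y; nra.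
Qed.

Lemma sum_inv_prod_le (N L : nat) : (0 < N)%N ->
  \sum_(l < L) ((N%:R + l.+1%:R - 1) * (N%:R + l.+1%:R) : R)^-1 <= N%:R^-1.
Proof.
move=> N0; have N1 : 1 <= N%:R :> R by rewrite ler1n.
suff : \sum_(l < L) ((N%:R + l.+1%:R - 1) * (N%:R + l.+1%:R) : R)^-1 =
  N%:R^-1 - (N%:R + L%:R)^-1.
  by move=> ->; rewrite gerBl invr_ge0 addr_ge0.
elim: L => [|L IH]; first by rewrite big_ord0 addr0 subrr.
rewrite big_ord_recr /= IH -[L.+1%:R]natr1; have : 0 <= L%:R :> R by [].
move: (N%:R) (L%:R) N1 => x y x1 y0.
have x0 : x != 0 by rewrite gt_eqF//; lra.
have xy : x + y != 0 by rewrite gt_eqF//; lra.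
have xy1 : x + (y + 1) != 0 by rewrite gt_eqF//; lra.
have -> : x + (y + 1) - 1 = x + y by ring.
by field; rewrite x0 xy xy1.
Qed.

Lemma tail_inv_sqr_le (L m : nat) : (0 < L)%N -> (L <= m)%N ->
  \sum_(i < m) (i.+1%:R : R) ^- 2 - \sum_(i < L) (i.+1%:R : R) ^- 2 <= L%:R^-1.
Proof.
move=> L0 Lm; rewrite (@sum_ord_cat _ (fun i => (i.+1%:R : R) ^- 2) _ _ Lm) [X in X - _]addrC addrK.
apply: le_trans (_ : L%:R^-1 - m%:R^-1 <= _); last by rewrite gerBl invr_ge0.
rewrite -opprB -(telescope_sumr (fun j => (j%:R : R)^-1) Lm) -sumrN.
rewrite big_nat [leRHS]big_nat; apply: ler_sum => j /andP[Lj _].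
have j1 : 1 <= j%:R :> R by rewrite ler1n (leq_trans L0 Lj).
rewrite -[j.+1%:R]natr1; move: (j%:R) j1 => y y1.
have y0 : y != 0 by rewrite gt_eqF//; lra.
have y0' : y + 1 != 0 by rewrite gt_eqF//; lra.
have -> : - ((y + 1)^-1 - y^-1) = (y * (y + 1))^-1 by field; rewrite y0 y0'.
rewrite lef_pV2 ?posrE ?exprn_gt0 ?mulr_gt0//; nra.
Qed.

End Kernel.

(** * The modular transformation *)

Section EtaTransformation.
Variable R : realType.
Local Notation C := R[i].
Local Notation T := ((2 * pi : R)%:C%C).

Lemma twopi_neq0 : T != 0 :> C.
Proof. by rewrite fmorph_eq0 mulf_neq0// gt_eqF// pi_gt0. Qed.

Lemma invpiE : (pi^-1 : R)%:C%C = 2 / T :> C.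
Proof.
have p0 : (pi : R) != 0 by rewrite gt_eqF// pi_gt0.
have -> : (2 : C) = (2 : R)%:C%C by rewrite realc_nat.
rewrite -fmorph_div; congr real_complex_def; move: (pi : R) p0 => p p0.
by field.
Qed.

Lemma normc_invpi_le1 : normc (pi^-1 : R)%:C%C <= 1.
Proof.
have p2 := pi_ge2 R.
by rewrite normcR ger0_norm ?invr_ge0 ?pi_ge0// invf_le1; lra.
Qed.

Lemma ker_pf_term (z : C) (l j : nat) :
  l.+1%:R^-1 * pf_term (l.+1%:R * z) j = ker (z / T) l.+1 j.+1.
Proof.
rewrite /ker invpiE /ker_den /pf_term.
have T0 := twopi_neq0; have l0 : (l.+1%:R : C) != 0 by rewrite pnatr_eq0.
move: T T0 l0; move: (l.+1%:R : C) (j.+1%:R : C) => x y t t0 x0.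
have -> : (z / t) ^+ 2 * x ^+ 2 + y ^+ 2 = ((x * z) ^+ 2 + (t * y) ^+ 2) / t ^+ 2.
  by field.
rewrite invf_div; move: ((x * z) ^+ 2 + (t * y) ^+ 2) => X.
have -> : x^-1 * (2 * (x * z) / X) = 2 * z * X^-1.
  by rewrite !mulrA; congr (_ / _); field.
have -> : 2 / t * (z / t) * (t ^+ 2 / X) = 2 * z * X^-1 => //.
by rewrite !mulrA; congr (_ / _); field.
Qed.

Lemma pf_term_ker (a : C) (l N : nat) : a != 0 ->
  pf_term (T * N%:R / a) l = a * ((pi^-1 : R)%:C%C * (N%:R / ker_den a l.+1 N)).
Proof.
move=> a0; rewrite invpiE /ker_den /pf_term.
have T0 := twopi_neq0.
move: T T0; move: (l.+1%:R : C) (N%:R : C) => x y t t0.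
have -> : (t * y / a) ^+ 2 + (t * x) ^+ 2 = (a ^+ 2 * x ^+ 2 + y ^+ 2) / (a ^+ 2 / t ^+ 2).
  by field; rewrite a0 t0.
rewrite invf_div; move: (a ^+ 2 * x ^+ 2 + y ^+ 2) => X.
by rewrite !mulrA; congr (_ / _); field; rewrite a0 t0.
Qed.

Lemma ker_inv (a : C) (l j : nat) : a != 0 -> ker a^-1 j l = ker a l j.
Proof.
move=> a0; rewrite /ker /ker_den.
have -> : a^-1 ^+ 2 * j%:R ^+ 2 + l%:R ^+ 2 = (a ^+ 2 * l%:R ^+ 2 + j%:R ^+ 2) / a ^+ 2.
  by field.
rewrite invf_div; move: (a ^+ 2 * _ + _) => X.
rewrite -!mulrA; congr (_ * _); rewrite !mulrA; congr (_ / _); by field.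
Qed.

(** What remains when the kernel sum over l < N^2, j < N is removed from that over l < N^2, j < N^4.
    The first comes from N terms of the series at 4 pi^2 / z after exchange of indices, the second
    from N^2 terms of the series at z. The exponents make both truncation errors in [j] O(1/N): N^2
    / N^4 and N / N^2. *)
Definition Dsum (N : nat) (a : C) : C :=
  \sum_(l < (N ^ 2)%N) \sum_(N <= j < (N ^ 4)%N) ker a l.+1 j.+1.

Definition Dsum' (N : nat) (a : C) : C :=
  \sum_(l < (N ^ 2)%N) \sum_(N <= j < (N ^ 4)%N) ker' a l.+1 j.+1.

Section Cone.
Variables (al be B : R).
Hypothesis (al0 : 0 < al).
Local Notation K := (quad_cst al be).

Let K0 : 0 < K.
Proof. by apply: lt_le_trans (quad_cst_ge2 al be). Qed.

Lemma ker'_inner_sum (a : C) (l N M : nat) : al <= re a -> `|im a| <= be ->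
  (0 < N)%N -> (N <= M)%N ->
  normc (\sum_(N <= j < M) ker' a l.+1 j.+1 -
         (pi^-1 : R)%:C%C * (N%:R / ker_den a l.+1 N - M%:R / ker_den a l.+1 M)) <=
  (2 * K) ^+ 3 * ((N%:R + l.+1%:R - 1) * (N%:R + l.+1%:R))^-1.
Proof.
move=> a1 a2 N0 NM; set x := 'i%C * a * l.+1%:R.
have K2 : 0 <= 2 * K by rewrite mulr_ge0// ltW.
have h1 (j : nat) : j%:R + l.+1%:R <= 2 * K * normc (j%:R + x) by exact: lin_ge.
have h2 (j : nat) : j%:R + l.+1%:R <= 2 * K * normc (j%:R + (- x)) by exact: lin_geN.
have jl (j : nat) : 0 < j%:R + l.+1%:R :> R by rewrite ltr_wpDl// ltr0n.
have nz1 (j : nat) : j%:R + x != 0.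
  apply/eqP => jE; have := h1 j; rewrite jE normc0 mulr0 leNgt jl//.
have nz2 (j : nat) : j%:R - x != 0.
  apply/eqP => jE; have := h2 j; rewrite jE normc0 mulr0 leNgt jl//.
have t1 := telescope_inv_sqr (ltn0Sn l) K2 h1 NM.
have t2 := telescope_inv_sqr (ltn0Sn l) K2 h2 NM.
have t3 := @sum_inv_cube_le R l.+1 N M (ltn0Sn l) N0 NM.
rewrite -!inv_split//.
under eq_bigr do rewrite ker'_split//.
rewrite -!mulr_sumr big_split /= -mulrBr normcM.
apply: le_trans (ler_wpM2r (normc_ge0 _) normc_invpi_le1) _; rewrite mul1r.
set S1 := \sum_(N <= j < M) (j.+1%:R + x) ^- 2 in t1 *.
set S2 := \sum_(N <= j < M) (j.+1%:R - x) ^- 2 in t2 *.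
have -> : 2^-1 * (S1 + S2) - (2^-1 * ((N%:R + x)^-1 + (N%:R - x)^-1) -
    2^-1 * ((M%:R + x)^-1 + (M%:R - x)^-1)) =
  2^-1 * ((S1 - ((N%:R + x)^-1 - (M%:R + x)^-1)) + (S2 - ((N%:R - x)^-1 - (M%:R - x)^-1))).
  by ring.
rewrite normcM normcV normc_nat.
set y := (2 * K) ^+ 3 * _ in t1 t2.
have y3 : y <= (2 * K) ^+ 3 * ((N%:R + l.+1%:R - 1) * (N%:R + l.+1%:R))^-1.
  by rewrite ler_wpM2l// exprn_ge0.
apply: le_trans y3.
have := normcD (S1 - ((N%:R + x)^-1 - (M%:R + x)^-1)) (S2 - ((N%:R - x)^-1 - (M%:R - x)^-1)).
lra.
Qed.

Lemma ker_top_le (a : C) (l M : nat) : al <= re a -> `|im a| <= be -> (0 < M)%N ->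
  normc ((pi^-1 : R)%:C%C * (M%:R / ker_den a l M)) <= K / M%:R.
Proof.
move=> a1 a2 M0; rewrite normcM; apply: le_trans (ler_wpM2r (normc_ge0 _) normc_invpi_le1) _.
rewrite mul1r normcM normcV normc_nat.
have := ker_den_ge al0 l M a1 a2; have := ker_den_gt0 al0 l a1 a2 M0.
set x := normc _ => x0 h; have M1 : 0 < M%:R :> R by rewrite ltr0n.
rewrite ler_pdivrMr// mulrAC ler_pdivlMr// -expr2; apply: le_trans h.
by rewrite lerDl sqr_ge0.
Qed.

(** The sum over [l] of N / (pi (a^2 l^2 + N^2)) is again a partial fraction series, now at w = 2 pi
    N / a: it equals (bose w - 1/w + 1/2) / a, and only 1 / (2 a) survives as N grows. *)
Lemma ker_sum_limit (a : C) (N : nat) : al <= re a -> `|im a| <= be -> normc a <= B ->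
  (0 < N)%N ->
  normc (\sum_(l < (N ^ 2)%N) (pi^-1 : R)%:C%C * (N%:R / ker_den a l.+1 N) - (2 * a)^-1) <=
  al^-1 * (B ^+ 2 / al + B + B * K) / N%:R.
Proof.
move=> a1 a2 aB N0; have N1 : 0 < N%:R :> R by rewrite ltr0n.
have ra : 0 < re a by exact: lt_le_trans a1.
have a0 := re_gt0_neq0 ra.
have na : 0 < normc a by rewrite normc_gt0.
have nal : al <= normc a by exact: le_trans a1 (re_le_normc a).
have B0 : 0 < B by exact: lt_le_trans aB.
have p2 := pi_ge2 R.
pose w := T * N%:R / a.
have wE : w = (2 * pi * N%:R : R)%:C%C * a^-1 by rewrite /w -realc_nat -rmorphM.
have rw : re w = 2 * pi * N%:R * (re a / normc a ^+ 2) by rewrite wE re_rmul reV.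
have w0 : 0 < re w by rewrite rw !mulr_gt0 ?invr_gt0 ?exprn_gt0// pi_gt0.
have hb := bose_partial_fraction w0.
have L0 : (0 < N ^ 2)%N by rewrite expn_gt0 N0.
have nv (l : nat) : normc (pf_term w l) <= B * K * N%:R * l.+1%:R ^- 2.
  rewrite /w pf_term_ker// normcM normcM normcM normcV normc_nat.
  have := ker_den_ge al0 l.+1 N a1 a2; have := ker_den_gt0 al0 l.+1 a1 a2 N0.
  set x := normc (ker_den _ _ _) => x0 h.
  have l2 : 0 < l.+1%:R ^+ 2 :> R by rewrite exprn_gt0// ltr0n.
  have hx : x^-1 <= K * l.+1%:R ^- 2.
    rewrite -[leLHS]mul1r ler_pdivrMr// mulrAC ler_pdivlMr// mul1r.
    by apply: le_trans h; rewrite lerDr sqr_ge0.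
  have -> : B * K * N%:R * l.+1%:R ^- 2 = B * (1 * (N%:R * (K * l.+1%:R ^- 2))) by ring.
  apply: ler_pM; rewrite ?normc_ge0//; first by rewrite !mulr_ge0 ?normc_ge0 ?invr_ge0 ?ltW.
  apply: ler_pM; rewrite ?normc_ge0 ?normc_invpi_le1//.
    by rewrite mulr_ge0 ?invr_ge0 ?ltW.
  by rewrite ler_wpM2l.
have tl (m : nat) : (N ^ 2 <= m)%N ->
    \sum_(i < m) B * K * N%:R * i.+1%:R ^- 2 -
    \sum_(i < (N ^ 2)%N) B * K * N%:R * i.+1%:R ^- 2 <= B * K / N%:R :> R.
  move=> Lm; rewrite -!mulr_sumr -mulrBr.
  apply: le_trans (ler_wpM2l _ (tail_inv_sqr_le R L0 Lm)) _.
    by rewrite !mulr_ge0// ltW.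
  by rewrite natrX le_eqVlt; apply/orP; left; apply/eqP; field; rewrite gt_eqF.
have h := has_csum_tail_le nv tl hb.
have -> : \sum_(l < (N ^ 2)%N) (pi^-1 : R)%:C%C * (N%:R / ker_den a l.+1 N) - (2 * a)^-1 =
  a^-1 * (bose w - w^-1 - (bose w - w^-1 + 2^-1 - \sum_(l < (N ^ 2)%N) pf_term w l)).
  rewrite (eq_bigr (fun l : 'I__ => a^-1 * pf_term w l)).
    by rewrite -mulr_sumr invfM; ring.
  by move=> l _; rewrite /w pf_term_ker// mulKf.
rewrite normcM normcV -mulrA; apply: ler_pM; rewrite ?normc_ge0 ?invr_ge0 ?normc_ge0//.
  by rewrite lef_pV2 ?posrE.
apply: le_trans (normcB _ _) _; rewrite mulrDl; apply: lerD => //.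
apply: le_trans (normcB _ _) _; rewrite mulrDl; apply: lerD.
  apply: le_trans (normc_bose_leV w0) _; rewrite rw.
  have -> : (2 * pi * N%:R * (re a / normc a ^+ 2))^-1 =
     (2 * pi)^-1 * (normc a ^+ 2 / re a / N%:R).
    have := gt_eqF (pi_gt0 R); move: (pi : R) => p p0.
    by field; rewrite p0 !gt_eqF.
  rewrite -[leRHS]mul1r; apply: ler_pM.
  - by rewrite invr_ge0 mulr_ge0// pi_ge0.
  - by rewrite !mulr_ge0 ?invr_ge0 ?ltW// exprn_gt0.
  - by rewrite invf_le1; lra.
  rewrite ler_wpM2r ?invr_ge0//; apply: ler_pM; rewrite ?sqr_ge0 ?invr_ge0 ?(ltW ra)//.
    by rewrite lerXn2r ?nnegrE ?normc_ge0 ?(ltW B0).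
  by rewrite lef_pV2 ?posrE.
rewrite wE invfM invrK normcM normcV normcR_ge0; last by rewrite !mulr_ge0// ?pi_ge0// ltW.
rewrite mulrC ler_pM ?normc_ge0 ?invr_ge0//.
  by rewrite !mulr_ge0// ?pi_ge0.
rewrite lef_pV2 ?posrE ?mulr_gt0//; last by rewrite pi_gt0.
by rewrite -[leLHS]mul1r ler_wpM2r//; lra.
Qed.

(** After the near-telescoping in [j] only the edges j = N and j = N^4 remain. The lower one gives 1
    / (2 a), the upper one is at most N^2 K / N^4, and the cubic errors add up to O(1/N). *)
Lemma Dsum'_limit (a : C) (N : nat) : al <= re a -> `|im a| <= be -> normc a <= B ->
  (0 < N)%N ->
  normc (Dsum' N a - (2 * a)^-1) <=
  (al^-1 * (B ^+ 2 / al + B + B * K) + K + (2 * K) ^+ 3) / N%:R.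
Proof.
move=> a1 a2 aB N0; have N1 : 0 < N%:R :> R by rewrite ltr0n.
have N1' : 1 <= N%:R :> R by rewrite ler1n.
have NM : (N <= N ^ 4)%N by rewrite -[leqLHS]expn1 leq_pexp2l.
have M0 : (0 < N ^ 4)%N by rewrite expn_gt0 N0.
rewrite /Dsum'; set p : C := (pi^-1 : R)%:C%C.
set M := (N ^ 4)%N in NM M0 *; set L := (N ^ 2)%N.
have -> : \sum_(l < L) \sum_(N <= j < M) ker' a l.+1 j.+1 - (2 * a)^-1 =
  (\sum_(l < L) p * (N%:R / ker_den a l.+1 N) - (2 * a)^-1) -
  \sum_(l < L) p * (M%:R / ker_den a l.+1 M) +
  \sum_(l < L) (\sum_(N <= j < M) ker' a l.+1 j.+1 -
     p * (N%:R / ker_den a l.+1 N - M%:R / ker_den a l.+1 M)).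
  rewrite [X in _ = _ + X](_ : _ = \sum_(l < L) \sum_(N <= j < M) ker' a l.+1 j.+1 -
    (\sum_(l < L) p * (N%:R / ker_den a l.+1 N) -
     \sum_(l < L) p * (M%:R / ker_den a l.+1 M))); first by ring.
  by rewrite -!sumrB; apply: eq_bigr => l _; rewrite mulrBr.
apply: le_trans (normcD _ _) _; rewrite [leRHS]mulrDl; apply: lerD.
  apply: le_trans (normcB _ _) _; rewrite [leRHS]mulrDl; apply: lerD.
    exact: ker_sum_limit.
  apply: le_trans (normc_sum _ _ _) _.
  apply: le_trans (_ : \sum_(l < L) K / M%:R <= _).
    by apply: ler_sum => l _; exact: ker_top_le.
  have -> : \sum_(l < L) K / M%:R = L%:R * (K / M%:R) by rewrite sumr_const card_ord mulr_natl.
  rewrite /L /M !natrX.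
  have -> : N%:R ^+ 2 * (K / N%:R ^+ 4) = (K / N%:R) / N%:R :> R by field; rewrite gt_eqF.
  by rewrite ler_pdivrMr// ler_peMr// divr_ge0// ltW.
apply: le_trans (normc_sum _ _ _) _.
apply: le_trans (_ : \sum_(l < L) (2 * K) ^+ 3 * ((N%:R + l.+1%:R - 1) * (N%:R + l.+1%:R))^-1 <= _).
  by apply: ler_sum => l _; exact: ker'_inner_sum.
rewrite -mulr_sumr ler_wpM2l// ?sum_inv_prod_le//.
by rewrite exprn_ge0// mulr_ge0// ltW.
Qed.

End Cone.

Lemma cder_sum_nat (m n : nat) (h : nat -> R -> C) t (d : nat -> C) :
  (forall i, (m <= i)%N -> cder (h i) t (d i)) ->
  cder (fun s => \sum_(m <= i < n) h i s) t (\sum_(m <= i < n) d i).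
Proof.
have E (f : nat -> C) : \sum_(m <= i < n) f i = \sum_(i < n - m) f (i + m)%N.
  by rewrite -{1}[m]add0n big_addn big_mkord.
move=> hd; rewrite E.
apply: cder_eq (@cder_sum _ (n - m) (fun i => h (i + m)%N) t (fun i => d (i + m)%N) _) => //.
by move=> i _; apply: hd; exact: leq_addl.
Qed.

(** Integrate [Dsum'_limit] along the segment from 1 to [a]: the limit 1 / (2 a) of the derivative
    has primitive [clog a / 2]. *)
Lemma Dsum_clog (a : C) : 0 < re a ->
  clim (fun n => Dsum n.+1 a - Dsum n.+1 1) (2^-1 * clog a).
Proof.
(* The minimum with 1 keeps the whole segment, including its end at 1, in the region where the
   constants are uniform. *)
move=> a0; pose al := Num.min 1 (re a).
have al0 : 0 < al by rewrite lt_min ltr01.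
have al1 : al <= 1 by rewrite ge_min lexx.
have ala : al <= re a by rewrite ge_min lexx orbT.
pose be := `|im a|; pose B := 1 + normc a.
pose KK := al^-1 * (B ^+ 2 / al + B + B * quad_cst al be) + quad_cst al be +
  (2 * quad_cst al be) ^+ 3.
apply: (@rlim0_le _ 0 _ (fun n => normc (a - 1) * KK / n.+1%:R)); last exact: rlim0_invn.
move=> n _; set N := n.+1.
pose at_ (t : R) : C := 1 + t%:C%C * (a - 1).
have rat (t : R) : 0 <= t <= 1 -> al <= re (at_ t).
  move=> /andP[t0 t1]; rewrite /at_ reD re_rmul reB /=.
  have : 0 <= t * (re a - al) by rewrite mulr_ge0// subr_ge0.
  have : 0 <= (1 - t) * (1 - al) by rewrite mulr_ge0// subr_ge0.
  by nra.
have iat (t : R) : 0 <= t <= 1 -> `|im (at_ t)| <= be.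
  move=> /andP[t0 t1]; rewrite /at_ imD im_rmul imB /= subr0 add0r normrM ger0_norm//.
  by rewrite -[leRHS]mul1r ler_wpM2r.
have nat_ (t : R) : 0 <= t <= 1 -> normc (at_ t) <= B.
  move=> /andP[t0 t1]; have -> : at_ t = (1 - t)%:C%C + t%:C%C * a.
    by rewrite /at_ rmorphB /=; ring.
  apply: le_trans (normcD _ _) _; rewrite normcM !normcR_ge0//; last by rewrite subr_ge0.
  apply: lerD; first by rewrite gerBl.
  by rewrite -[leRHS]mul1r ler_wpM2r ?normc_ge0.
pose h (t : R) : C := Dsum N (at_ t) - 2^-1 * clog (at_ t).
pose g (t : R) : R := normc (a - 1) * KK / N%:R * t ^+ 1.
have -> : Dsum N a - Dsum N 1 - 2^-1 * clog a = h 1 - h 0.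
  have at1 : at_ 1 = a by rewrite /at_ mul1r addrC subrK.
  have at0 : at_ 0 = 1 by rewrite /at_ mul0r addr0.
  by rewrite /h at1 at0 clog1 mulr0 subr0; ring.
have -> : normc (a - 1) * KK / N%:R = g 1 - g 0.
  by rewrite /g expr1n expr0n /= mulr1 mulr0 subr0.
apply: (@mean_value_le _ h (fun t => (a - 1) * (Dsum' N (at_ t) - (2 * at_ t)^-1)) g
  (fun t => normc (a - 1) * KK / N%:R * 1%:R * t ^+ 0)) => t t01.
- have ha : cder at_ t (a - 1).
    apply: cder_eq (cderD (cder_cst 1 t) (cderM (cder_id t) (cder_cst (a - 1) t))) => //.
    by rewrite mul1r mulr0 addr0 add0r.
  have rt : 0 < re (at_ t) by exact: lt_le_trans (rat t t01).
  apply: cder_eq (cderB (@cder_sum _ (N ^ 2) (fun l s => \sum_(N <= j < (N ^ 4)%N)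
     ker (at_ s) l.+1 j.+1) t (fun l => \sum_(N <= j < (N ^ 4)%N) (a - 1) * ker' (at_ t) l.+1 j.+1) _)
     (cderZ 2^-1 (cder_clog rt ha))) => //.
    rewrite mulrBr /Dsum' mulr_sumr; congr (_ - _).
      by apply: eq_bigr => l _; rewrite mulr_sumr.
    by rewrite invfM mulrCA.
  move=> l _; apply: cder_sum_nat => j _; apply: cder_ker ha.
  by rewrite -normc_gt0; apply: (ker_den_gt0 al0) (rat t t01) (iat t t01) _.
- rewrite expr0 !mulr1 normcM -mulrA ler_wpM2l ?normc_ge0//.
  exact: Dsum'_limit al0 _ _ (rat t t01) (iat t t01) (nat_ t t01) _.
Qed.

(** The f of the overview. With q = e^{-z} it is the logarithm of the product of 1 / (1 - q^m), that
    is minus log eta without its linear term z / 24. *)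
Definition etalog (z : C) : C := csum (fun l => bose (l.+1%:R * z) / l.+1%:R).

Lemma re_natM (n : nat) (z : C) : re (n%:R * z) = n%:R * re z.
Proof. by rewrite -realc_nat re_rmul. Qed.

Lemma re_natM_gt0 (n : nat) (z : C) : 0 < re z -> 0 < re (n.+1%:R * z).
Proof. by move=> z0; rewrite re_natM mulr_gt0// ltr0n. Qed.

Lemma normc_etalog_term (z : C) (l : nat) : 0 < re z ->
  normc (bose (l.+1%:R * z) / l.+1%:R) <= (re z)^-1 * l.+1%:R ^- 2.
Proof.
move=> z0; rewrite normcM normcV normc_nat.
apply: le_trans (ler_wpM2r _ (normc_bose_leV (re_natM_gt0 l z0))) _.
  by rewrite invr_ge0.
rewrite re_natM expr2 !invfM le_eqVlt; apply/orP; left; apply/eqP; ring.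
Qed.

Lemma etalogP (z : C) : 0 < re z ->
  has_csum (fun l => bose (l.+1%:R * z) / l.+1%:R) (etalog z).
Proof.
move=> z0; apply: csumP; apply: (csummable_le (B := (re z)^-1 * 2)).
  by move=> l; exact: normc_etalog_term.
by move=> n; rewrite -mulr_sumr ler_wpM2l ?sum_inv_sqr_le// invr_ge0 ltW.
Qed.

(** The polar part 1 / (l^2 z) is removed. The divergent harmonic part, the sum of 1 / (2 l), does
    not depend on [z] and is left to cancel later. *)
Definition eta_partial (L : nat) (z : C) : C :=
  \sum_(l < L) bose (l.+1%:R * z) / l.+1%:R - z^-1 * \sum_(l < L) l.+1%:R ^- 2.

Lemma eta_partial_ker (z : C) : 0 < re z -> exists2 K : R, 0 <= K &
  forall L J : nat, (0 < J)%N ->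
  normc (eta_partial L z + 2^-1 * \sum_(l < L) l.+1%:R^-1 -
         \sum_(l < L) \sum_(j < J) ker (z / T) l.+1 j.+1) <= K * L%:R / J%:R.
Proof.
move=> z0; pose a := z / T.
have ra : 0 < re a.
  rewrite /a -fmorphV mulrC re_rmul mulr_gt0// invr_gt0 mulr_gt0// pi_gt0//.
pose K := quad_cst (re a) `|im a|.
have K0 : 0 <= K by apply: le_trans (quad_cst_ge2 _ _).
exists (normc a * K) => [|L J J0]; first by rewrite mulr_ge0 ?normc_ge0.
have -> : eta_partial L z + 2^-1 * \sum_(l < L) l.+1%:R^-1 -
         \sum_(l < L) \sum_(j < J) ker a l.+1 j.+1 =
  \sum_(l < L) (l.+1%:R^-1 * (bose (l.+1%:R * z) - (l.+1%:R * z)^-1 + 2^-1) -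
     \sum_(j < J) ker a l.+1 j.+1).
  rewrite /eta_partial !mulr_sumr -sumrB -big_split /= -sumrB; apply: eq_bigr => l _.
  by congr (_ - _); rewrite (expr2 (l.+1%:R)) !invfM; ring.
apply: le_trans (normc_sum _ _ _) _.
apply: le_trans (_ : \sum_(l < L) normc a * K / J%:R <= _); last first.
  have -> : \sum_(l < L) normc a * K / J%:R = L%:R * (normc a * K / J%:R).
    by rewrite sumr_const card_ord mulr_natl.
  by rewrite mulrC mulrAC.
apply: ler_sum => l _.
have hs : has_csum (fun j => ker a l.+1 j.+1)
    (l.+1%:R^-1 * (bose (l.+1%:R * z) - (l.+1%:R * z)^-1 + 2^-1)).
  apply: eq_has_csum (has_csumZ l.+1%:R^-1 (bose_partial_fraction (re_natM_gt0 l z0))).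
  by move=> j; rewrite ker_pf_term.
apply: (@has_csum_tail_le _ _ _ (fun j => normc a * K * j.+1%:R ^- 2) J _ _ _ hs).
  by move=> j; exact: normc_ker_le.
move=> m Jm; rewrite -!mulr_sumr -mulrBr ler_wpM2l ?tail_inv_sqr_le//.
by rewrite mulr_ge0 ?normc_ge0.
Qed.

Lemma eta_partial_Dsum (z : C) : 0 < re z -> exists K : R, forall n,
  normc (eta_partial (n.+1 ^ 2) z - eta_partial n.+1 (T ^+ 2 / z) +
    2^-1 * (\sum_(l < (n.+1 ^ 2)%N) l.+1%:R^-1 - \sum_(l < n.+1) l.+1%:R^-1) -
    Dsum n.+1 (z / T)) <= K / n.+1%:R.
Proof.
move=> z0; have zn := re_gt0_neq0 z0; have T0 := twopi_neq0.
have z0' : 0 < re (T ^+ 2 / z).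
  by rewrite -rmorphXn re_rmul mulr_gt0 ?reV_gt0// exprn_gt0// mulr_gt0// pi_gt0.
have [K1 K10 h1] := eta_partial_ker z0.
have [K2 K20 h2] := eta_partial_ker z0'.
exists (K1 + K2) => n; set N := n.+1.
have N1 : 1 <= N%:R :> R by rewrite ler1n.
have N0 : 0 < N%:R :> R by rewrite ltr0n.
have NM : (N <= N ^ 4)%N by rewrite -[leqLHS]expn1 leq_pexp2l.
have M0 : (0 < N ^ 4)%N by rewrite expn_gt0.
have L0 : (0 < N ^ 2)%N by rewrite expn_gt0.
have g1 := h1 (N ^ 2)%N (N ^ 4)%N M0; have g2 := h2 N (N ^ 2)%N L0.
pose a := z / T.
have a0 : a != 0 by rewrite mulf_neq0// invr_eq0.
have aV : T ^+ 2 / z / T = a^-1 by rewrite /a; move: T T0 => t t0; field; rewrite zn t0.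
have kE : \sum_(l < N) \sum_(j < (N ^ 2)%N) ker (T ^+ 2 / z / T) l.+1 j.+1 =
   \sum_(l < (N ^ 2)%N) \sum_(j < N) ker a l.+1 j.+1.
  rewrite exchange_big; apply: eq_bigr => l _; apply: eq_bigr => j _.
  by rewrite aV ker_inv.
have DE : Dsum N a = \sum_(l < (N ^ 2)%N) \sum_(j < (N ^ 4)%N) ker a l.+1 j.+1 -
   \sum_(l < (N ^ 2)%N) \sum_(j < N) ker a l.+1 j.+1.
  rewrite /Dsum -sumrB; apply: eq_bigr => l _.
  by rewrite (@sum_ord_cat _ (fun j => ker a l.+1 j.+1) _ _ NM) [X in _ = X - _]addrC addrK.
move: g1 g2; rewrite kE -/a.
set A1 := eta_partial _ z; set A2 := eta_partial _ _; set H1 := \sum_(l < (N ^ 2)%N) _^-1.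
set H2 := \sum_(l < N) _^-1; rewrite DE.
set S1 := \sum_(l < _) \sum_(j < (N ^ 4)%N) _; set S2 := \sum_(l < _) _ => g1 g2.
have -> : A1 - A2 + 2^-1 * (H1 - H2) - (S1 - S2) =
  (A1 + 2^-1 * H1 - S1) - (A2 + 2^-1 * H2 - S2) by ring.
apply: le_trans (normcB _ _) _; rewrite mulrDl; apply: lerD.
  apply: le_trans g1 _; rewrite !natrX.
  have -> : K1 * N%:R ^+ 2 / N%:R ^+ 4 = K1 / N%:R / N%:R :> R by field; rewrite gt_eqF.
  by rewrite ler_pdivrMr// ler_peMr// divr_ge0// ltW.
apply: le_trans g2 _; rewrite natrX.
have -> : K2 * N%:R / N%:R ^+ 2 = K2 / N%:R :> R by field; rewrite gt_eqF.
exact: lexx.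
Qed.

Lemma eta_partial_clim (z : C) (g : nat -> nat) : (forall n, (n <= g n)%N) -> 0 < re z ->
  clim (fun n => eta_partial (g n) z) (etalog z - z^-1 * (pi ^+ 2 / 6)%:C%C).
Proof.
move=> gn z0; apply: (clim_sub (u := fun n => eta_partial n z)) gn _.
by apply: climB; [exact: etalogP | apply: climZ; exact: basel].
Qed.

(** [eta_partial_Dsum] at [z] is compared with itself at 2 pi, the fixed point of z -> 4 pi^2 / z:
    the harmonic sums cancel, and the difference of the two [Dsum] tends to [clog (z / T) / 2]. The
    terms in 1 / z and z come from [basel] at [z] and at 4 pi^2 / z. *)
Theorem etalog_transform (z : C) : 0 < re z ->
  etalog z = (pi ^+ 2 / 6)%:C%C / z - z / 24 + 2^-1 * clog (z / T) + etalog (T ^+ 2 / z).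
Proof.
move=> z0; have zn := re_gt0_neq0 z0; have T0 := twopi_neq0.
have z0' : 0 < re (T ^+ 2 / z).
  by rewrite -rmorphXn re_rmul mulr_gt0 ?reV_gt0// exprn_gt0// mulr_gt0// pi_gt0.
have rT : 0 < re T by rewrite /= mulr_gt0// pi_gt0.
have ra : 0 < re (z / T).
  by rewrite -fmorphV mulrC re_rmul mulr_gt0// invr_gt0 mulr_gt0// pi_gt0.
have TT : T ^+ 2 / T = T by move: T T0 => t t0; field.
have [K1 h1] := eta_partial_Dsum z0; have [K2] := eta_partial_Dsum rT.
rewrite TT (divff T0) => h2.
have sq n : (n <= n.+1 ^ 2)%N by rewrite (leq_trans (leqnSn n))// -[leqLHS]expn1 leq_pexp2l.
have E1 := climB (eta_partial_clim (g := fun n => (n.+1 ^ 2)%N) sq z0)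
                 (eta_partial_clim (g := S) leqnSn z0').
have E2 := climB (eta_partial_clim (g := fun n => (n.+1 ^ 2)%N) sq rT)
                 (eta_partial_clim (g := S) leqnSn rT).
have E := climB (climB E1 E2) (Dsum_clog ra).
have E0 : clim (fun n => eta_partial (n.+1 ^ 2) z - eta_partial n.+1 (T ^+ 2 / z) -
    (eta_partial (n.+1 ^ 2) T - eta_partial n.+1 T) - (Dsum n.+1 (z / T) - Dsum n.+1 1)) 0.
  apply: (@rlim0_le _ 0 _ (fun n => (K1 + K2) / n.+1%:R)); last exact: rlim0_invn.
  move=> n _; move: (h1 n) (h2 n).
  set P := eta_partial _ z; set P' := eta_partial _ _; set Q := eta_partial _ _.
  set Q' := eta_partial _ _; set H := 2^-1 * _; set X := Dsum _ _; set Y := Dsum _ _.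
  move=> g1 g2; have -> : P - P' - (Q - Q') - (X - Y) - 0 = (P - P' + H - X) - (Q - Q' + H - Y).
    by ring.
  by apply: le_trans (normcB _ _) _; rewrite [leRHS]mulrDl; exact: lerD.
have zz : (T ^+ 2 / z)^-1 * (pi ^+ 2 / 6)%:C%C = z / 24.
  rewrite invf_div fmorph_div !rmorphXn rmorphM /= !realc_nat.
  have p0 : pi%:C%C != 0 :> C by rewrite fmorph_eq0 gt_eqF// pi_gt0.
  by move: (pi%:C%C) p0 => p p0; field.
have := clim_unique E E0; rewrite zz subrr subr0 => H.
by apply/eqP; rewrite -subr_eq0; apply/eqP; rewrite -[RHS]H; ring.
Qed.

End EtaTransformation.

(** * From the formal product to the analytic generating function *)

Section PowerSeriesEvaluation.
Variable R : realType.
Local Notation C := R[i].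
Implicit Types (f g : fps) (q : C) (r : R).

(** Absolute convergence at radius [r] with an explicit bound, which is needed to be uniform over
    the partial products. *)
Definition fbd f r (B : R) :=
  forall n, \sum_(i < n) normc ((f i)%:~R : C) * r ^+ i <= B.

Definition fev f q (l : C) := has_csum (fun n => (f n)%:~R * q ^+ n) l.

Lemma fbd_csummable f q B : fbd f (normc q) B -> csummable (fun n => (f n)%:~R * q ^+ n).
Proof.
by move=> fB; exists B => n; apply: le_trans (fB n); apply: ler_sum => i _; rewrite normcM normcX.
Qed.

Lemma fbd_le f r (A B : R) : A <= B -> fbd f r A -> fbd f r B.
Proof. by move=> AB fA n; exact: le_trans (fA n) AB. Qed.

Lemma conv_sum_le (u v : nat -> R) (N : nat) : (forall i, 0 <= u i) -> (forall i, 0 <= v i) ->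
  \sum_(n < N) \sum_(i < n.+1) u i * v (n - i)%N <= (\sum_(i < N) u i) * (\sum_(j < N) v j).
Proof.
move=> u0 v0; pose a i n : R := if (n < i)%N then 0 else u i * v (n - i)%N.
have a0 i n : 0 <= a i n by rewrite /a; case: ifP => // _; rewrite mulr_ge0.
have -> : \sum_(n < N) \sum_(i < n.+1) u i * v (n - i)%N = \sum_(n < N) \sum_(i < N) a i n.
  apply: eq_bigr => n _.
  rewrite (big_ord_widen N (fun i => u i * v (n - i)%N) (ltn_ord n)) big_mkcond /=.
  by apply: eq_bigr => i _; rewrite /a ltnS leqNgt; case: ltnP.
rewrite exchange_big mulr_suml; apply: ler_sum => i _.
apply: le_trans (_ : \sum_(n < (i + N)%N) a i n <= _).
  by apply: (@ler_sum_nonneg _ (fun n => a i n)) (leq_addl _ _).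
rewrite big_split_ord /= big1 ?add0r; last by move=> j _; rewrite /a ltn_ord.
rewrite mulr_sumr; apply: ler_sum => j _.
by rewrite /a ltnNge leq_addr /= addKn.
Qed.

Lemma fbd_mul f g r A B : 0 <= r -> fbd f r A -> fbd g r B -> fbd (fps_mul f g) r (A * B).
Proof.
move=> r0 fA gB n.
have t0 h i : 0 <= normc ((h i)%:~R : C) * r ^+ i by rewrite mulr_ge0 ?normc_ge0// exprn_ge0.
apply: le_trans (_ : \sum_(m < n) \sum_(i < m.+1) (normc ((f i)%:~R : C) * r ^+ i) *
   (normc ((g (m - i)%N)%:~R : C) * r ^+ (m - i)) <= _).
  apply: ler_sum => m _; rewrite /fps_mul rmorph_sum /=.
  apply: le_trans (ler_wpM2r _ (normc_sum _ _ _)) _; first by rewrite exprn_ge0.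
  rewrite mulr_suml; apply: ler_sum => i _; rewrite rmorphM normcM /=.
  have im : (i <= m)%N by rewrite -ltnS.
  by rewrite mulrACA -exprD subnKC.
apply: le_trans (conv_sum_le _ (t0 f) (t0 g)) _.
by apply: ler_pM; rewrite ?sumr_ge0.
Qed.

Lemma fev_mul f g q A B F G : fbd f (normc q) A -> fbd g (normc q) B ->
  fev f q F -> fev g q G -> fev (fps_mul f g) q (F * G).
Proof.
move=> fA gB fF gG.
apply: eq_has_csum (cauchy_product (fbd_csummable fA) (fbd_csummable gB) fF gG) => n.
rewrite /fps_mul rmorph_sum mulr_suml; apply: eq_bigr => i _; rewrite rmorphM /=.
have im : (i <= n)%N by rewrite -ltnS.
by rewrite mulrACA -exprD subnKC.
Qed.

Lemma sum_delta (V : nzRingType) (F : nat -> V) (n m : nat) :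
  \sum_(i < n) ((i : nat) == m)%:R * F i = (m < n)%N%:R * F m.
Proof.
case: ltnP => mn.
  rewrite (bigD1 (Ordinal mn)) //= eqxx big1 ?addr0// => i im.
  by case: eqP => [iE|_]; [case/eqP: im; apply: val_inj | rewrite mul0r].
rewrite mul0r big1// => i _; case: eqP => [iE|_]; last by rewrite mul0r.
by have := ltn_ord i; rewrite iE ltnNge mn.
Qed.

Lemma fbd_one r : 0 <= r -> fbd fps_one r 1.
Proof.
move=> r0 n; apply: le_trans (_ : \sum_(i < n) ((i : nat) == 0%N)%:R * r ^+ i <= _).
  by apply: ler_sum => i _; rewrite /fps_one rmorph_nat normc_nat.
by rewrite (sum_delta (fun i => r ^+ i)) expr0 mulr1; case: ltnP.
Qed.

Lemma fev_one q : fev fps_one q 1.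
Proof.
have h : has_csum (fun n => (fps_one n)%:~R * q ^+ n) (\sum_(i < 1) (fps_one i)%:~R * q ^+ i).
  by apply: has_csum_finite => j; rewrite /fps_one; case: j => // j _; rewrite mul0r.
by move: h; rewrite big_ord1 /fps_one eqxx expr0 mulr1.
Qed.

Lemma fbd_1mX m r : 0 <= r -> fbd (fps_1mX m) r (1 + r ^+ m).
Proof.
move=> r0 n.
apply: le_trans (_ : \sum_(i < n) (((i : nat) == 0%N)%:R * r ^+ i + ((i : nat) == m)%:R * r ^+ i) <= _).
  apply: ler_sum => i _; rewrite -mulrDl ler_wpM2r ?exprn_ge0//.
  by rewrite /fps_1mX rmorphB /= !rmorph_nat; apply: le_trans (normcB _ _) _; rewrite !normc_nat.
rewrite big_split /= !(sum_delta (fun i => r ^+ i)) expr0 mulr1; apply: lerD.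
  by case: ltnP.
by case: ltnP => _; rewrite ?mul1r ?mul0r// exprn_ge0.
Qed.

Lemma fev_1mX m q : fev (fps_1mX m) q (1 - q ^+ m).
Proof.
have h : has_csum (fun n => (fps_1mX m n)%:~R * q ^+ n) (\sum_(i < m.+1) (fps_1mX m i)%:~R * q ^+ i).
  apply: has_csum_finite => j mj; rewrite /fps_1mX.
  by rewrite (gtn_eqF mj) (gtn_eqF (leq_ltn_trans (leq0n m) mj)) subrr mul0r.
move: h; congr has_csum.
transitivity (\sum_(i < m.+1) (((i : nat) == 0%N)%:R * q ^+ i - ((i : nat) == m)%:R * q ^+ i)).
  by apply: eq_bigr => i _; rewrite /fps_1mX rmorphB /= !rmorph_nat mulrBl.
by rewrite sumrB !(sum_delta (fun i => q ^+ i)) ltnSn /= expr0 !mul1r.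
Qed.

Lemma has_csum_ge_partial (v : nat -> R) (l : C) n : (forall i, 0 <= v i) ->
  has_csum (fun i => (v i)%:C%C) l -> \sum_(i < n) v i <= re l.
Proof.
move=> v0 vl; rewrite -lerN2 -reN; apply: (clim_re_le (N0 := n)) (climN vl) => m nm.
by rewrite reN lerN2 re_sum /=; exact: ler_sum_nonneg.
Qed.

Lemma fbd_1mXV_weak m r : 0 <= r < 1 -> fbd (fps_1mXV m) r (1 - r)^-1.
Proof.
move=> r01 n; apply: le_trans (sum_geo_le n r01); apply: ler_sum => i _.
rewrite /fps_1mXV rmorph_nat normc_nat -[leRHS]mul1r ler_wpM2r//.
  by rewrite exprn_ge0//; case/andP: r01.
by case: (_ %| _)%N.
Qed.

(** Once convergence is known, the value follows from the formal identity [fps_1mXK]. *)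
Lemma fev_1mXV m q : (0 < m)%N -> normc q < 1 -> fev (fps_1mXV m) q (1 - q ^+ m)^-1.
Proof.
move=> m0 q1; have r01 : 0 <= normc q < 1 by rewrite normc_ge0.
have bV := @fbd_1mXV_weak m _ r01.
have hV := csumP (fbd_csummable bV); set V := csum _ in hV.
have h := fev_mul (fbd_1mX m (normc_ge0 q)) bV (fev_1mX m q) hV.
have h1 : fev fps_one q ((1 - q ^+ m) * V).
  by apply: eq_has_csum h => n; rewrite fps_1mXK.
have e := has_csum_unique h1 (fev_one q).
have nz : 1 - q ^+ m != 0 by apply/eqP => qE; move: e; rewrite qE mul0r => /esym/eqP; rewrite oner_eq0.
suff -> : (1 - q ^+ m)^-1 = V by [].
by apply: (mulfI nz); rewrite e mulfV.
Qed.

(** The coefficients are nonnegative, so the bound is the value at [r]. Unlike the weak bound, it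
    tends to 1 with [m], so that an infinite product of such bounds converges. *)
Lemma fbd_1mXV m r : (0 < m)%N -> 0 <= r < 1 -> fbd (fps_1mXV m) r (1 - r ^+ m)^-1.
Proof.
move=> m0 /andP[r0 r1] n.
have nr : normc r%:C%C < 1 by rewrite normcR_ge0.
have h := fev_1mXV m0 nr.
have -> : (1 - r ^+ m)^-1 = re ((1 - r%:C%C ^+ m)^-1).
  by rewrite -rmorphXn -(rmorph1 (real_complex R)) -rmorphB -fmorphV.
apply: (@has_csum_ge_partial (fun i => normc ((fps_1mXV m i)%:~R : C) * r ^+ i)).
  by move=> i; rewrite mulr_ge0 ?normc_ge0// exprn_ge0.
apply: eq_has_csum h => i; rewrite rmorphM rmorphXn /=; congr (_ * _).
by rewrite /fps_1mXV rmorph_nat normc_nat realc_nat.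
Qed.

Lemma invB_le_exp (x c : R) : 0 <= x -> x <= c -> c < 1 -> (1 - x)^-1 <= expR (x / (1 - c)).
Proof.
move=> x0 xc c1; have p : 0 < 1 - x by lra.
apply: le_trans (_ : 1 + x / (1 - x) <= _).
  by rewrite le_eqVlt; apply/orP; left; apply/eqP; field; rewrite gt_eqF.
apply: le_trans (expR_ge1Dx _) _; rewrite ler_expR ler_wpM2l// lef_pV2 ?posrE; lra.
Qed.

Lemma invB_ge_1D (x : R) : 0 <= x < 1 -> 1 + x <= (1 - x)^-1.
Proof.
move=> /andP[x0 x1]; rewrite -[leRHS]mul1r ler_pdivlMr; last lra.
by have := sqr_ge0 x; nra.
Qed.

(** Each of the six elementary factors is bounded by the same exponential: 1 + x <= 1 / (1 - x) <=
    exp (x / (1 - r)) for 0 <= x <= r^m, m >= 1. *)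
Lemma fbd_factor k m r : (0 < m)%N -> 0 <= r < 1 ->
  fbd (brokenDiamond_factor k m) r (expR (r ^+ m / (1 - r)) ^+ 6).
Proof.
move=> m0 r01; have /andP[r0 r1] := r01.
have xr d : (0 < d)%N -> 0 <= r ^+ (d * m) <= r ^+ m.
  move=> d0; rewrite exprn_ge0//= mulnC exprM.
  by rewrite -[leRHS]expr1 ler_wiXn2l// ?exprn_ge0// exprn_ile1// ltW.
have rm1 : r ^+ m <= r by rewrite -[leRHS]expr1 ler_wiXn2l// ltW.
pose E := expR (r ^+ m / (1 - r)).
have bV d : (0 < d)%N -> (1 - r ^+ (d * m))^-1 <= E.
  move=> d0; have /andP[h0 h1] := xr d d0.
  apply: le_trans (invB_le_exp h0 (le_trans h1 rm1) r1) _.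
  by rewrite ler_expR ler_wpM2r// invr_ge0; lra.
have bX d : (0 < d)%N -> 1 + r ^+ (d * m) <= E.
  move=> d0; apply: le_trans (bV d d0); apply: invB_ge_1D.
  by have /andP[-> h1] := xr d d0; exact: le_lt_trans (le_trans h1 rm1) r1.
have fX d : (0 < d)%N -> fbd (fps_1mX (d * m)) r E.
  by move=> d0; apply: fbd_le (bX d d0) (fbd_1mX _ r0).
have fV d : (0 < d)%N -> fbd (fps_1mXV (d * m)) r E.
  by move=> d0; apply: fbd_le (bV d d0) (fbd_1mXV _ r01); rewrite muln_gt0 d0.
have -> : E ^+ 6 = (E * E) * ((E * (E * (E * 1))) * E) by ring.
rewrite /brokenDiamond_factor; apply: fbd_mul => //; apply: fbd_mul => //.
- exact: fX.
- by apply: fX; rewrite addn1.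
- by rewrite /fps_exp /=; do 3 (apply: fbd_mul => //; first by rewrite -[m]mul1n; exact: fV);
  exact: fbd_one.
- by apply: fV; rewrite addn2.
Qed.

Definition qfactor (k m : nat) q : C :=
  (1 - q ^+ (2 * m)) * (1 - q ^+ ((2 * k + 1) * m)) *
  ((1 - q ^+ m)^-1 ^+ 3 * (1 - q ^+ ((4 * k + 2) * m))^-1).

Lemma fev_factor k m q : (0 < m)%N -> normc q < 1 ->
  fev (brokenDiamond_factor k m) q (qfactor k m q).
Proof.
move=> m0 q1; have r0 := normc_ge0 q; have r01 : 0 <= normc q < 1 by rewrite r0.
have bX d := fbd_1mX d r0.
have bV d (d0 : (0 < d)%N) := fbd_1mXV d0 r01.
have M2 : (0 < (4 * k + 2) * m)%N by rewrite muln_gt0 addn2.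
rewrite /brokenDiamond_factor /qfactor /fps_exp /=.
have -> : (1 - q ^+ m)^-1 ^+ 3 = (1 - q ^+ m)^-1 * ((1 - q ^+ m)^-1 * ((1 - q ^+ m)^-1 * 1)).
  by rewrite mulr1 !exprS expr0 mulr1.
have b1 := fbd_one r0; have vm := bV m m0; have e1 := fev_1mXV m0 q1.
have c1 := fbd_mul r0 vm b1; have c2 := fbd_mul r0 vm c1; have c3 := fbd_mul r0 vm c2.
apply: fev_mul (fbd_mul r0 (bX _) (bX _)) (fbd_mul r0 c3 (bV _ M2)) _ _.
  by apply: fev_mul (bX _) (bX _) _ _; exact: fev_1mX.
apply: fev_mul c3 (bV _ M2) _ (fev_1mXV M2 q1).
exact: (fev_mul vm c2 e1 (fev_mul vm c1 e1 (fev_mul vm b1 e1 (fev_one q)))).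
Qed.

Lemma fbd_pprod k r N : 0 <= r < 1 ->
  fbd (fps_pprod (brokenDiamond_factor k) N) r (expR (6 / (1 - r) ^+ 2)).
Proof.
move=> r01; have /andP[r0 r1] := r01; have p : 0 < 1 - r by lra.
suff H : fbd (fps_pprod (brokenDiamond_factor k) N) r
    (expR (6 / (1 - r) * \sum_(i < N) r ^+ i.+1)).
  apply: fbd_le H; rewrite ler_expR expr2 invfM mulrA ler_wpM2l//.
    by rewrite divr_ge0// ltW.
  apply: le_trans (sum_geo_le N r01); apply: ler_sum => i _.
  by rewrite ler_wiXn2l// ltW.
elim: N => [|N IH] /=; first by rewrite big_ord0 mulr0 expR0; exact: fbd_one.
rewrite big_ord_recr /= mulrDr expRD; apply: fbd_mul => //.
have := @fbd_factor k N.+1 r isT r01; rewrite -expRM_natl; congr fbd; congr expR.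
by rewrite -mulr_natl; ring.
Qed.

Lemma fbd_Delta k r : 0 <= r < 1 -> fbd (Delta k) r (expR (6 / (1 - r) ^+ 2)).
Proof.
move=> r01 n; apply: le_trans (fbd_pprod k n r01 n).
by apply: ler_sum => i _; rewrite Delta_pprod// ltnW.
Qed.

Lemma fev_pprod k N q : normc q < 1 ->
  fev (fps_pprod (brokenDiamond_factor k) N) q (\prod_(m < N) qfactor k m.+1 q).
Proof.
move=> q1; have r01 : 0 <= normc q < 1 by rewrite normc_ge0.
elim: N => [|N IH] /=; first by rewrite big_ord0; exact: fev_one.
rewrite big_ord_recr /=.
exact: (fev_mul (fbd_pprod k N r01) (@fbd_factor k N.+1 _ isT r01) IH (@fev_factor k N.+1 q isT q1)).
Qed.

(** The coefficients of the N-th partial product and of [Delta k] agree up to [N]. Beyond, the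
    bounds at the larger radius r = (1 + |q|) / 2 gain the factor (|q| / r)^N. *)
Lemma prod_qfactor_clim k q F : normc q < 1 -> fev (Delta k) q F ->
  clim (fun N => \prod_(m < N) qfactor k m.+1 q) F.
Proof.
move=> q1 qF; pose r := (1 + normc q) / 2; have q0 := normc_ge0 q.
have r01 : 0 <= r < 1 by rewrite /r; apply/andP; split; lra.
have /andP[r0 r1] := r01; have rp : 0 < r by rewrite /r; lra.
have qr : normc q / r < 1 by rewrite ltr_pdivrMr// mul1r /r; lra.
pose BB := expR (6 / (1 - r) ^+ 2).
apply: (@rlim0_le _ 0 _ (fun N => (2 * BB) * (normc q / r) ^+ N)); last first.
  by apply: rlim0_geo; rewrite divr_ge0.
move=> N _; have h := has_csumB (fev_pprod k N q1) qF.
apply: has_csum_norm_le h => n.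
set P := fps_pprod _ _.
apply: le_trans (_ : \sum_(i < n) ((normc ((P i)%:~R : C) * r ^+ i) +
   (normc ((Delta k i)%:~R : C) * r ^+ i)) * (normc q / r) ^+ N <= _).
  apply: ler_sum => i _; rewrite -mulrBl normcM normcX.
  have [iN|Ni] := leqP i N.
    rewrite /P Delta_pprod// subrr normc0 mul0r.
    by rewrite mulr_ge0 ?exprn_ge0 ?divr_ge0// addr_ge0// mulr_ge0 ?normc_ge0// exprn_ge0.
  have -> : normc q ^+ i = r ^+ i * (normc q / r) ^+ i.
    by rewrite (expr_div_n (normc q)) mulrCA mulfV ?mulr1// expf_neq0// gt_eqF.
  rewrite mulrA -mulrDl; apply: ler_pM.
  - by rewrite mulr_ge0 ?normc_ge0// exprn_ge0.
  - by rewrite exprn_ge0// divr_ge0.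
  - by rewrite ler_wpM2r ?exprn_ge0// normcB.
  - by apply: ler_wiXn2l; [rewrite divr_ge0 | exact: ltW | exact: ltnW].
rewrite -mulr_suml; apply: ler_wpM2r; first by rewrite exprn_ge0// divr_ge0.
rewrite big_split /= mulr_natl mulr2n.
by apply: lerD; [exact: fbd_pprod | exact: fbd_Delta].
Qed.

Definition llog q : C := csum (fun i => q ^+ i.+1 / i.+1%:R).

Lemma llogP q : normc q < 1 -> has_csum (fun i => q ^+ i.+1 / i.+1%:R) (llog q).
Proof. by move=> q1; apply: csumP; exact: csummable_logseries. Qed.

Lemma cexp_llog q : normc q < 1 -> cexp (llog q) = (1 - q)^-1.
Proof. by move=> q1; apply: cexp_logseries => //; exact: llogP. Qed.

Lemma normc_cexpN_lt1 (w : C) : 0 < re w -> normc (cexp (- w)) < 1.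
Proof. by move=> w0; rewrite normc_cexp reN expR_lt1 oppr_lt0. Qed.

Lemma boseE (w : C) : bose w = cexp (- w) / (1 - cexp (- w)).
Proof.
have e0 := cexp_neq0 w; rewrite /bose cexpN.
have -> : 1 - (cexp w)^-1 = (cexp w - 1) / cexp w by field.
by rewrite invf_div mulrA mulVf// mul1r.
Qed.

(** Summing over [m] first, the finite geometric sum in x = q^l is bose (l w) (1 - x^N), so the
    error is at most |q|^N times an absolutely convergent series. *)
Lemma sum_llog_clim (w : C) : 0 < re w ->
  clim (fun N => \sum_(m < N) llog (cexp (- w) ^+ m.+1)) (etalog w).
Proof.
move=> w0; set q := cexp (- w); have q1 : normc q < 1 by exact: normc_cexpN_lt1.
have q0 := normc_ge0 q.
apply: (@rlim0_le _ 0 _ (fun N => ((re w)^-1 * 2) * normc q ^+ N)); last first.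
  by apply: rlim0_geo; rewrite q0.
move=> N _.
have qm m : normc (q ^+ m.+1) < 1 by rewrite normcX exprn_ilt1.
have hs := has_csum_sum (J := N) (a := fun m i => (q ^+ m.+1) ^+ i.+1 / i.+1%:R)
   (fun m _ => llogP (qm m)).
have h := has_csumB hs (etalogP w0).
apply: has_csum_norm_le h => n.
apply: le_trans (_ : \sum_(i < n) (re w)^-1 * i.+1%:R ^- 2 * normc q ^+ N <= _).
  apply: ler_sum => i _; pose x := q ^+ i.+1.
  have x1 : normc x < 1 by exact: qm.
  have xn : 1 - x != 0 by rewrite subr_eq0; apply: contraTneq x1 => <-; rewrite normc1 ltxx.
  have bx : bose (i.+1%:R * w) = x / (1 - x) by rewrite boseE -mulrN cexpXn.
  have -> : \sum_(m < N) (q ^+ m.+1) ^+ i.+1 / i.+1%:R - bose (i.+1%:R * w) / i.+1%:R =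
     - (x ^+ N * (bose (i.+1%:R * w) / i.+1%:R)).
    rewrite -mulr_suml (eq_bigr (fun m : 'I_N => x * x ^+ m)); last first.
      by move=> m _; rewrite -exprS -!exprM mulnC.
    have g : (1 - x) * \sum_(m < N) x ^+ m = 1 - x ^+ N.
      by rewrite -[1 - x]opprB mulNr -subrX1 opprB.
    have key : x * \sum_(m < N) x ^+ m = bose (i.+1%:R * w) * (1 - x ^+ N).
      by rewrite bx -g; field.
    by rewrite -mulr_sumr key; ring.
  rewrite normcN normcM mulrC; apply: ler_pM; rewrite ?normc_ge0//.
    exact: normc_etalog_term.
  rewrite normcX /x normcX -exprM -{2}[N]mul1n ler_wiXn2l ?(ltW q1)//.
  by rewrite leq_mul2r orbT.
rewrite -mulr_suml ler_wpM2r ?exprn_ge0// -mulr_sumr ler_wpM2l ?sum_inv_sqr_le//.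
by rewrite invr_ge0 ltW.
Qed.

Definition Glog (k : nat) (z : C) : C :=
  3 * etalog z - etalog (2 * z) - etalog ((2 * k + 1)%:R * z) + etalog ((4 * k + 2)%:R * z).

(** Finite sums of logarithms are exponentiated before the limit, so no choice of branch for the
    logarithm of the product is involved. *)
Theorem Delta_gen k (z : C) : 0 < re z ->
  has_csum (fun n => (Delta k n)%:~R * cexp (- z) ^+ n) (cexp (Glog k z)).
Proof.
move=> z0; set q := cexp (- z); have q1 : normc q < 1 by exact: normc_cexpN_lt1.
have q0 := normc_ge0 q; have r01 : 0 <= normc q < 1 by rewrite q0.
have hF := csumP (fbd_csummable (fbd_Delta k r01)); set F := csum _ in hF.
suff -> : cexp (Glog k z) = F by [].
apply: clim_unique (prod_qfactor_clim q1 hF).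
have qd d m : (0 < d)%N -> normc (q ^+ (d * m.+1)) < 1.
  by case: d => // d _; rewrite normcX exprn_ilt1.
pose S d N := \sum_(m < N) llog (q ^+ (d * m.+1)).
have Sd d : (0 < d)%N -> clim (S d) (etalog (d%:R * z)).
  move=> d0; have dz : 0 < re (d%:R * z) by rewrite re_natM mulr_gt0// ltr0n.
  apply: (clim_eq (N0 := 0)) (sum_llog_clim dz) => N _; apply: eq_bigr => m _.
  by rewrite -mulrN cexpXn exprM.
have S1 : clim (S 1%N) (etalog z) by rewrite -[z]mul1r; exact: Sd.
have h : clim (fun N => 3 * S 1%N N - S 2%N N - S (2 * k + 1)%N N + S (4 * k + 2)%N N) (Glog k z).
  apply: climD; last by apply: Sd; rewrite addn2.
  apply: climB; last by apply: Sd; rewrite addn1.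
  by apply: climB; [exact: climZ | exact: Sd].
apply: (clim_eq (N0 := 0)) (clim_cexp h) => N _.
rewrite /S mulr_sumr -!sumrB -big_split /=.
rewrite (cexp_sum N (fun m => 3 * llog (q ^+ (1 * m.+1)) - llog (q ^+ (2 * m.+1)) -
   llog (q ^+ ((2 * k + 1) * m.+1)) + llog (q ^+ ((4 * k + 2) * m.+1)))).
apply: eq_bigr => m _.
have aux (a b c d A B D E : C) : cexp a = A -> cexp b = B -> cexp c = D -> cexp d = E ->
    cexp (3 * a - b - c + d) = A ^+ 3 / B / D * E.
  by move=> <- <- <- <-; rewrite cexpD !cexpB cexpXn.
have M1 : (0 < 2 * k + 1)%N by rewrite addn1.
have M2 : (0 < 4 * k + 2)%N by rewrite addn2.
have L d (d0 : (0 < d)%N) := cexp_llog (qd d m d0).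
apply: (etrans (aux _ _ _ _ _ _ _ _ (L 1%N isT) (L 2%N isT) (L _ M1) (L _ M2))).
by rewrite /qfactor mul1n !invrK; ring.
Qed.

End PowerSeriesEvaluation.

(** * Taylor coefficients of e^{nu w} / (e^w - 1) - 1 / w *)

Section BernoulliSeries.
Variable R : realType.
Local Notation C := R[i].
Variable nu : R.
Hypothesis nu01 : 0 < nu < 1.

(** Taylor coefficients of ((e^{nu w} - 1) - ((e^w - 1) / w - 1)) / w, the product of the sought
    function with (e^w - 1) / w. *)
Definition bcoef (i : nat) : R := nu ^+ i.+1 / i.+1`!%:R - i.+2`!%:R^-1.

(** Course-of-values recursion: each coefficient depends on all previous ones, so the whole list is
    carried. *)
Fixpoint hlist (n : nat) : seq R :=
  if n is n'.+1 then
    rcons (hlist n') (bcoef n' - \sum_(j < n') (hlist n')`_j / (n' - j).+1`!%:R)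
  else [::].

(** This is B_{n+1}(nu) / (n+1)! with the Bernoulli polynomial B_{n+1}. *)
Definition hcoef (n : nat) : R := (hlist n.+1)`_n.

Lemma size_hlist n : size (hlist n) = n.
Proof. by elim: n => //= n IH; rewrite size_rcons IH. Qed.

Lemma hlistE m j : (j < m)%N -> (hlist m)`_j = hcoef j.
Proof.
elim: m => // m IH; rewrite ltnS leq_eqVlt => /predU1P[->//|jm].
by rewrite /= nth_rcons size_hlist jm IH.
Qed.

Lemma hcoefE n : hcoef n = bcoef n - \sum_(j < n) hcoef j / (n - j).+1`!%:R.
Proof.
rewrite /hcoef /= nth_rcons size_hlist ltnn eqxx; congr (_ - _).
by apply: eq_bigr => j _; rewrite hlistE.
Qed.

Lemma sum_inv_fact_le n : \sum_(l < n) (l.+2`!%:R : R)^-1 <= 3 / 4.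
Proof.
have f3 l : (2 * 3 ^ l <= l.+2`!)%N.
  elim: l => // l IH; rewrite factS expnS mulnCA.
  by apply: leq_mul.
have f3' l : (l.+2`!%:R : R)^-1 <= 2^-1 * 3^-1 ^+ l.
  rewrite exprVn -invfM lef_pV2 ?posrE ?mulr_gt0 ?exprn_gt0// ?ltr0n ?fact_gt0//.
  by rewrite -natrX -natrM ler_nat.
apply: le_trans (_ : \sum_(l < n) 2^-1 * 3^-1 ^+ l <= _).
  by apply: ler_sum => l _; exact: f3'.
rewrite -mulr_sumr; have := @sum_geo_le R 3^-1 n.
have -> : (1 - 3^-1)^-1 = 3 / 2 :> R by field.
have r3 : 0 <= (3^-1 : R) < 1 by apply/andP; split; lra.
by move=> /(_ r3); lra.
Qed.

Lemma bcoef_le n : `|bcoef n| <= 1.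
Proof.
have /andP[n0 n1] := nu01.
have f1 m : (m`!%:R : R)^-1 <= 1 by rewrite invf_le1 ?ltr0n ?fact_gt0// ler1n fact_gt0.
have a0 : 0 <= nu ^+ n.+1 / n.+1`!%:R by rewrite divr_ge0// exprn_ge0// ltW.
have a1 : nu ^+ n.+1 / n.+1`!%:R <= 1.
  rewrite -[leRHS]mulr1; apply: ler_pM; rewrite ?invr_ge0// ?exprn_ge0 ?(ltW n0)//.
  by apply: exprn_ile1; exact: ltW.
have b0 : 0 <= (n.+2`!%:R : R)^-1 by rewrite invr_ge0.
by rewrite /bcoef ler_norml; apply/andP; split; have := f1 n.+2; lra.
Qed.

(** The constant 4 reproduces itself through the recursion, as 1 + 4 (3 / 4) = 4. *)
Lemma hcoef_le n : `|hcoef n| <= 4.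
Proof.
have [m] := ubnP n; elim: m n => // m IH n nm.
rewrite hcoefE; apply: le_trans (ler_normB _ _) _.
have h : `|\sum_(j < n) hcoef j / (n - j).+1`!%:R| <= 4 * (3 / 4).
  apply: le_trans (ler_norm_sum _ _ _) _.
  apply: le_trans (ler_wpM2l _ (sum_inv_fact_le n)) => //.
  rewrite mulr_sumr (reindex_inj rev_ord_inj) /=; apply: ler_sum => j _.
  have jn := ltn_ord j; have -> : (n - (n - j.+1)).+1 = j.+2 by lia.
  rewrite normrM normfV normr_nat; apply: ler_wpM2r; first by rewrite invr_ge0.
  by apply: IH; lia.
have := bcoef_le n; lra.
Qed.

Lemma has_csum_exp_shift (w : C) : w != 0 ->
  has_csum (fun i => w ^+ i / i.+1`!%:R) ((cexp w - 1) / w).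
Proof.
move=> w0; have h := has_csum_shift 1 (has_csum_exp w).
rewrite big_ord_recl big_ord0 expr0 fact0 divr1 addr0 in h.
rewrite mulrC; apply: eq_has_csum (has_csumZ w^-1 h) => i.
by rewrite add1n exprS -mulrA mulKf.
Qed.

Lemma csummable_geo_le (u : nat -> C) (B r : R) : 0 <= r < 1 -> 0 <= B ->
  (forall i, normc (u i) <= B * r ^+ i) -> csummable u.
Proof.
move=> r01 B0 uB; apply: (csummable_le (B := B / (1 - r)) uB) => n.
by rewrite -mulr_sumr ler_wpM2l// sum_geo_le.
Qed.

Lemma hcoef_series (w : C) : 0 < re w -> normc w < 1 ->
  has_csum (fun i => (hcoef i)%:C%C * w ^+ i) (cexp (nu%:C%C * w) * bose w - w^-1).
Proof.
move=> w0 w1; have wn := re_gt0_neq0 w0.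
have r01 : 0 <= normc w < 1 by rewrite normc_ge0.
have sH : csummable (fun i => (hcoef i)%:C%C * w ^+ i).
  apply: (csummable_geo_le r01 (ler0n R 4)) => i.
  by rewrite normcM normcX normcR ler_wpM2r ?exprn_ge0 ?normc_ge0// hcoef_le.
have hE := has_csum_exp_shift wn.
have sE : csummable (fun i => w ^+ i / i.+1`!%:R).
  have p1 : 0 <= 1 :> R by [].
  apply: (csummable_geo_le r01 p1) => i.
  rewrite normcM normcX normcV normc_nat mulrC ler_wpM2r ?exprn_ge0 ?normc_ge0//.
  by rewrite invf_le1 ?ltr0n ?fact_gt0// ler1n fact_gt0.
have hH := csumP sH; set H := csum _ in hH.
have hP := cauchy_product sH sE hH hE.
have {}hP : has_csum (fun n => (bcoef n)%:C%C * w ^+ n) (H * ((cexp w - 1) / w)).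
  apply: eq_has_csum hP => n.
  have -> : bcoef n = \sum_(j < n.+1) hcoef j / (n - j).+1`!%:R.
    by rewrite big_ord_recr /= subnn factS fact0 muln1 divr1 [X in _ + X]hcoefE addrC subrK.
  rewrite rmorph_sum mulr_suml; apply: eq_bigr => j _.
  have jn : (j <= n)%N by rewrite -ltnS.
  rewrite fmorph_div rmorph_nat /=.
  have -> : w ^+ n = w ^+ j * w ^+ (n - j) by rewrite -exprD subnKC.
  by ring.
have hN : has_csum (fun n => (bcoef n)%:C%C * w ^+ n)
    (w^-1 * ((cexp (nu%:C%C * w) - 1) - ((cexp w - 1) / w - 1))).
  have h1 := has_csum_shift 1 (has_csum_exp (nu%:C%C * w)).
  rewrite big_ord_recl big_ord0 expr0 fact0 divr1 addr0 in h1.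
  have h2 := has_csum_shift 1 hE.
  rewrite big_ord_recl big_ord0 expr0 factS fact0 muln1 divr1 addr0 in h2.
  apply: eq_has_csum (has_csumZ w^-1 (has_csumB h1 h2)) => n.
  rewrite !add1n /bcoef rmorphB fmorph_div rmorphXn fmorphV !rmorph_nat exprMn ![w ^+ n.+1]exprS.
  move: (nu%:C%C ^+ n.+1) (w ^+ n) (n.+1`!%:R^-1 : C) (n.+2`!%:R^-1 : C) => a b c d.
  by field.
have eq1 := has_csum_unique hP hN.
suff -> : cexp (nu%:C%C * w) * bose w - w^-1 = H by [].
have W0 := cexpB1_neq0 w0.
have W1 : (cexp w - 1) / w != 0 by rewrite mulf_neq0// invr_eq0.
apply: (mulIf W1); rewrite eq1 /bose; field.
by rewrite wn W0.
Qed.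

End BernoulliSeries.

Lemma ler_last_sum (R : realType) (v : nat -> R) p : (forall j, 0 <= v j) ->
  v p <= \sum_(j < p.+1) v j.
Proof. by move=> v0; rewrite big_ord_recr /= lerDr sumr_ge0. Qed.

(** * The generating function of the Bessel terms *)

Section BesselSeries.
Variable R : realType.
Local Notation C := R[i].
Variables (A nu : R).
Hypothesis A0 : 0 < A.
Hypothesis nu01 : 0 < nu < 1.

Definition nshift (i : nat) : R := i.+1%:R - nu.

(** The coefficient of z^{-p-1} in z e^{A/z}; the Bessel term is the series with coefficients
    [alpha p / p!], its inverse Laplace transform. *)
Definition alpha (p : nat) : R := A ^+ p.+2 / p.+2`!%:R.

Definition bterm (i p : nat) : R := nshift i ^+ p / p`!%:R.

(* [bes i / (2 * pi)] is the Bessel term of the theorem at [n = i + 1]. *)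
Definition bes (i : nat) : C := csum (fun p => (alpha p * bterm i p)%:C%C).

Definition eterm (z : C) (i : nat) : C := cexp (- ((nshift i)%:C%C * z)).

(** If the sum over [i] were an integral over a positive variable N, this would be z^{-p-1} exactly;
    [tau] is the correction. *)
Definition Ssum (z : C) (p : nat) : C := csum (fun i => (bterm i p)%:C%C * eterm z i).

Lemma nshift_gt0 i : 0 < nshift i.
Proof.
have /andP[_ n1] := nu01; rewrite /nshift subr_gt0; apply: lt_le_trans n1 _.
by rewrite ler1n.
Qed.

Lemma nshift_ge i : i%:R <= nshift i.
Proof. by have /andP[_ n1] := nu01; rewrite /nshift -natr1; lra. Qed.

Lemma bterm_ge0 i p : 0 <= bterm i p.
Proof. by rewrite divr_ge0// exprn_ge0// ltW// nshift_gt0. Qed.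

Lemma alpha_ge0 p : 0 <= alpha p.
Proof. by rewrite divr_ge0// exprn_ge0// ltW. Qed.

Lemma normc_eterm z i : normc (eterm z i) = expR (- (nshift i * re z)).
Proof. by rewrite normc_cexp reN re_rmul. Qed.

Lemma alpha_le (r : R) p : 0 < r -> alpha p <= expR (A / r) * r ^+ p.+2.
Proof.
move=> r0; have h := @fact_ge_exp R (A / r) p.+2 (ltW (divr_gt0 A0 r0)).
by move: h; rewrite expr_div_n mulrAC ler_pdivrMr ?exprn_gt0.
Qed.

Lemma sum_alpha_le (D : R) n : 0 < D -> \sum_(p < n) alpha p * D ^+ p <= expR (A * D) / D ^+ 2.
Proof.
move=> D0; rewrite ler_pdivlMr ?exprn_gt0// mulr_suml.
have AD : 0 <= A * D by rewrite mulr_ge0// ltW.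
apply: le_trans (sum_exp_le n.+2 AD).
rewrite 2!big_ord_recl; rewrite -[leLHS]add0r; apply: lerD; first by rewrite expr0 fact0 divr1.
rewrite -[leLHS]add0r; apply: lerD.
  by rewrite divr_ge0// exprn_ge0.
apply: ler_sum => p _; rewrite /alpha !lift0 !exprMn.
by rewrite -[leLHS]mulrA -exprD addn2 mulrAC.
Qed.

Lemma bterm_sum_le (z : C) (r : R) : 0 <= r -> r < re z -> forall I P,
  \sum_(i < I) \sum_(p < P) bterm i p * r ^+ p * normc (eterm z i) <=
  (1 - expR (- (re z - r)))^-1.
Proof.
move=> r0 rz I P.
have e1 : 0 <= expR (- (re z - r)) < 1 by rewrite expR_ge0 expR_lt1 oppr_lt0 subr_gt0.
apply: le_trans (sum_geo_le I e1); apply: ler_sum => i _.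
rewrite -mulr_suml normc_eterm.
have n0 := ltW (nshift_gt0 i).
apply: le_trans (_ : expR (nshift i * r) * expR (- (nshift i * re z)) <= _).
  rewrite ler_wpM2r ?expR_ge0//; apply: le_trans (sum_exp_le P _); last by rewrite mulr_ge0.
  by apply: ler_sum => p _; rewrite /bterm exprMn mulrAC.
rewrite -expRD -expRM_natl ler_expR.
have := nshift_ge i => h.
have -> : nshift i * r - nshift i * re z = - (nshift i * (re z - r)) by ring.
by rewrite mulrN lerN2 ler_wpM2r// subr_ge0 ltW.
Qed.

Lemma Ssum_term_le (z : C) (r : R) p : 0 <= r -> r < re z -> forall I,
  \sum_(i < I) bterm i p * normc (eterm z i) * r ^+ p <= (1 - expR (- (re z - r)))^-1.
Proof.
move=> r0 rz I; apply: le_trans (bterm_sum_le r0 rz I p.+1); apply: ler_sum => i _.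
rewrite mulrAC; apply: (@ler_last_sum _ (fun p => bterm i p * r ^+ p * normc (eterm z i))) => j.
apply: mulr_ge0; last exact: normc_ge0.
by apply: mulr_ge0; [exact: bterm_ge0 | exact: exprn_ge0].
Qed.

Lemma SsumP (z : C) p : 0 < re z ->
  has_csum (fun i => (bterm i p)%:C%C * eterm z i) (Ssum z p).
Proof.
move=> z0; apply: csumP; pose r := re z / 2.
have r0 : 0 < r by rewrite divr_gt0.
have rz : r < re z by rewrite /r; lra.
exists ((1 - expR (- (re z - r)))^-1 / r ^+ p) => n.
rewrite ler_pdivlMr ?exprn_gt0// mulr_suml.
apply: le_trans (Ssum_term_le p (ltW r0) rz n); apply: ler_sum => i _.
by rewrite normcM (normcR_ge0 (bterm_ge0 i p)).
Qed.

Lemma normc_Ssum_le (z : C) (r : R) p : 0 <= r -> r < re z ->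
  normc (Ssum z p) * r ^+ p <= (1 - expR (- (re z - r)))^-1.
Proof.
move=> r0 rz; have z0 : 0 < re z by exact: le_lt_trans rz.
rewrite -{1}(normcR_ge0 (exprn_ge0 p r0)) mulrC -normcM.
apply: has_csum_norm_le (has_csumZ (r ^+ p)%:C%C (SsumP p z0)) => n.
apply: le_trans (Ssum_term_le p r0 rz n); apply: ler_sum => i _.
by rewrite normcM (normcR_ge0 (exprn_ge0 p r0)) normcM (normcR_ge0 (bterm_ge0 i p)) mulrC.
Qed.

Lemma besP i : has_csum (fun p => (alpha p * bterm i p)%:C%C) (bes i).
Proof.
apply: csumP; have n0 := nshift_gt0 i.
exists (expR (A * nshift i) / nshift i ^+ 2) => n.
apply: le_trans (sum_alpha_le n n0); apply: ler_sum => p _.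
rewrite normcR_ge0; last by rewrite mulr_ge0 ?alpha_ge0 ?bterm_ge0.
rewrite ler_wpM2l ?alpha_ge0// /bterm ler_pdivrMr ?ltr0n ?fact_gt0//.
by rewrite ler_peMr ?exprn_ge0 ?(ltW n0)// ler1n fact_gt0.
Qed.

Lemma bes_gen (z : C) : 0 < re z -> exists l,
  has_csum (fun i => bes i * eterm z i) l /\
  has_csum (fun p => (alpha p)%:C%C * Ssum z p) l.
Proof.
move=> z0; pose r := re z / 2.
have r0 : 0 < r by rewrite divr_gt0.
have rz : r < re z by rewrite /r; lra.
apply: (@csum_exchange _ (fun i p => (alpha p * bterm i p)%:C%C * eterm z i) _ _
  (expR (A / r) * r ^+ 2 * (1 - expR (- (re z - r)))^-1)).
- move=> I J; apply: le_trans (ler_wpM2l _ (bterm_sum_le (ltW r0) rz I J)); last first.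
    by rewrite mulr_ge0 ?expR_ge0// exprn_ge0// ltW.
  rewrite mulr_sumr; apply: ler_sum => i _; rewrite mulr_sumr; apply: ler_sum => p _.
  rewrite normcM normcR_ge0; last by rewrite mulr_ge0 ?alpha_ge0 ?bterm_ge0.
  rewrite [leRHS]mulrA ler_wpM2r ?normc_ge0//.
  have := ler_wpM2r (bterm_ge0 i p) (alpha_le p r0) => h; apply: le_trans h _.
  by rewrite le_eqVlt; apply/orP; left; apply/eqP; rewrite -addn2 exprD; ring.
- by move=> i; rewrite mulrC; apply: eq_has_csum (has_csumZ (eterm z i) (besP i)) => p; rewrite mulrC.
- move=> p; apply: eq_has_csum (has_csumZ (alpha p)%:C%C (SsumP p z0)) => i.
  by rewrite mulrA -rmorphM.
Qed.

Lemma main_series (z : C) : z != 0 ->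
  has_csum (fun p => (alpha p)%:C%C * z ^- p.+1) (z * cexp (A%:C%C / z) - z - A%:C%C).
Proof.
move=> z0; have h := has_csum_shift 2 (has_csum_exp (A%:C%C / z)).
rewrite !big_ord_recl big_ord0 expr0 expr1 fact0 factS fact0 divr1 muln1 divr1 addr0 in h.
have -> : z * cexp (A%:C%C / z) - z - A%:C%C = z * (cexp (A%:C%C / z) - (1 + A%:C%C / z)).
  by move: (cexp _) => e; field.
apply: eq_has_csum (has_csumZ z h) => p.
rewrite /alpha fmorph_div rmorphXn rmorph_nat add2n expr_div_n [z ^+ p.+2]exprS.
have zp : z ^+ p.+1 != 0 by rewrite expf_neq0.
move: (z ^+ p.+1) zp (A%:C%C ^+ p.+2) (p.+2`!%:R^-1 : C) => a a0 b c.
by field; rewrite a0 z0.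
Qed.

Lemma eterm_shift (z : C) i : eterm z i.+1 = eterm z i * cexp (- z).
Proof.
rewrite /eterm -cexpD; congr cexp.
have -> : nshift i.+1 = nshift i + 1 by rewrite /nshift -[i.+2%:R]natr1; ring.
by rewrite rmorphD rmorph1; ring.
Qed.

Lemma sum_eterm (w : C) : 0 < re w ->
  has_csum (fun i => eterm w i) (cexp (nu%:C%C * w) * bose w).
Proof.
move=> w0; have q1 := normc_cexpN_lt1 w0.
have h := has_csumZ (cexp (nu%:C%C * w)) (has_csum_geoS q1).
rewrite boseE; apply: eq_has_csum h => i.
rewrite -cexpXn -cexpD /eterm; congr cexp; rewrite /nshift rmorphB /= realc_nat; ring.
Qed.

Lemma Ssum_gen (z : C) (u : C) : normc u < re z ->
  has_csum (fun p => Ssum z p * u ^+ p) (cexp (nu%:C%C * (z - u)) * bose (z - u)).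
Proof.
move=> uz; have u0 := normc_ge0 u; have z0 : 0 < re z by exact: le_lt_trans uz.
have zu0 : 0 < re (z - u).
  by rewrite reB subr_gt0; apply: le_lt_trans (re_le_normc u) uz.
have [|i|p|l [h1 h2]] := @csum_exchange _ (fun i p => (bterm i p)%:C%C * u ^+ p * eterm z i)
  (fun i => eterm (z - u) i) (fun p => Ssum z p * u ^+ p) (1 - expR (- (re z - normc u)))^-1.
- move=> I J; apply: le_trans (bterm_sum_le u0 uz I J).
  apply: ler_sum => i _; apply: ler_sum => p _.
  by rewrite !normcM normcX (normcR_ge0 (bterm_ge0 i p)).
- have h := has_csumZ (eterm z i) (has_csum_exp ((nshift i)%:C%C * u)).
  have -> : eterm (z - u) i = eterm z i * cexp ((nshift i)%:C%C * u).
    by rewrite /eterm -cexpD; congr cexp; ring.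
  apply: eq_has_csum h => p.
  by rewrite /bterm fmorph_div rmorphXn rmorph_nat exprMn; ring.
- rewrite mulrC; apply: eq_has_csum (has_csumZ (u ^+ p) (SsumP p z0)) => i; ring.
by rewrite (has_csum_unique (sum_eterm zu0) h1).
Qed.

(** The coefficient of u^p when the power series [hcoef] at z - u is expanded by the binomial
    theorem; this is absolutely convergent for |z| + |u| <= 3/4 because the coefficients are
    bounded. *)
Definition tau (z : C) (p : nat) : C :=
  csum (fun i => (hcoef nu i)%:C%C * ('C(i, p)%:R * z ^+ (i - p) * (-1) ^+ p)).

Lemma hbin_sum_le (x r : R) (I P : nat) : 0 <= x -> 0 <= r -> x + r <= 3 / 4 ->
  \sum_(i < I) \sum_(p < P) `|hcoef nu i| * ('C(i, p)%:R * x ^+ (i - p) * r ^+ p) <= 16.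
Proof.
move=> x0 r0 xr.
have e1 : 0 <= x + r < 1 by apply/andP; split; lra.
apply: le_trans (_ : 4 * \sum_(i < I) (x + r) ^+ i <= _).
  rewrite mulr_sumr; apply: ler_sum => i _; rewrite -mulr_sumr.
  apply: ler_pM => //; rewrite ?hcoef_le//.
    by apply: sumr_ge0 => p _; rewrite !mulr_ge0 ?exprn_ge0.
  have t0 p : 0 <= 'C(i, p)%:R * x ^+ (i - p) * r ^+ p by rewrite !mulr_ge0 ?exprn_ge0.
  rewrite exprDn.
  have -> : \sum_(j < i.+1) x ^+ (i - j) * r ^+ j *+ 'C(i, j) =
    \sum_(j < i.+1) 'C(i, j)%:R * x ^+ (i - j) * r ^+ j.
    by apply: eq_bigr => j _; rewrite -mulr_natl mulrA.
  have [Pi|iP] := leqP P i.+1.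
    by apply: (@ler_sum_nonneg _ (fun p => 'C(i, p)%:R * x ^+ (i - p) * r ^+ p)).
  rewrite (@sum_ord_cat _ (fun p => 'C(i, p)%:R * x ^+ (i - p) * r ^+ p) i.+1 P (ltnW iP)).
  rewrite [X in _ + X]big_nat_cond [X in _ + X]big1 ?addr0// => p.
  by rewrite andbT => /andP[ip _]; rewrite bin_small// !mul0r.
have := sum_geo_le I e1 => h; apply: le_trans (ler_wpM2l _ h) _ => //.
rewrite ler_pdivrMr; lra.
Qed.

Lemma tau_term_le (z : C) (r : R) (p I : nat) : 0 <= r -> normc z + r <= 3 / 4 ->
  \sum_(i < I) normc ((hcoef nu i)%:C%C * ('C(i, p)%:R * z ^+ (i - p) * (-1) ^+ p)) * r ^+ p <= 16.
Proof.
move=> r0 zr; apply: le_trans (hbin_sum_le I p.+1 (normc_ge0 z) r0 zr).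
apply: ler_sum => i _; rewrite big_ord_recr /= !normcM !normcX normcR normc_nat normcN normc1.
rewrite expr1n mulr1 -!mulrA lerDr; apply: sumr_ge0 => j _.
by rewrite !mulr_ge0 ?exprn_ge0 ?normc_ge0.
Qed.

Lemma tauP (z : C) p : normc z <= 1 / 2 ->
  has_csum (fun i => (hcoef nu i)%:C%C * ('C(i, p)%:R * z ^+ (i - p) * (-1) ^+ p)) (tau z p).
Proof.
move=> z2; apply: csumP; pose r : R := 4^-1; have r0 : 0 < r by rewrite invr_gt0.
exists (16 / r ^+ p) => n; rewrite ler_pdivlMr ?exprn_gt0// mulr_suml.
by apply: tau_term_le; rewrite ?(ltW r0)//; rewrite /r; lra.
Qed.

Lemma normc_tau_le (z : C) p : normc z <= 1 / 2 -> normc (tau z p) <= 16 * 4 ^+ p.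
Proof.
move=> z2; apply: has_csum_norm_le (tauP p z2) => n.
have h : \sum_(i < n) normc ((hcoef nu i)%:C%C * ('C(i, p)%:R * z ^+ (i - p) * (-1) ^+ p))
   * 4^-1 ^+ p <= 16.
  by apply: tau_term_le => //; lra.
by move: h; rewrite -mulr_suml exprVn ler_pdivrMr// exprn_gt0.
Qed.

Lemma tau_gen (z u : C) : normc z <= 1 / 4 -> normc u <= 1 / 8 -> 0 < re (z - u) ->
  has_csum (fun p => tau z p * u ^+ p) (cexp (nu%:C%C * (z - u)) * bose (z - u) - (z - u)^-1).
Proof.
move=> z4 u8 zu0.
have zu1 : normc (z - u) < 1 by apply: le_lt_trans (normcB _ _) _; lra.
have z2 : normc z <= 1 / 2 by lra.
have [|i|p|l [h1 h2]] := @csum_exchange _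
  (fun i p => (hcoef nu i)%:C%C * ('C(i, p)%:R * z ^+ (i - p) * (- u) ^+ p))
  (fun i => (hcoef nu i)%:C%C * (z - u) ^+ i) (fun p => tau z p * u ^+ p) 16.
- move=> I J; apply: le_trans (@hbin_sum_le (normc z) (normc u) I J _ _ _);
    rewrite ?normc_ge0//; last lra.
  apply: ler_sum => i _; apply: ler_sum => p _.
  by rewrite !normcM !normcX normcR normc_nat normcN.
- apply: has_csumZ.
  have -> : (z - u) ^+ i = \sum_(p < i.+1) 'C(i, p)%:R * z ^+ (i - p) * (- u) ^+ p.
    by rewrite exprDn; apply: eq_bigr => p _; rewrite -mulr_natl mulrA.
  by apply: has_csum_finite => p ip; rewrite bin_small// !mul0r.
- rewrite mulrC; apply: eq_has_csum (has_csumZ (u ^+ p) (tauP p z2)) => i.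
  by rewrite [(- u) ^+ p]exprNn; ring.
by rewrite (has_csum_unique (hcoef_series nu01 zu0 zu1) h1).
Qed.

(* Both sides are the Taylor coefficients at z of u |-> sum_i exp (- nshift i * (z - u)). *)
Lemma SsumE (z : C) p : 0 < re z -> normc z <= 1 / 4 -> Ssum z p = z ^- p.+1 + tau z p.
Proof.
move=> z0 z4; have zn := re_gt0_neq0 z0; have rez := re_le_normc z.
pose r := re z / 2; have r0 : 0 < r by rewrite divr_gt0.
have z2 : normc z <= 1 / 2 by lra.
have nz0 : 0 < normc z by rewrite normc_gt0.
pose c p := Ssum z p - (z ^- p.+1 + tau z p).
(* Uniqueness of power series coefficients: the series of [c] vanishes on the circle |u| = r, and
   [cauchy_estimate] is applied with bound 0. *)
suff H : normc (c p) * r ^+ p <= 0.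
  have : normc (c p) <= 0 by move: H; rewrite pmulr_lle0// exprn_gt0.
  move=> h; have := normc_ge0 (c p) => h'.
  have /eqP : normc (c p) == 0 by rewrite eq_le h h'.
  by move/eqP; rewrite normc_eq0 subr_eq0 => /eqP.
have gen u : normc u = r -> has_csum (fun p => c p * u ^+ p) 0.
  move=> ur.
  have uz : normc u < re z by rewrite ur /r; lra.
  have u8 : normc u <= 1 / 8 by rewrite ur /r; lra.
  have zu0 : 0 < re (z - u).
    by rewrite reB subr_gt0; apply: le_lt_trans (re_le_normc u) uz.
  have zun := re_gt0_neq0 zu0.
  have q1 : normc (u / z) < 1.
    by rewrite normcM normcV ltr_pdivrMr// mul1r; exact: lt_le_trans rez.
  have hg := has_csumZ z^-1 (has_csum_geo q1).
  have hs := has_csumB (Ssum_gen uz) (has_csumD hg (tau_gen z4 u8 zu0)).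
  have e0 : z^-1 * (1 - u / z)^-1 = (z - u)^-1.
    have -> : 1 - u / z = (z - u) / z by field.
    by rewrite invf_div mulrA mulVf// mul1r.
  rewrite e0 [(z - u)^-1 + _]addrC subrK subrr in hs.
  apply: eq_has_csum hs => i; rewrite /c expr_div_n exprS invfM; ring.
apply: (cauchy_estimate r0) => [|t l _ hl].
  (* Any radius strictly between [r] and re z would do; this one gives the ratio r / r' = 2/3. *)
  pose r' := re z * (3 / 4); have r0' : 0 < r' by rewrite mulr_gt0//; lra.
  have rz' : r' < re z by rewrite /r'; lra.
  pose D := (1 - expR (- (re z - r')))^-1.
  have D0 : 0 <= D.
    by rewrite invr_ge0 subr_ge0 ltW// expR_lt1 oppr_lt0 subr_gt0.
  apply: (@csummable_geo_le _ _ (D + (normc z)^-1 + 16) (2 / 3)).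
  - by apply/andP; split; lra.
  - by rewrite !addr_ge0// invr_ge0 ltW.
  move=> i; rewrite normcM normcX (normcR_ge0 (ltW r0)).
  have s1 : normc (Ssum z i) * r ^+ i <= D * (2 / 3) ^+ i.
    have := normc_Ssum_le i (ltW r0') rz'; rewrite -/D => h.
    have -> : r = r' * (2 / 3) by rewrite /r /r'; field.
    by rewrite exprMn mulrA ler_wpM2r// exprn_ge0//; lra.
  have s2 : normc (z ^- i.+1) * r ^+ i <= (normc z)^-1 * (2 / 3) ^+ i.
    rewrite normcV normcX exprS invfM -mulrA ler_wpM2l ?invr_ge0 ?(ltW nz0)//.
    rewrite mulrC -expr_div_n; apply: lerXn2r; rewrite ?nnegrE; last first.
    - rewrite ler_pdivrMr// /r; lra.
    - by lra.
    - by rewrite divr_ge0// ltW.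
  have s3 : normc (tau z i) * r ^+ i <= 16 * (2 / 3) ^+ i.
    apply: le_trans (ler_wpM2r (exprn_ge0 i (ltW r0)) (normc_tau_le i z2)) _.
    rewrite -mulrA ler_wpM2l// -exprMn; apply: lerXn2r; rewrite ?nnegrE; last first.
    - by rewrite /r; lra.
    - by lra.
    - by rewrite mulr_ge0// ltW.
  have hc : normc (c i) <= normc (Ssum z i) + (normc (z ^- i.+1) + normc (tau z i)).
    apply: le_trans (normcB _ _) _; rewrite lerD2l; exact: normcD.
  apply: le_trans (ler_wpM2r (exprn_ge0 i (ltW r0)) hc) _.
  set x := (2 / 3) ^+ i in s1 s2 s3 *.
  have -> : (D + (normc z)^-1 + 16) * x = D * x + ((normc z)^-1 * x + 16 * x) by ring.
  rewrite mulrDl; apply: lerD => //; rewrite mulrDl; exact: (lerD s2 s3).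
have ur : normc (r%:C%C * cexpi t) = r by rewrite normcM normc_cexpi mulr1 (normcR_ge0 (ltW r0)).
by rewrite (has_csum_unique hl (gen _ ur)) normc0.
Qed.

(** Insert [SsumE]: the powers z^{-p-1} add up to [main_series], and the corrections, at most 16 *
    4^p, are summed against [alpha] by [sum_alpha_le] at D = 4. *)
Lemma bes_gen_near (z l : C) : 0 < re z -> normc z <= 1 / 4 ->
  has_csum (fun i => bes i * eterm z i) l ->
  normc (l - z * cexp (A%:C%C / z)) <= 1 + A + expR (A * 4).
Proof.
move=> z0 z4 hl; have zn := re_gt0_neq0 z0.
have z2 : normc z <= 1 / 2 by lra.
have [l' [h1 h2]] := bes_gen z0; rewrite -(has_csum_unique hl h1) in h2.
have h3 := has_csumB h2 (main_series zn).
have h4 : normc (l - (z * cexp (A%:C%C / z) - z - A%:C%C)) <= expR (A * 4).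
  apply: has_csum_norm_le h3 => n.
  have p4 : 0 < 4 :> R by [].
  have h := sum_alpha_le n p4; apply: le_trans (_ : 16 * (expR (A * 4) / 4 ^+ 2) <= _).
    apply: le_trans (ler_wpM2l _ h) => //; rewrite mulr_sumr; apply: ler_sum => p _.
    rewrite -mulrBr SsumE// [_ + tau z p]addrC addrK normcM (normcR_ge0 (alpha_ge0 p)).
    by rewrite mulrCA ler_wpM2l ?alpha_ge0// normc_tau_le.
  have := expR_ge0 (A * 4); lra.
have -> : l - z * cexp (A%:C%C / z) =
  (l - (z * cexp (A%:C%C / z) - z - A%:C%C)) - (z + A%:C%C) by ring.
apply: le_trans (normcB _ _) _; have := normcD z A%:C%C.
by rewrite (normcR_ge0 (ltW A0)); lra.
Qed.

(** Multiplication by e^z shifts the summation index; the binomial theorem for (N + 1)^p expresses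
    the shifted sum by the sums of order at most [p]. *)
Lemma Ssum_rec (z : C) p : 0 < re z ->
  (cexp z - 1) * Ssum z p =
  \sum_(j < p) Ssum z j / (p - j)`!%:R + (bterm 0 p)%:C%C * cexp (nu%:C%C * z).
Proof.
move=> z0.
have h := has_csum_shift 1 (has_csumZ (cexp z) (SsumP p z0)).
rewrite big_ord_recl big_ord0 addr0 in h.
have h2 : has_csum (fun i => \sum_(j < p.+1) (p - j)`!%:R^-1 * ((bterm i j)%:C%C * eterm z i))
    (\sum_(j < p.+1) (p - j)`!%:R^-1 * Ssum z j).
  apply: (@has_csum_sum _ p.+1
    (fun j i => (p - j)`!%:R^-1 * ((bterm i j)%:C%C * eterm z i))
    (fun j => (p - j)`!%:R^-1 * Ssum z j)) => j _.
  by apply: has_csumZ; exact: SsumP.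
have h3 := has_csum_unique h (eq_has_csum _ h2).
have e0 : cexp z * ((bterm 0 p)%:C%C * eterm z 0) = (bterm 0 p)%:C%C * cexp (nu%:C%C * z).
  rewrite mulrCA /eterm -cexpD; congr (_ * cexp _).
  by rewrite /nshift rmorphB rmorph1; ring.
rewrite mulrBl mul1r -[cexp z * _](subrK (cexp z * ((bterm 0 p)%:C%C * eterm z 0))) h3.
  rewrite e0 big_ord_recr /= subnn fact0 invr1 mul1r addrAC [_ + Ssum z p]addrC.
  rewrite [Ssum z p + _]addrC addrK.
  by congr (_ + _); apply: eq_bigr => j _; rewrite mulrC.
move=> i; rewrite add1n eterm_shift.
have -> : cexp z * ((bterm i.+1 p)%:C%C * (eterm z i * cexp (- z))) =
  (bterm i.+1 p)%:C%C * eterm z i * (cexp z * cexp (- z)) by ring.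
rewrite -cexpD subrr cexp0 mulr1.
have -> : \sum_(j < p.+1) (p - j)`!%:R^-1 * ((bterm i j)%:C%C * eterm z i) =
  (\sum_(j < p.+1) (p - j)`!%:R^-1 * bterm i j)%:C%C * eterm z i.
  rewrite rmorph_sum mulr_suml; apply: eq_bigr => j _.
  have e : ((p - j)`!%:R : C)^-1 = ((p - j)`!%:R^-1 : R)%:C%C by rewrite fmorphV /= realc_nat.
  by rewrite mulrA e -rmorphM.
congr (_%:C%C * _); rewrite /bterm.
have -> : nshift i.+1 = 1 + nshift i by rewrite /nshift -[i.+2%:R]natr1; ring.
rewrite exprDn mulr_suml; apply: eq_bigr => j _; rewrite expr1n mul1r.
have jp : (j <= p)%N by rewrite -ltnS.
have f0 m : (m`!%:R : R) != 0 by rewrite pnatr_eq0 -lt0n fact_gt0.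
have := bin_fact jp => /(congr1 (fun m => m%:R : R)); rewrite !natrM => bf.
rewrite -[_ *+ 'C(p, j)]mulr_natl -bf.
have b0 : ('C(p, j)%:R : R) != 0.
  by apply: contraTneq (f0 p) => b0; rewrite -bf b0 mul0r eqxx.
move: (f0 j) (f0 (p - j)%N) b0.
move: (j`!%:R : R) ((p - j)`!%:R : R) ('C(p, j)%:R : R) (nshift i ^+ j) => a b c d a0 b0 c0.
by field; rewrite a0 b0 c0.
Qed.

Lemma normc_Ssum_far (z : C) p : 0 < re z -> re z <= 1 ->
  normc (Ssum z p) <= expR 1 / normc (cexp z - 1) * (2 + 2 / normc (cexp z - 1)) ^+ p.
Proof.
move=> z0 z1; set de := normc (cexp z - 1); have /andP[n0 n1] := nu01.
have de0 : 0 < de by rewrite normc_gt0 cexpB1_neq0.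
set D := 2 + 2 / de; have D2 : 2 <= D by rewrite /D lerDl divr_ge0// ltW.
have K0 : 0 <= expR 1 / de by rewrite divr_ge0 ?expR_ge0// ltW.
have [m] := ubnP p; elim: m p => // m IH p pm.
have b1 : normc ((bterm 0 p)%:C%C * cexp (nu%:C%C * z)) <= expR 1.
  rewrite normcM (normcR_ge0 (bterm_ge0 0 p)) normc_cexp re_rmul -[leRHS]mul1r.
  apply: ler_pM; rewrite ?bterm_ge0 ?expR_ge0//.
    rewrite /bterm ler_pdivrMr ?ltr0n ?fact_gt0// mul1r.
    apply: le_trans (_ : 1 <= _); last by rewrite ler1n fact_gt0.
    by apply: exprn_ile1; rewrite /nshift; lra.
  by rewrite ler_expR; nra.
have := Ssum_rec p z0 => /(congr1 (@Normc.normc R)); rewrite normcM -/de => rec.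
have -> : normc (Ssum z p) = normc (\sum_(j < p) Ssum z j / (p - j)`!%:R +
   (bterm 0 p)%:C%C * cexp (nu%:C%C * z)) / de by rewrite -rec [de * _]mulrC mulfK// gt_eqF.
rewrite mulrAC; apply: ler_wpM2r; first by rewrite invr_ge0 ltW.
apply: le_trans (normcD _ _) _.
have s1 : normc (\sum_(j < p) Ssum z j / (p - j)`!%:R) <= expR 1 / de * \sum_(j < p) D ^+ j.
  apply: le_trans (normc_sum _ _ _) _; rewrite mulr_sumr; apply: ler_sum => j _.
  rewrite normcM normcV normc_nat ler_pdivrMr ?ltr0n ?fact_gt0//.
  apply: le_trans (IH j _) _; first by have := ltn_ord j; lia.
  rewrite ler_peMr ?ler1n ?fact_gt0// mulr_ge0// exprn_ge0//; lra.
case: p pm b1 rec s1 => [|p] pm b1 rec s1.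
  by rewrite big_ord0 normc0 add0r expr0 mulr1.
have s2 : de^-1 * \sum_(j < p.+1) D ^+ j <= D ^+ p.+1 / 2.
  have := subrX1 D p.+1; have -> : D - 1 = 1 + 2 * de^-1 by rewrite /D; ring.
  have : 0 <= \sum_(j < p.+1) D ^+ j by apply: sumr_ge0 => j _; rewrite exprn_ge0//; lra.
  by nra.
have s3 : 1 <= D ^+ p.+1 / 2.
  have : 1 <= D ^+ p by apply: exprn_ege1; lra.
  by rewrite exprS; nra.
have e1 : 0 < expR 1 :> R by exact: expR_gt0.
have := ler_wpM2l (ltW e1) s2; have := ler_wpM2l (ltW e1) s3.
rewrite mulr1 mulrA => ? ?; lra.
Qed.

(** Summed against [alpha] by [sum_alpha_le], the geometric bound gives e^{A D}; the +1 in the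
    exponent absorbs the prefactor, as 1 / de <= D <= e^D. *)
Lemma bes_gen_far (z l : C) : 0 < re z -> re z <= 1 ->
  has_csum (fun i => bes i * eterm z i) l ->
  normc l <= expR 1 * expR ((A + 1) * (2 + 2 / normc (cexp z - 1))).
Proof.
move=> z0 z1 hl; have [l' [h1 h2]] := bes_gen z0; rewrite -(has_csum_unique hl h1) in h2.
set de := normc (cexp z - 1); have de0 : 0 < de by rewrite normc_gt0 cexpB1_neq0.
set D := 2 + 2 / de; have D2 : 2 <= D by rewrite /D lerDl divr_ge0// ltW.
have D0 : 0 < D by lra.
apply: has_csum_norm_le h2 => n.
apply: le_trans (_ : expR 1 / de * (expR (A * D) / D ^+ 2) <= _).
  apply: le_trans (ler_wpM2l _ (sum_alpha_le n D0)); last by rewrite divr_ge0 ?expR_ge0// ltW.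
  rewrite mulr_sumr; apply: ler_sum => p _.
  rewrite normcM (normcR_ge0 (alpha_ge0 p)) mulrCA ler_wpM2l ?alpha_ge0//.
  exact: normc_Ssum_far.
rewrite -mulrA ler_wpM2l ?expR_ge0// mulrDl mul1r expRD mulrCA ler_wpM2l ?expR_ge0//.
have dD : de^-1 <= D.
  by rewrite /D; have : 0 < de^-1 :> R; [rewrite invr_gt0 | lra].
have dV : D ^- 2 <= 1 by rewrite invf_le1 ?exprn_gt0// expr2; nra.
apply: le_trans (_ : D * 1 <= _).
  by apply: ler_pM => //; rewrite invr_ge0 ?ltW// exprn_gt0.
by rewrite mulr1; have := expR_ge1Dx D; lra.
Qed.

End BesselSeries.

(** * Bounds for the generating function of [Delta] away from z = 0 *)

Section GeneratingFunctionBounds.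
Variable R : realType.
Local Notation C := R[i].
Local Notation T := ((2 * pi : R)%:C%C).
Local Notation Z := (pi ^+ 2 / 6 : R).

Lemma has_csum_ge0 (u : nat -> C) (l : C) : (forall i, 0 <= re (u i)) -> has_csum u l -> 0 <= re l.
Proof.
move=> u0 hu; rewrite -oppr_le0 -reN.
apply: (@clim_re_le _ 0 (fun n => - \sum_(i < n) u i)) (climN hu) => n _.
rewrite reN oppr_le0; elim: n => [|n IH]; first by rewrite big_ord0.
by rewrite big_ord_recr reD addr_ge0.
Qed.

Lemma sum_dilate (u : nat -> C) (d n : nat) : (0 < d)%N ->
  \sum_(i < n) (if (d %| i.+1)%N then u (i.+1 %/ d).-1 else 0) = \sum_(i < n %/ d) u i.
Proof.
move=> d0; elim: n => [|n IH]; first by rewrite div0n !big_ord0.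
rewrite big_ord_recr /= IH; case: ifP => dn.
  have -> : (n.+1 %/ d = (n %/ d).+1)%N.
    by rewrite divnS// dn.
  by rewrite big_ord_recr.
by rewrite divnS// dn addr0.
Qed.

Lemma has_csum_dilate (u : nat -> C) (l : C) (d : nat) : (0 < d)%N -> has_csum u l ->
  has_csum (fun i => if (d %| i.+1)%N then u (i.+1 %/ d).-1 else 0) l.
Proof.
move=> d0 hu e e0; have [N h] := hu e e0; exists (N * d)%N => n Nn.
by rewrite sum_dilate//; apply: h; rewrite leq_divRL.
Qed.

Definition dvr (d l : nat) : R := (d %| l)%N%:R.

Lemma etalog_dilate (z : C) (d : nat) : 0 < re z -> (0 < d)%N ->
  has_csum (fun l => (d%:R * dvr d l.+1 / l.+1%:R)%:C%C * bose (l.+1%:R * z)) (etalog (d%:R * z)).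
Proof.
move=> z0 d0; have dz : 0 < re (d%:R * z) by rewrite re_natM mulr_gt0// ltr0n.
apply: eq_has_csum (has_csum_dilate d0 (etalogP dz)) => l; rewrite /dvr.
case: ifP => dl; last by rewrite mulr0 mul0r rmorph0 mul0r.
have m0 : (0 < l.+1 %/ d)%N by rewrite divn_gt0// dvdn_leq.
rewrite (prednK m0) mulr1 -{3 4}(divnK dl).
set m := (l.+1 %/ d)%N in m0 *; rewrite mulrA -natrM mulrC; congr (_ * _).
have m1 : (m%:R : R) != 0 by rewrite pnatr_eq0 -lt0n.
have d1 : (d%:R : R) != 0 by rewrite pnatr_eq0 -lt0n.
have -> : d%:R / (m * d)%:R = (m%:R)^-1 :> R by rewrite natrM; field; rewrite m1 d1.
by rewrite fmorphV /= realc_nat.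
Qed.

Lemma basel_dilate (d : nat) : (0 < d)%N ->
  has_csum (fun l => (dvr d l.+1 * l.+1%:R ^- 2)%:C%C) (Z / d%:R ^+ 2)%:C%C.
Proof.
move=> d0; have -> : (Z / d%:R ^+ 2)%:C%C = ((d%:R : R) ^- 2)%:C%C * Z%:C%C by rewrite mulrC rmorphM.
have h := has_csumZ ((d%:R : R) ^- 2)%:C%C (has_csum_dilate d0 (@basel R)).
apply: eq_has_csum h => l; rewrite /dvr.
case: ifP => dl; last by rewrite mulr0 mul0r rmorph0.
have m0 : (0 < l.+1 %/ d)%N by rewrite divn_gt0// dvdn_leq.
rewrite (prednK m0) mul1r -{2}(divnK dl).
set m := (l.+1 %/ d)%N in m0 *.
have -> : (m%:R : C) ^- 2 = ((m%:R : R) ^- 2)%:C%C by rewrite fmorphV rmorphXn /= realc_nat.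
by rewrite -rmorphM /= mulrC natrM exprMn; congr (_%:C%C); rewrite [RHS]invfM.
Qed.

(** Coefficients that merge the four series of [Glog] into one: [etalog (d z)] is a series over the
    multiples of d, where 1 / m = d / (m d) gives the weight d. *)
Definition kap (k l : nat) : R :=
  3 - 2 * dvr 2 l - (2 * k + 1)%:R * dvr (2 * k + 1) l + (4 * k + 2)%:R * dvr (4 * k + 2) l.

(* Dominates [|kap k l|] and has equality for [l <= 3]; for [k = 1] it is [kap k l] itself. *)
Definition akap (k l : nat) : R :=
  3 - 2 * dvr 2 l - (5 - 2 * k%:R) * dvr (2 * k + 1) l + 6 * dvr (4 * k + 2) l.

(** The sum of [akap k l / l^2] in units of pi^2 / 6: the multiples of d contribute the fraction 1 /
    d^2. *)
Definition akap_mean (k : nat) : R :=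
  3 - 1 / 2 - (5 - 2 * k%:R) / (2 * k + 1)%:R ^+ 2 + 6 / (4 * k + 2)%:R ^+ 2.

Lemma kap_le k l : k = 1%N \/ k = 2%N -> `|kap k l| <= akap k l <= 9.
Proof.
have e6 : (6 %| l)%N = (2 %| l)%N && (3 %| l)%N by exact: (Gauss_dvd l (isT : coprime 2 3)).
have e10 : (10 %| l)%N = (2 %| l)%N && (5 %| l)%N by exact: (Gauss_dvd l (isT : coprime 2 5)).
case=> ->; rewrite /kap /akap /dvr.
  rewrite -[(2 * 1 + 1)%N]/3%N -[(4 * 1 + 2)%N]/6%N e6.
  by case: (2 %| l)%N; case: (3 %| l)%N => /=; rewrite ler_norml; apply/andP; split; try apply/andP; try split; lra.
rewrite -[(2 * 2 + 1)%N]/5%N -[(4 * 2 + 2)%N]/10%N e10.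
by case: (2 %| l)%N; case: (5 %| l)%N => /=; rewrite ler_norml; apply/andP; split; try apply/andP; try split; lra.
Qed.

Lemma kap_small k l : k = 1%N \/ k = 2%N -> (0 < l <= 3)%N -> kap k l = akap k l.
Proof.
case=> ->; rewrite /kap /akap.
  by move=> _; rewrite -[(2 * 1 + 1)%N]/3%N -[(4 * 1 + 2)%N]/6%N; ring.
case/andP=> l0 l3; have e d : (3 < d)%N -> dvr d l = 0.
  by move=> d3; rewrite /dvr gtnNdvd// (leq_ltn_trans l3).
by rewrite (e (2 * 2 + 1)%N isT) (e (4 * 2 + 2)%N isT) !mulr0.
Qed.

Lemma has_csum_kap k (z : C) : 0 < re z ->
  has_csum (fun l => (kap k l.+1 / l.+1%:R)%:C%C * bose (l.+1%:R * z)) (Glog k z).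
Proof.
move=> z0.
have h1 := etalog_dilate z0 (isT : (0 < 1)%N); rewrite mul1r in h1.
have h2 := etalog_dilate z0 (isT : (0 < 2)%N).
have h3 := etalog_dilate z0 (ltn_addl (2 * k) (isT : (0 < 1)%N)).
have h4 := etalog_dilate z0 (ltn_addl (4 * k) (isT : (0 < 2)%N)).
have lin4 (a b c d : R) (w : C) : 3 * (a%:C%C * w) - b%:C%C * w - c%:C%C * w + d%:C%C * w =
    (3 * a - b - c + d)%:C%C * w.
  by rewrite rmorphD !rmorphB rmorphM /= realc_nat; ring.
have := has_csumD (has_csumB (has_csumB (has_csumZ 3 h1) h2) h3) h4.
apply: eq_has_csum => l.
rewrite lin4; congr (_%:C%C * _).
by rewrite /kap {1}/dvr dvd1n /=; ring.
Qed.

Lemma has_csum_akap k :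
  has_csum (fun l => (akap k l.+1 * l.+1%:R ^- 2)%:C%C) (akap_mean k * Z)%:C%C.
Proof.
have h1 := basel_dilate (isT : (0 < 1)%N).
have h2 := basel_dilate (isT : (0 < 2)%N).
have h3 := basel_dilate (ltn_addl (2 * k) (isT : (0 < 1)%N)).
have h4 := basel_dilate (ltn_addl (4 * k) (isT : (0 < 2)%N)).
pose a5 : R := 5 - 2 * k%:R.
have := has_csumD (has_csumB (has_csumB (has_csumZ (3 : R)%:C%C h1)
   (has_csumZ (2 : R)%:C%C h2)) (has_csumZ a5%:C%C h3)) (has_csumZ (6 : R)%:C%C h4).
rewrite -!rmorphM -!rmorphB -rmorphD /=.
have -> : 3 * (Z / 1 ^+ 2) - 2 * (Z / 2 ^+ 2) - a5 * (Z / (2 * k + 1)%:R ^+ 2) +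
   6 * (Z / (4 * k + 2)%:R ^+ 2) = akap_mean k * Z.
  rewrite /akap_mean -/a5; move: (((2 * k + 1)%:R ^+ 2)^-1) (((4 * k + 2)%:R ^+ 2)^-1) (pi ^+ 2) => a b p.
  by rewrite expr1n; field.
apply: eq_has_csum => l.
rewrite -!rmorphM -!rmorphB -rmorphD /=; congr (_%:C%C).
by rewrite /akap -/a5 {1}/dvr dvd1n /=; ring.
Qed.

(** The terms outside [P] are bounded through |bose (l z)| <= 1 / (l re z). Each index of [P] saves
    its share of the 1 / re z term; at most three indices with [akap] at most 9 give the 27. *)
Lemma re_Glog_le k (z : C) (P : pred nat) (Cb : R) : k = 1%N \/ k = 2%N -> 0 < re z -> 0 <= Cb ->
  (forall l, P l -> (0 < l <= 3)%N /\ re (bose (l%:R * z)) <= Cb) ->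
  re (Glog k z) <= 27 * Cb +
    (akap_mean k * Z - \sum_(l < 3) (if P l.+1 then akap k l.+1 * l.+1%:R ^- 2 else 0)) / re z.
Proof.
move=> hk z0 C0 hP; set y := re z.
have ak l : 0 <= akap k l <= 9.
  by have /andP[h h'] := kap_le l hk; rewrite h' andbT; apply: le_trans h.
(* On [P], the correction that replaces the generic majorant by the bound [Cb]. *)
pose w l := if P l.+1 then akap k l.+1 * Cb - akap k l.+1 * l.+1%:R ^- 2 / y else 0.
have hw : has_csum (fun l => (w l)%:C%C) (\sum_(l < 3) (w l)%:C%C).
  apply: has_csum_finite => j j3; rewrite /w; case: ifP => // /hP[/andP[_ j4] _].
  by have := leq_trans j4 j3; rewrite ltnn.
have h := has_csumB (has_csumD (has_csumZ (y^-1)%:C%C (has_csum_akap k)) hw) (has_csum_kap k z0).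
have g0 : 0 <= re ((y^-1)%:C%C * (akap_mean k * Z)%:C%C + \sum_(l < 3) (w l)%:C%C - Glog k z).
  have reR (x : R) : re x%:C%C = x by [].
  apply: has_csum_ge0 h => l; rewrite reB reD (re_rmul y^-1) (re_rmul (kap k l.+1 / l.+1%:R)).
  rewrite [re (akap k l.+1 * _)%:C%C]reR [re (w l)%:C%C]reR.
  have l0 : 0 < (l.+1%:R : R) by rewrite ltr0n.
  have l1 : 1 <= (l.+1%:R : R) by rewrite ler1n.
  rewrite /w; case: ifP => Pl.
    have [l3 hb] := hP _ Pl; rewrite (kap_small hk l3) subr_ge0.
    have /andP[a0 _] := ak l.+1.
    apply: le_trans (_ : akap k l.+1 * Cb <= _); last by rewrite [y^-1 * _]mulrC addrC subrK.
    apply: le_trans (_ : akap k l.+1 / l.+1%:R * Cb <= _).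
      by apply: ler_wpM2l => //; rewrite divr_ge0// ltW.
    rewrite ler_wpM2r// ler_pdivrMr//; exact: ler_peMr.
  rewrite addr0 subr_ge0.
  have lz : 0 < re (l.+1%:R * z) by exact: re_natM_gt0.
  have nb := normc_bose_leV lz; rewrite re_natM -/y in nb.
  have rb : `|re (bose (l.+1%:R * z))| <= (l.+1%:R * y)^-1 by apply: le_trans nb; exact: normr_re_le.
  move: (re (bose _)) rb => rbz rb; apply: le_trans (ler_norm _) _; rewrite normrM normrM [`|_^-1|]ger0_norm ?invr_ge0 ?(ltW l0)//.
  have /andP[ka _] := kap_le l.+1 hk.
  have -> : y^-1 * (akap k l.+1 * l.+1%:R ^- 2) = akap k l.+1 / l.+1%:R * (l.+1%:R * y)^-1.
    have yn : y != 0 by rewrite gt_eqF.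
    have := lt0r_neq0 l0; move: (akap k l.+1) (l.+1%:R : R) (y) yn => a b c c0 b0.
    by field; rewrite b0 c0.
  apply: ler_pM => //.
  by rewrite ler_wpM2r ?invr_ge0 ?(ltW l0).
rewrite reB reD -rmorphM -rmorph_sum /= subr_ge0 in g0.
apply: le_trans g0 _; rewrite mulrBl [y^-1 * _]mulrC [27 * Cb + _]addrC -addrA lerD2l.
have -> : 27 * Cb = \sum_(l < 3) 9 * Cb by rewrite sumr_const card_ord -mulr_natr; ring.
rewrite mulr_suml -sumrN -big_split /=.
apply: ler_sum => l _; rewrite /w; have /andP[a0 a9] := ak l.+1.
have := ler_wpM2r C0 a9; have C9 : 0 <= 9 * Cb by rewrite mulr_ge0.
by case: ifP => _ hh; [move: (_ / y) => t; lra | rewrite mul0r oppr0 add0r].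
Qed.

(** The true value is about 1.645, and [re_Glog_far] needs a bound below 1.672. The remainder comes
    from 1 / m^2 <= 1 / ((m - 1/2) (m + 1/2)), which telescopes from 1 + 1/4 = 33/20 - 2/5. *)
Lemma zeta2_le : Z <= 33 / 20.
Proof.
have h n : \sum_(i < n.+2) (i.+1%:R : R) ^- 2 <= 33 / 20 - (n%:R + 5 / 2)^-1.
  elim: n => [|n IH].
    rewrite !big_ord_recl big_ord0 /bump /= add0r addr0 expr1n invr1.
    have -> : (5 / 2 : R)^-1 = 2 / 5 by field.
    have -> : (2 : R) ^- 2 = 1 / 4 by field.
    by lra.
  rewrite big_ord_recr /=; apply: le_trans (lerD IH (lexx _)) _.
  have -> : n.+3%:R = n%:R + 3 :> R by rewrite -[n.+3]addn3 natrD.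
  rewrite -[n.+1%:R]natr1; have : 0 <= n%:R :> R by [].
  move: (n%:R : R) => x x0.
  have -> : 33 / 20 - (x + 1 + 5 / 2)^-1 =
    33 / 20 - (x + 5 / 2)^-1 + ((x + 5 / 2) * (x + 7 / 2))^-1 by field; lra.
  have p1 : 0 < (x + 3) ^+ 2 by rewrite exprn_gt0//; lra.
  have p2 : 0 < (x + 5 / 2) * (x + 7 / 2) by rewrite mulr_gt0//; lra.
  by rewrite lerD2l lef_pV2 ?posrE//; nra.
have -> : Z = re (Z%:C%C) by [].
apply: (@clim_re_le _ 2 _ _ _ _ (@basel R)) => -[|[|n]]// _.
have -> : \sum_(i < n.+2) (i.+1%:R : C) ^- 2 = (\sum_(i < n.+2) (i.+1%:R : R) ^- 2)%:C%C.
  by rewrite rmorph_sum; apply: eq_bigr => i _; rewrite fmorphV rmorphXn /= realc_nat.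
rewrite /=; apply: le_trans (h n) _; rewrite gerBl invr_ge0 addr_ge0//.
Qed.

Lemma expRB1_le (x : R) : 0 <= x <= 1 / 2 -> expR x - 1 <= 2 * x.
Proof.
case/andP=> x0 x2; have h : 1 - x <= expR (- x) by exact: expR_ge1Dx.
rewrite expRN in h; have e0 := expR_gt0 x.
have : (1 - x) * expR x <= 1 by rewrite -ler_pdivlMr// mul1r.
by nra.
Qed.

(** The numerator in [re_bose_le] is at most 6 re z <= 6 |z|^2 and the denominator is at least |z|^2
    / 81, whence 486 = 6 * 81. *)
Lemma re_bose_bounded (z : C) (j : nat) : (0 < j <= 3)%N -> 0 < re z -> re z <= 1 / 16 ->
  re z <= normc z ^+ 2 -> normc z / 9 <= normc (cexp (j%:R * z) - 1) ->
  re (bose (j%:R * z)) <= 486.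
Proof.
case/andP=> j0 j3 z0 z1 zz hj; have jz : 0 < re (j%:R * z) by rewrite re_natM mulr_gt0// ltr0n.
apply: le_trans (re_bose_le jz) _; rewrite re_natM.
have jr : 0 < (j%:R : R) by rewrite ltr0n.
have jr3 : (j%:R : R) <= 3 by rewrite ler_nat.
have d0 : 0 < normc (cexp (j%:R * z) - 1) by rewrite normc_gt0 cexpB1_neq0.
have n0 := normc_ge0 z.
rewrite ler_pdivrMr ?exprn_gt0//.
have y3 : j%:R * re z <= 3 * re z by rewrite ler_pM2r.
have h1 : expR (j%:R * re z) - 1 <= 2 * (j%:R * re z).
  apply: expRB1_le; apply/andP; split; first exact: (mulr_ge0 (ltW jr) (ltW z0)).
  by lra.
have h2 : (normc z / 9) ^+ 2 <= normc (cexp (j%:R * z) - 1) ^+ 2.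
  by rewrite lerXn2r// nnegrE ?(ltW d0)// divr_ge0.
by move: h2; rewrite expr_div_n; lra.
Qed.

Definition Ak (k : nat) : R := Z * ((5 * k%:R + 2) / (2 * k%:R + 1)).

Definition nuk (k : nat) : R := (2 * k%:R + 2) / 24.

(** The margin 1/25 is what the bound 33/20 on pi^2 / 6 leaves room for; any positive margin would
    give a strictly smaller exponent in the end. *)
Definition Bk (k : nat) : R := Ak k / 4 - 1 / 25.

Lemma akap_mean1 : akap_mean 1 = 7 / 3.
Proof. by rewrite /akap_mean -[(2 * 1 + 1)%N]/3%N -[(4 * 1 + 2)%N]/6%N; field. Qed.

Lemma akap_mean2 : akap_mean 2 = 63 / 25.
Proof. by rewrite /akap_mean -[(2 * 2 + 1)%N]/5%N -[(4 * 2 + 2)%N]/10%N; field. Qed.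

Lemma Ak1 : Ak 1 = Z * (7 / 3).
Proof. by rewrite /Ak; congr (_ * _); field. Qed.

Lemma Ak2 : Ak 2 = Z * (12 / 5).
Proof. by rewrite /Ak; congr (_ * _); field. Qed.

Lemma dvrE d l b : (d %| l)%N = b -> dvr d l = b%:R.
Proof. by rewrite /dvr => ->. Qed.

Lemma akap11 : akap 1 1 = 3.
Proof. by rewrite /akap (@dvrE 2%N _ false)// (@dvrE (_ + 1)%N _ false)// (@dvrE (_ + 2)%N _ false)//=; ring. Qed.

Lemma akap21 : akap 2 1 = 3.
Proof. by rewrite /akap (@dvrE 2%N _ false)// (@dvrE (_ + 1)%N _ false)// (@dvrE (_ + 2)%N _ false)//=; ring. Qed.

Lemma akap22 : akap 2 2 = 1.
Proof. by rewrite /akap (@dvrE 2%N _ true)// (@dvrE (_ + 1)%N _ false)// (@dvrE (_ + 2)%N _ false)//=; ring. Qed.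

Lemma akap23 : akap 2 3 = 3.
Proof. by rewrite /akap (@dvrE 2%N _ false)// (@dvrE (_ + 1)%N _ false)// (@dvrE (_ + 2)%N _ false)//=; ring. Qed.

(* Since [(e^{3z} - 1) - e^z (e^{2z} - 1) = e^z - 1], the points [2z] and [3z] cannot both be
   close to poles of [bose]; for [k = 2] discarding [l = 1] alone would not give [Bk k < Ak k / 4]. *)
Lemma re_Glog_far k (z : C) : k = 1%N \/ k = 2%N -> 0 < re z -> re z <= 1 / 16 ->
  `|im z| <= 4 -> re z <= normc z ^+ 2 -> re (Glog k z) <= 27 * 486 + Bk k / re z.
Proof.
move=> hk z0 z1 iz zz.
have n0 := normc_ge0 z.
have c0 : normc z / 3 <= normc (cexp z - 1) by apply: normc_cexpB1_ge => //; exact: ltW.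
have c1 : re (bose (1%:R * z)) <= 486.
  by apply: re_bose_bounded => //; rewrite mul1r; lra.
have c2 : exists2 j : nat, j = 2%N \/ j = 3%N & re (bose (j%:R * z)) <= 486.
  have ez : normc (cexp z) <= 2.
    rewrite normc_cexp; have : 0 <= re z <= 1 / 2 by apply/andP; split; lra.
    by move/expRB1_le; lra.
  have e : cexp z - 1 = (cexp (3%:R * z) - 1) - cexp z * (cexp (2%:R * z) - 1).
    by rewrite !cexpXn; ring.
  have h := normcB (cexp (3%:R * z) - 1) (cexp z * (cexp (2%:R * z) - 1)).
  rewrite -e normcM in h.
  have h2 := ler_wpM2r (normc_ge0 (cexp (2%:R * z) - 1)) ez.
  (* The threshold 1/9 balances |z| / 3 <= |e^{3z} - 1| + 2 |e^{2z} - 1|, as 1/9 + 2 / 9 = 1/3. *)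
  have [h3|h3] := leP (normc z / 9) (normc (cexp (3%:R * z) - 1)).
    by exists 3%N; [right | apply: re_bose_bounded].
  by exists 2%N; [left | apply: re_bose_bounded => //; lra].
have zle := zeta2_le; have C486 : 0 <= 486 :> R by rewrite ler0n.
have fin x : x <= Bk k -> x / re z <= Bk k / re z by move=> h; rewrite ler_pM2r ?invr_gt0.
have i1 : (1 : R) ^- 2 = 1 by rewrite expr1n invr1.
have i2 : (2 : R) ^- 2 = 1 / 4 by field.
have i3 : (3 : R) ^- 2 = 1 / 9 by field.
case: hk c2 fin => -> [j hj cj] fin.
  have hP l : pred1 1%N l -> (0 < l <= 3)%N /\ re (bose (l%:R * z)) <= 486.
    by move=> /= /eqP ->.
  apply: le_trans (re_Glog_le (or_introl erefl) z0 C486 hP) _.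
  rewrite lerD2l; apply: fin.
  rewrite !big_ord_recl big_ord0 /= /Bk Ak1 akap_mean1 akap11 i1.
  by move: (Z) zle => p; lra.
pose P l := (l == 1%N) || (l == j).
have hP l : P l -> (0 < l <= 3)%N /\ re (bose (l%:R * z)) <= 486.
  by rewrite /P => /orP[] /eqP ->//; split=> //; case: hj => ->.
apply: le_trans (re_Glog_le (or_intror erefl) z0 C486 hP) _.
rewrite lerD2l; apply: fin.
rewrite !big_ord_recl big_ord0 /bump /= ?add1n /P /= /Bk Ak2 akap_mean2 akap21 i1.
by case: hj => -> /=; rewrite ?akap22 ?akap23 ?i2 ?i3; move: (Z) zle => p; lra.
Qed.

End GeneratingFunctionBounds.

(** * Difference of the generating functions, and the estimate of its coefficients *)

Section CoefficientEstimate.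
Variable R : realType.
Local Notation C := R[i].
Local Notation T := ((2 * pi : R)%:C%C).
Local Notation Z := (pi ^+ 2 / 6 : R).

(** The middle inequality is the crucial one: the slowest transformed series decays like e^{- 4 pi^2
    Re (1/z) / (4k+2)} and has to compensate the growth e^{A Re (1/z)}. For k = 2 both rates are 2
    pi^2 / 5. *)
Lemma Ak_bounds k : k = 1%N \/ k = 2%N ->
  [/\ 1 <= Ak R k, Ak R k <= 4 * pi ^+ 2 / (4 * k + 2)%:R & 1 <= 4 * pi ^+ 2 / (4 * k + 2)%:R :> R].
Proof.
have p2 : 4 <= pi ^+ 2 :> R.
  by have := pi_ge2 R => h; rewrite expr2; have := ler_pM _ _ h h; rewrite !ler0n => /(_ isT isT); lra.
case=> ->; rewrite ?Ak1 ?Ak2 -?[(4 * 1 + 2)%N]/6%N -?[(4 * 2 + 2)%N]/10%N.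
  by move: (pi ^+ 2 : R) p2 => p p2; split; lra.
by move: (pi ^+ 2 : R) p2 => p p2; split; lra.
Qed.

Lemma Bk_gt0 k : k = 1%N \/ k = 2%N -> 0 < Bk R k.
Proof. by case/Ak_bounds => a1 _ _; rewrite /Bk; lra. Qed.

Lemma nuk01 k : k = 1%N \/ k = 2%N -> 0 < nuk R k < 1.
Proof. by case=> ->; rewrite /nuk; apply/andP; split; lra. Qed.

(** The exponent is linear in 1 / |z|; the arithmetic-geometric mean inequality trades it for B /
    |z|^2 <= B / re z plus a constant, for any B > 0. *)
Lemma bes_exponent_le (z : C) (A B : R) : 0 < A -> 0 < B -> 0 < re z -> `|im z| <= 4 ->
  re z <= normc z ^+ 2 ->
  (A + 1) * (2 + 2 / normc (cexp z - 1)) <= 2 * (A + 1) + 9 * (A + 1) ^+ 2 / B + B / re z.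
Proof.
move=> A0 B0 z0 iz zz.
have nz : 0 < normc z by rewrite normc_gt0 re_gt0_neq0.
have c0 : normc z / 3 <= normc (cexp z - 1) by apply: normc_cexpB1_ge => //; exact: ltW.
have h1 : (normc (cexp z - 1))^-1 <= 3 / normc z.
  have c00 : 0 < normc z / 3 by rewrite divr_gt0.
  by rewrite -[3 / _]invf_div lef_pV2 ?posrE ?(lt_le_trans c00 c0).
have h2 : (normc z)^-1 ^+ 2 <= (re z)^-1.
  by rewrite exprVn lef_pV2 ?posrE ?exprn_gt0.
set s := (normc z)^-1 in h1 h2; have s0 : 0 < s by rewrite invr_gt0.
have h3 : (A + 1) * 6 * s <= B * s ^+ 2 + 9 * (A + 1) ^+ 2 / B.
  have e : B * s ^+ 2 + 9 * (A + 1) ^+ 2 / B - (A + 1) * 6 * s = (B * s - 3 * (A + 1)) ^+ 2 / B.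
    by field; rewrite gt_eqF.
  by rewrite -subr_ge0 e divr_ge0 ?sqr_ge0// ltW.
have h4 := ler_wpM2l (ltW B0) h2.
have A1 : 0 <= A + 1 by lra.
have h5 := ler_wpM2l A1 h1.
move: h3 h4 h5; rewrite -/s; move: (normc _)^-1 (s ^+ 2) (re z)^-1 (_ / B) => x s2 y c; nra.
Qed.

(** For x >= 1 one has 1 / (e^x - 1) <= 2 e^{-x}, and the terms decrease by a factor of at least
    2. *)
Lemma normc_etalog_le (w : C) : 1 <= re w -> normc (etalog w) <= 4 * expR (- re w).
Proof.
move=> w1; have w0 : 0 < re w by lra.
have half : expR (- re w) <= 1 / 2.
  rewrite expRN -[1 / 2]invf_div divr1 lef_pV2 ?posrE ?expR_gt0//.
  by have := expR_ge1Dx (re w); lra.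
apply: has_csum_norm_le (etalogP w0) => n.
apply: le_trans (_ : \sum_(i < n) (2 * expR (- re w)) * (1 / 2) ^+ i <= _); last first.
  rewrite -mulr_sumr.
  have h : \sum_(i < n) (1 / 2 : R) ^+ i <= (1 - 1 / 2)^-1.
    by apply: sum_geo_le; apply/andP; split; lra.
  have -> : 4 * expR (- re w) = 2 * expR (- re w) * (1 - 1 / 2)^-1 by field.
  by rewrite ler_wpM2l// mulr_ge0 ?expR_ge0.
apply: ler_sum => i _; rewrite normcM normcV normc_nat.
have i0 : 0 < (i.+1%:R : R) by rewrite ltr0n.
have i1 : 1 <= (i.+1%:R : R) by rewrite ler1n.
have iw : 0 < re (i.+1%:R * w) by exact: re_natM_gt0.
have iw1 : 1 <= re (i.+1%:R * w) by rewrite re_natM; nra.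
apply: le_trans (_ : normc (bose (i.+1%:R * w)) <= _).
  by rewrite ler_pdivrMr//; apply: ler_peMr => //; exact: normc_ge0.
apply: le_trans (normc_bose_le iw) _.
have -> : 2 * expR (- re w) * (1 / 2) ^+ i = 2 * (expR (- re w) * (1 / 2) ^+ i) by rewrite mulrA.
apply: le_trans (_ : 2 * expR (- re (i.+1%:R * w)) <= _).
  have e2 := expR_ge1Dx (re (i.+1%:R * w)); rewrite expRN.
  rewrite -[2 * _]invf_div lef_pV2 ?posrE ?divr_gt0 ?expR_gt0//; last by lra.
  by lra.
rewrite ler_pM2l// re_natM -[i.+1%:R]natr1 mulrDl mul1r opprD expRD mulrC ler_pM2l ?expR_gt0//.
by rewrite -mulrN expRM_natl; apply: lerXn2r; rewrite ?nnegrE ?expR_ge0//; lra.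
Qed.

Definition eta_rest k (z : C) : C :=
  3 * etalog (T ^+ 2 / z) - etalog (T ^+ 2 / (2 * z)) - etalog (T ^+ 2 / ((2 * k + 1)%:R * z))
  + etalog (T ^+ 2 / ((4 * k + 2)%:R * z)).

(** [etalog_transform] at the four dilations. The 1/z terms combine by 3 - 1/2 - 1/(2k+1) + 1/(4k+2)
    = (5k+2)/(2k+1), and the linear ones by 3 - 2 - (2k+1) + (4k+2) = 2k+2. The logarithms leave (3
    - 1 - 1 + 1) / 2 = 1 copy of log (z / 2 pi), while ln 2, ln (2k+1) and ln (4k+2) cancel. *)
Lemma cexp_Glog k (z : C) : 0 < re z ->
  cexp (Glog k z) = cexp ((Ak R k)%:C%C / z) * cexp (- ((nuk R k)%:C%C * z)) * (z / T) *
    cexp (eta_rest k z).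
Proof.
move=> z0; have zn := re_gt0_neq0 z0.
have zT : 0 < re (z / T).
  by rewrite -fmorphV mulrC re_rmul mulr_gt0// invr_gt0 mulr_gt0// pi_gt0.
have tr d : (0 < d)%N -> etalog (d%:R * z) = Z%:C%C / (d%:R * z) - d%:R * z / 24 +
    2^-1 * ((ln (d%:R : R))%:C%C + clog (z / T)) + etalog (T ^+ 2 / (d%:R * z)).
  move=> d0; have dz : 0 < re (d%:R * z) by rewrite re_natM mulr_gt0// ltr0n.
  have d0' : 0 < (d%:R : R) by rewrite ltr0n.
  have := clogM d0' zT; rewrite realc_nat => cl.
  by rewrite etalog_transform// -[d%:R * z / T]mulrA cl.
have M1 : (0 < 2 * k + 1)%N by rewrite addn1.
have M2 : (0 < 4 * k + 2)%N by rewrite addn2.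
have lnM : ln ((4 * k + 2)%:R : R) = ln 2 + ln ((2 * k + 1)%:R).
  by rewrite -lnM ?posrE ?ltr0n// -natrM; congr (ln _%:R); rewrite mulnDr mulnA.
rewrite -[z / T](cexp_clog zT) -!cexpD; congr cexp.
rewrite /Glog etalog_transform// (tr 2%N)// (tr _ M1) (tr _ M2) lnM /eta_rest.
move: (etalog _) (etalog _) (etalog _) (etalog _) => e4 e3 e2 e1.
have eA : (Ak R k)%:C%C = Z%:C%C * ((5 * k%:R + 2) / (2 * k%:R + 1)).
  by rewrite /Ak rmorphM; congr (_ * _); rewrite rmorphM fmorphV !rmorphD !rmorphM /= !realc_nat.
have en : (nuk R k)%:C%C = (2 * k%:R + 2) / 24.
  by rewrite /nuk rmorphM fmorphV !rmorphD !rmorphM /= !realc_nat.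
have eM1 : (2 * k + 1)%:R = 2 * k%:R + 1 :> C by rewrite natrD natrM.
have eM2 : (4 * k + 2)%:R = 4 * k%:R + 2 :> C by rewrite natrD natrM.
rewrite eA en [(ln 2 + ln _)%:C%C]rmorphD /= eM1 eM2.
have kn : 2 * k%:R + 1 != 0 :> C by rewrite -eM1 pnatr_eq0 addn1.
have kn2 : 4 * k%:R + 2 != 0 :> C by rewrite -eM2 pnatr_eq0 addn2.
move: (clog (z / T)) (Z%:C%C) ((ln 2 : R)%:C%C) ((ln (2 * k + 1)%:R : R)%:C%C) (k%:R : C) kn kn2 zn => c p a b x kn kn2 zn.
by field; rewrite zn kn kn2.
Qed.

Lemma re_dilate_inv (z : C) (d m : nat) : (0 < d <= m)%N -> 1 <= re z^-1 ->
  4 * pi ^+ 2 / m%:R * re z^-1 <= re (T ^+ 2 / (d%:R * z)).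
Proof.
case/andP=> d0 dm z1.
have -> : T ^+ 2 / (d%:R * z) = (4 * pi ^+ 2 / d%:R)%:C%C * z^-1.
  rewrite invfM mulrA; congr (_ * _).
  by rewrite [(_ / d%:R)%:C%C]rmorphM fmorphV /= realc_nat -rmorphXn /=; congr (_%:C%C * _); ring.
rewrite re_rmul ler_wpM2r//; first by lra.
apply: ler_wpM2l; first by rewrite mulr_ge0// sqr_ge0.
by rewrite lef_pV2 ?posrE ?ltr0n ?ler_nat// (leq_trans d0).
Qed.

Lemma divisor_range k : [/\ (0 < 1 <= 4 * k + 2)%N, (0 < 2 <= 4 * k + 2)%N,
  (0 < 2 * k + 1 <= 4 * k + 2)%N & (0 < 4 * k + 2 <= 4 * k + 2)%N].
Proof. by split; lia. Qed.

(** The explicit factors of both generating functions coincide, so what is left is the effect of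
    [eta_rest] and the bounded error of [bes_gen_near]. *)
Lemma near_bound k (z l : C) : k = 1%N \/ k = 2%N -> 0 < re z -> re z <= 1 / 16 ->
  normc z ^+ 2 <= re z ->
  has_csum (fun i => bes (Ak R k) (nuk R k) i * eterm (nuk R k) z i) l ->
  normc (cexp (Glog k z) - cexp (- ((nuk R k)%:C%C * z)) * l / T) <=
  24 * expR 24 + (1 + Ak R k + expR (Ak R k * 4)).
Proof.
move=> hk z0 z1 zz hl; have [A1 A2 A3] := Ak_bounds hk; have /andP[n0 n1] := nuk01 hk.
have A0 : 0 < Ak R k by lra.
have zn := re_gt0_neq0 z0.
have nz0 : 0 < normc z by rewrite normc_gt0.
have nz4 : normc z <= 1 / 4 by apply: ler_sqr_nonneg => //; lra.
have rho : 1 <= re z^-1 by rewrite reV ler_pdivlMr ?exprn_gt0// mul1r.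
set v := 4 * pi ^+ 2 / (4 * k + 2)%:R * re z^-1.
have v1 : 1 <= v by rewrite /v; nra.
have Av : Ak R k * re z^-1 <= v by rewrite /v ler_wpM2r//; lra.
have small d : (0 < d <= 4 * k + 2)%N -> normc (etalog (T ^+ 2 / (d%:R * z))) <= 4 * expR (- v).
  move=> hd; have h := re_dilate_inv hd rho; rewrite -/v in h.
  apply: le_trans (normc_etalog_le (le_trans v1 h)) _.
  by rewrite ler_wpM2l// ler_expR lerN2.
(* 24 = 4 (3 + 1 + 1 + 1), by [normc_etalog_le] for each series. *)
have ge : normc (eta_rest k z) <= 24 * expR (- v).
  have s1 := small 1%N; rewrite mul1r in s1.
  have s2 := small 2%N; have s3 := small (2 * k + 1)%N; have s4 := small (4 * k + 2)%N.
  have [d1 d2 d3 d4] := divisor_range k.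
  have {}s1 := s1 d1; have {}s2 := s2 d2; have {}s3 := s3 d3; have {}s4 := s4 d4.
  rewrite /eta_rest; apply: le_trans (normcD _ _) _.
  have t1 := normcB (3 * etalog (T ^+ 2 / z) - etalog (T ^+ 2 / (2 * z))) (etalog (T ^+ 2 / ((2 * k + 1)%:R * z))).
  have t2 := normcB (3 * etalog (T ^+ 2 / z)) (etalog (T ^+ 2 / (2 * z))).
  rewrite normcM normc_nat in t2; lra.
have ev1 : expR (- v) <= 1 by rewrite -expR0 ler_expR; lra.
have ge24 : normc (eta_rest k z) <= 24 by lra.
have mm : normc (z * cexp ((Ak R k)%:C%C / z) * (cexp (eta_rest k z) - 1)) <= 24 * expR 24.
  (* The growth [expR v] allowed for e^{A/z} cancels against the decay [expR (- v)] of
     [eta_rest]. *)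
  have -> : 24 * expR 24 = 1 * expR v * (24 * expR (- v) * expR 24).
    by rewrite expRN; field; rewrite gt_eqF ?expR_gt0.
  rewrite !normcM; apply: ler_pM; rewrite ?mulr_ge0 ?normc_ge0//.
    apply: ler_pM; rewrite ?normc_ge0//; first by lra.
    by rewrite normc_cexp re_rmul ler_expR.
  apply: le_trans (normc_cexpB1 _) _; apply: ler_pM; rewrite ?normc_ge0 ?expR_ge0//.
  by rewrite ler_expR.
have nn := bes_gen_near A0 (nuk01 hk) z0 nz4 hl.
have Tn := twopi_neq0 R.
have -> : cexp (Glog k z) - cexp (- ((nuk R k)%:C%C * z)) * l / T =
  cexp (- ((nuk R k)%:C%C * z)) * T^-1 *
  (z * cexp ((Ak R k)%:C%C / z) * (cexp (eta_rest k z) - 1) - (l - z * cexp ((Ak R k)%:C%C / z))).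
  by rewrite cexp_Glog//; ring.
rewrite normcM; apply: le_trans (_ : 1 * (24 * expR 24 + (1 + Ak R k + expR (Ak R k * 4))) <= _); last by rewrite mul1r.
apply: ler_pM; rewrite ?normc_ge0//; last first.
  by apply: le_trans (normcB _ _) _; apply: lerD.
rewrite normcM normc_cexp reN re_rmul normcV -[leRHS]mul1r; apply: ler_pM.
- exact: expR_ge0.
- by rewrite invr_ge0 normc_ge0.
- by rewrite -expR0 ler_expR oppr_le0 mulr_ge0// ltW.
have p2 := pi_ge2 R; rewrite normcR_ge0; last by lra.
by rewrite invf_le1; lra.
Qed.

Definition diff_cst k : R := 24 * expR 24 + (1 + Ak R k + expR (Ak R k * 4)) +
  expR (27 * 486) + expR 1 * expR (2 * (Ak R k + 1) + 9 * (Ak R k + 1) ^+ 2 / Bk R k).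

Lemma diff_bound k (z l : C) : k = 1%N \/ k = 2%N -> 0 < re z -> re z <= 1 / 16 -> `|im z| <= 4 ->
  has_csum (fun i => bes (Ak R k) (nuk R k) i * eterm (nuk R k) z i) l ->
  normc (cexp (Glog k z) - cexp (- ((nuk R k)%:C%C * z)) * l / T) <=
  diff_cst k * expR (Bk R k / re z).
Proof.
move=> hk z0 z1 iz hl; have [A1 _ _] := Ak_bounds hk; have A0 : 0 < Ak R k by lra.
have B0 := Bk_gt0 hk; have /andP[n0 _] := nuk01 hk.
have E1 : 1 <= expR (Bk R k / re z) by rewrite -expR0 ler_expR divr_ge0// ltW.
rewrite /diff_cst; set c1 := 24 * expR 24 + _; set c2 := expR (27 * 486); set c3 := expR 1 * _.
have c10 : 0 <= c1.
  have := expR_ge0 (24 : R); have := expR_ge0 (Ak R k * 4); rewrite /c1; lra.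
have c20 : 0 <= c2 by exact: expR_ge0.
have c30 : 0 <= c3 by rewrite mulr_ge0 ?expR_ge0.
(* The condition |z|^2 <= re z is Re (1/z) >= 1. *)
have [zz|/ltW zz] := leP (normc z ^+ 2) (re z).
  apply: le_trans (near_bound hk z0 z1 zz hl) _; rewrite -/c1.
  move: (expR (_ / _)) E1 => E E1; nra.
apply: le_trans (normcB _ _) _; rewrite normc_cexp.
have h1 : expR (re (Glog k z)) <= c2 * expR (Bk R k / re z).
  by rewrite -expRD ler_expR; exact: re_Glog_far.
have h2 : normc (cexp (- ((nuk R k)%:C%C * z)) * l / T) <= c3 * expR (Bk R k / re z).
  apply: le_trans (_ : normc l <= _).
    rewrite !normcM normcV normc_cexp reN re_rmul.
    have p2 := pi_ge2 R; rewrite normcR_ge0; last by lra.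
    have e1 : expR (- (nuk R k * re z)) <= 1.
      by rewrite -expR0 ler_expR oppr_le0 mulr_ge0// ltW.
    have i1 : (2 * pi : R)^-1 <= 1 by rewrite invf_le1; lra.
    have i0 : 0 <= (2 * pi : R)^-1 by rewrite invr_ge0; lra.
    rewrite -[leRHS]mulr1; apply: ler_pM => //; first by rewrite mulr_ge0 ?expR_ge0 ?normc_ge0.
    by rewrite -[leRHS]mul1r ler_wpM2r ?normc_ge0.
  have z11 : re z <= 1 by lra.
  apply: le_trans (bes_gen_far A0 (nuk01 hk) z0 z11 hl) _.
  rewrite /c3 -mulrA ler_pM2l ?expR_gt0// -expRD ler_expR.
  exact: bes_exponent_le.
have E0 := expR_ge0 (Bk R k / re z).
have h3 := mulr_ge0 c10 E0.
apply: le_trans (lerD h1 h2) _.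
have aux (a b c e : R) : 0 <= a * e -> b * e + c * e <= (a + b + c) * e.
  by move=> h; rewrite [leRHS](_ : _ = a * e + (b * e + c * e)); [rewrite lerDr | ring].
exact: aux.
Qed.

(** The Bessel terms start at n = 1, since n - nu is negative for n = 0; index [m] of [bes] belongs
    to n = m + 1. *)
Definition dcoef k (n : nat) : C :=
  (Delta k n)%:~R - (if n is m.+1 then bes (Ak R k) (nuk R k) m / T else 0).

(** The factor e^{- nu z} turns e^{- (n - nu) z} into q^n. *)
Lemma has_csum_dcoef k (z : C) : k = 1%N \/ k = 2%N -> 0 < re z -> exists2 l : C,
  has_csum (fun i => bes (Ak R k) (nuk R k) i * eterm (nuk R k) z i) l &
  has_csum (fun n => dcoef k n * cexp (- z) ^+ n)
    (cexp (Glog k z) - cexp (- ((nuk R k)%:C%C * z)) * l / T).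
Proof.
move=> hk z0; have [A1 _ _] := Ak_bounds hk; have A0 : 0 < Ak R k by lra.
have [l [hl _]] := bes_gen A0 (nuk01 hk) z0; exists l => //.
pose f n : C := (if n is m.+1 then bes (Ak R k) (nuk R k) m / T else 0) * cexp (- z) ^+ n.
have h := has_csumZ (cexp (- ((nuk R k)%:C%C * z)) / T) hl.
have hf : has_csum f (cexp (- ((nuk R k)%:C%C * z)) * l / T).
  have := @has_csum_unshift _ 1 f (cexp (- ((nuk R k)%:C%C * z)) * l / T).
  rewrite big_ord_recl big_ord0 /f /= mul0r !add0r; apply.
  rewrite mulrAC; apply: eq_has_csum h => i; rewrite add1n.
  rewrite /eterm /nshift -cexpXn.
  have -> : i.+1%:R * - z = - ((nuk R k)%:C%C * z) + - ((i.+1%:R - nuk R k)%:C%C * z).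
    by rewrite rmorphB /= realc_nat; ring.
  by rewrite cexpD; ring.
apply: eq_has_csum (has_csumB (Delta_gen k z0) hf) => n.
by rewrite /f /dcoef mulrBl.
Qed.

Lemma has_csum_real (v : nat -> R) (l : C) : has_csum (fun i => (v i)%:C%C) l -> im l = 0.
Proof.
move=> h; apply/eqP; rewrite eq_le.
have sE n : \sum_(i < n) (v i)%:C%C = (\sum_(i < n) v i)%:C%C by rewrite rmorph_sum.
have h1 := climZ (0 +i* 1)%C h; have h2 := climZ (0 +i* -1)%C h.
apply/andP; split.
  have -> : im l = re ((0 +i* -1)%C * l) by rewrite reM /= mul0r mulN1r add0r opprK.
  apply: (@clim_re_le _ 0 _ _ _ _ h2) => n _.
  by rewrite sE reM /= mul0r mulr0 subrr.
rewrite -oppr_le0.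
have -> : - im l = re ((0 +i* 1)%C * l) by rewrite reM /= mul0r mul1r add0r.
apply: (@clim_re_le _ 0 _ _ _ _ h1) => n _.
by rewrite sE reM /= mul0r mulr0 subrr.
Qed.

Lemma besE (A nu : R) i : 0 < A -> 0 < nu < 1 ->
  bes A nu i = (re (bes A nu i))%:C%C /\ 0 <= re (bes A nu i).
Proof.
move=> A0 n01; have h := besP A0 n01 i; split.
  by apply: complex_ext => //=; exact: has_csum_real h.
apply: has_csum_ge0 h => p /=.
by rewrite mulr_ge0 ?alpha_ge0 ?bterm_ge0.
Qed.

(** The Bessel terms are nonnegative, so their generating function at the real point [y] bounds all
    the partial sums of moduli. *)
Lemma csummable_dcoef k (y : R) : k = 1%N \/ k = 2%N -> 0 < y ->
  csummable (fun n => dcoef k n * (expR (- y))%:C%C ^+ n).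
Proof.
move=> hk y0; have [A1 _ _] := Ak_bounds hk; have A0 : 0 < Ak R k by lra.
have n01 := nuk01 hk; have /andP[n0 _] := n01.
set q := (expR (- y))%:C%C : C; have q0 : 0 <= expR (- y) by exact: expR_ge0.
have nq : normc q = expR (- y) by rewrite normcR_ge0.
have q1 : 0 <= normc q < 1 by rewrite nq q0 expR_lt1 oppr_lt0.
have [B1 h1] := fbd_csummable (fbd_Delta k q1).
have yc : 0 < re (y%:C%C : C) by [].
have [l [hl _]] := bes_gen A0 n01 yc.
pose v m := re (bes (Ak R k) (nuk R k) m) * expR (- (nshift (nuk R k) m * y)).
have v0 m : 0 <= v m by rewrite mulr_ge0 ?expR_ge0//; have [] := besE m A0 n01.
have hv : has_csum (fun m => (v m)%:C%C) l.
  apply: eq_has_csum hl => m; rewrite /v rmorphM /=.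
  by have [<- _] := besE m A0 n01; rewrite /eterm -rmorphM -rmorphN cexpR.
pose f n : C := (if n is m.+1 then bes (Ak R k) (nuk R k) m / T else 0) * q ^+ n.
have fv m : normc (f m.+1) <= v m.
  rewrite /f !normcM normcX nq normcV; have [be b0] := besE m A0 n01.
  have -> : normc (bes (Ak R k) (nuk R k) m) = re (bes (Ak R k) (nuk R k) m).
    by rewrite {1}be normcR_ge0.
  have p2 := pi_ge2 R; rewrite normcR_ge0; last by lra.
  rewrite -mulrA ler_wpM2l// -expRM_natl.
  have i1 : (2 * pi : R)^-1 <= 1 by rewrite invf_le1; lra.
  rewrite -[leRHS]mul1r; apply: ler_pM; rewrite ?expR_ge0 ?invr_ge0//; first by lra.
  rewrite ler_expR /nshift mulrN lerN2 ler_wpM2r ?(ltW y0)// gerBl ltW//.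
have hf N : \sum_(n < N) normc (f n) <= re l.
  case: N => [|N]; first by rewrite big_ord0; apply: has_csum_ge0 hv => i; exact: v0.
  rewrite big_ord_recl {1}/f mul0r normc0 add0r.
  apply: le_trans (has_csum_ge_partial N v0 hv).
  by apply: ler_sum => i _; exact: fv.
exists (B1 + re l) => n.
apply: le_trans (_ : \sum_(i < n) (normc ((Delta k i)%:~R * q ^+ i) + normc (f i)) <= _).
  by apply: ler_sum => i _; rewrite /dcoef mulrBl -/(f i); exact: normcB.
by rewrite big_split; exact: lerD (h1 n) (hf n).
Qed.

(** [cauchy_estimate] on |q| = e^{-y}: the angle t corresponds to z = y - i t, and |t| <= pi < 4
    puts it in the range of [diff_bound]. *)
Theorem dcoef_le k (y : R) n : k = 1%N \/ k = 2%N -> 0 < y -> y <= 1 / 16 ->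
  normc (dcoef k n) <= diff_cst k * expR (n%:R * y + Bk R k / y).
Proof.
move=> hk y0 y1; pose r := expR (- y); have r0 : 0 < r by exact: expR_gt0.
have zre t : re (y +i* t)%C = y by [].
have main : normc (dcoef k n) * r ^+ n <= diff_cst k * expR (Bk R k / y).
  apply: (cauchy_estimate r0).
    exact: csummable_dcoef.
  move=> t l tp hl.
  have zt : 0 < re (y +i* - t)%C by [].
  have [l' hl' h] := has_csum_dcoef hk zt.
  have e : r%:C%C * cexpi t = cexp (- (y +i* - t)%C).
    by rewrite /r -cexpR /cexpi -cexpD; congr cexp; apply: complex_ext; rewrite /= ?addr0 ?add0r ?opprK.
  rewrite e in hl; rewrite (has_csum_unique hl h).
  apply: (diff_bound hk zt) => //=; rewrite normrN; apply: le_trans tp _.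
  by have := pihalf_lt2 R; lra.
have -> : n%:R * y + Bk R k / y = Bk R k / y + n%:R * y by rewrite addrC.
rewrite expRD mulrA -ler_pdivrMr ?expR_gt0// -expRN -mulrN expRM_natl; exact: main.
Qed.

End CoefficientEstimate.

(** * The integral Gamma at positive integers *)

Section GammaFactorial.
Variable R : realType.

Definition gterm (n : nat) (t : R) : R := expR (- t) * (t ^+ n / n`!%:R).

(** An explicit primitive of [gterm n]: the derivatives of the summands telescope, so no integration
    by parts is needed. *)
Definition gprim (n : nat) (t : R) : R := - \sum_(i < n.+1) gterm i t.

Lemma is_derive_gterm0 (t : R) : is_derive t (1 : R) (gterm 0) (- gterm 0 t).
Proof.
have h : is_derive t (1 : R) (fun x : R => expR (- x)) (- expR (- t)).
  apply: is_derive_eq; rewrite /GRing.scale /=; ring.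
have e : (gterm 0 : R -> R) = (fun x => expR (- x)).
  by apply/funext => x; rewrite /gterm expr0 fact0 invr1 !mulr1.
by rewrite e.
Qed.

Lemma is_derive_gterm (n : nat) (t : R) :
  is_derive t (1 : R) (gterm n.+1) (gterm n t - gterm n.+1 t).
Proof.
have h1 : is_derive t (1 : R) (fun x : R => expR (- x)) (- expR (- t)).
  apply: is_derive_eq; rewrite /GRing.scale /=; ring.
have h := is_deriveM h1 (is_derive_rX n (n.+1`!%:R^-1) t).
have e : (gterm n.+1 : R -> R) = (fun x => expR (- x)) * (fun x : R => n.+1`!%:R^-1 * x ^+ n.+1).
  by apply/funext => x; rewrite /gterm [_ / _]mulrC.
rewrite -e in h; apply: (is_derive_eq h).
have f0 : (n`!%:R : R) != 0 by rewrite pnatr_eq0 -lt0n fact_gt0.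
rewrite /gterm /GRing.scale /= factS natrM exprS.
have n0 : (n.+1%:R : R) != 0 by rewrite pnatr_eq0.
move: (n.+1%:R : R) (n`!%:R : R) n0 f0 => a b a0 b0.
by field; rewrite a0 b0.
Qed.

Lemma is_derive_gprim (n : nat) (t : R) : is_derive t (1 : R) (gprim n) (gterm n t).
Proof.
elim: n => [|n IH].
  have e : gprim 0 = - gterm 0 by apply/funext => x; rewrite /gprim big_ord_recl big_ord0 addr0.
  by rewrite e -[gterm 0 t]opprK; apply: is_deriveN; exact: is_derive_gterm0.
have e : gprim n.+1 = gprim n - gterm n.+1.
  by apply/funext => x; rewrite /gprim big_ord_recr opprD.
have -> : gterm n.+1 t = gterm n t - (gterm n t - gterm n.+1 t) by ring.
by rewrite e; apply: is_deriveB; exact: is_derive_gterm.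
Qed.

Lemma gterm_cvg0 (n : nat) : gterm n t @[t --> +oo%R] --> (0 : R).
Proof.
apply: (@squeeze_cvgr _ _ _ _ (fun=> 0) (fun t => 2 ^+ n * expR (- (2^-1 * t)))).
- near=> t; have t0 : 0 <= t by near: t; exact: nbhs_pinfty_ge.
  rewrite mulr_ge0 ?expR_ge0 ?divr_ge0 ?exprn_ge0//= /gterm.
  have h : (2^-1 * t) ^+ n / n`!%:R <= expR (2^-1 * t).
    have t2 : 0 <= 2^-1 * t by rewrite mulr_ge0// invr_ge0.
    case: n => [|n]; first by rewrite expr0 fact0 invr1 mulr1; have := expR_ge1Dx (2^-1 * t); lra.
    by have := expR_ge1Dxn n t2; lra.
  have -> : t ^+ n / n`!%:R = 2 ^+ n * ((2^-1 * t) ^+ n / n`!%:R).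
    by rewrite mulrA -exprMn mulrA mulfV ?mul1r.
  rewrite mulrCA ler_wpM2l ?exprn_ge0//.
  have -> : - (2^-1 * t) = - t + 2^-1 * t by field.
  by rewrite expRD ler_wpM2l ?expR_ge0.
- exact: cvg_cst.
- rewrite -(mulr0 (2 ^+ n)); apply: cvgMr.
  apply: (@cvg_comp _ _ _ (fun t : R => 2^-1 * t) (fun t => expR (- t)) _ (pinfty_nbhs R)); last exact: cvgr_expR.
  by apply: gt0_cvgMry => //; exact: cvg_id.
Unshelve. all: by end_near. Qed.

Lemma gprim_cvg0 (n : nat) : gprim n t @[t --> +oo%R] --> (0 : R).
Proof.
elim: n => [|n IH].
  have -> : gprim 0 = (fun t => - gterm 0 t).
    by apply/funext => x; rewrite /gprim big_ord_recl big_ord0 addr0.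
  by rewrite -oppr0; apply: cvgN; exact: gterm_cvg0.
have -> : gprim n.+1 = (fun t => gprim n t - gterm n.+1 t).
  by apply/funext => x; rewrite /gprim big_ord_recr opprD.
by rewrite -[X in _ --> X](subrr (0 : R)); apply: cvgB => //; exact: gterm_cvg0.
Qed.

Lemma gprim_at0 (n : nat) : gprim n 0 = -1.
Proof.
rewrite /gprim big_ord_recl big1 ?addr0.
  by rewrite /gterm oppr0 expR0 expr0 fact0 invr1 !mulr1.
by move=> i _; rewrite /gterm expr0n /= mul0r mulr0.
Qed.

Lemma continuous_gterm n : continuous (gterm n).
Proof.
move=> t; apply: differentiable_continuous; apply/derivable1_diffP.
case: n => [|n].
  by have [] := is_derive_gterm0 t.
by have [] := is_derive_gterm n t.
Qed.

Lemma continuous_gprim n : continuous (gprim n).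
Proof.
move=> t; apply: differentiable_continuous; apply/derivable1_diffP.
by have [] := is_derive_gprim n t.
Qed.

Lemma Gamma_fact (n : nat) : Gamma (n%:R + 1 : R) = n`!%:R.
Proof.
have fn : (n`!%:R : R) != 0 by rewrite pnatr_eq0 -lt0n fact_gt0.
rewrite /Gamma addrK.
transitivity (\int[lebesgue_measure]_(t in `]0%R, +oo[) (n`!%:R * gterm n t)).
  apply: eq_Rintegral => t; rewrite inE /= in_itv /= andbT => t0.
  by rewrite powR_mulrn ?(ltW t0)// /gterm; field.
have cf : continuous (fun t => n`!%:R * gterm n t).
  by move=> t; apply: cvgMr; exact: continuous_gterm.
have mf : measurable_fun (`]0%R, +oo[ : set R) (fun t : R => n`!%:R * gterm n t).
  by apply: measurable_funS (continuous_measurable_fun cf).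
(* The endpoint 0 is added to the domain to match the fundamental theorem on a closed half line. *)
rewrite /Rintegral integral_itv_obnd_cbnd; last first.
  by apply/measurable_EFinP.
have df t : is_derive t (1 : R) (fun t => n`!%:R * gprim n t) (n`!%:R * gterm n t).
  exact: (is_deriveZ n`!%:R (is_derive_gprim n t)).
rewrite (@ge0_continuous_FTC2y _ _ (fun t => n`!%:R * gprim n t) 0 0) /=.
- by rewrite gprim_at0 mulrN1 opprK add0r.
- by move=> t t0; rewrite mulr_ge0// /gterm mulr_ge0 ?expR_ge0// divr_ge0// exprn_ge0.
- exact: continuous_subspaceT.
- by rewrite -(mulr0 n`!%:R); apply: cvgMr; exact: gprim_cvg0.
- by move=> t _; have [] := df t.
- by apply: cvg_at_right_filter; apply: cvgMr; exact: continuous_gprim.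
- by move=> t _; rewrite derive1E; have [_ ->] := df t.
Qed.

End GammaFactorial.

(** * Identification of the Bessel term, and the final error bound *)

Section MainTerm.
Variable R : realType.
Local Notation C := R[i].

Lemma limn_series_csum (u : nat -> R) (L : R) : (forall i, 0 <= u i) ->
  has_csum (fun i => (u i)%:C%C) L%:C%C -> limn (series u) = L.
Proof.
move=> u0 hu; have c : cvgn (series u).
  apply: (@real_abs_cvg _ _ L) => n; rewrite (eq_bigr (fun i : 'I_n => u i)); last first.
    by move=> i _; rewrite ger0_norm.
  exact: (has_csum_ge_partial n u0 hu).
have := rcvg_clim c => h.
have h' : clim (fun n => (series u n)%:C%C) L%:C%C.
  apply: (@clim_eq _ 0 _ _ _ _ hu) => n _.
  by rewrite /series /= big_mkord rmorph_sum.
by have := clim_unique h h' => /(congr1 (@complex.Re R)).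
Qed.

Variable k : nat.
Hypothesis hk : k = 1%N \/ k = 2%N.
Local Notation ord := ((5 * k%:R + 2) / (2 * k%:R + 1) : R).

Lemma ord_gt0 : 0 < ord.
Proof. by apply: divr_gt0; rewrite ltr_wpDl// mulr_ge0. Qed.

Lemma xk_sqr n : 2 <= n%:R :> R -> xk R k n ^+ 2 = 2 * pi ^+ 2 / 3 * (n%:R - nuk R k).
Proof.
move=> n2; have /andP[n0 n1] := nuk01 R hk.
have e : 24 * n%:R - (2 * k%:R + 2) = 24 * (n%:R - nuk R k) by rewrite /nuk; field.
rewrite /xk e !exprMn sqr_sqrtr; last by rewrite mulr_ge0//; lra.
by move: (pi : R) (n%:R - nuk R k) => p x; field.
Qed.

Lemma xk_ge0 n : 0 <= xk R k n.
Proof. by rewrite /xk divr_ge0// mulr_ge0 ?pi_ge0 ?sqrtr_ge0. Qed.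

Lemma xk_ge1 n : 2 <= n%:R :> R -> 1 <= xk R k n.
Proof.
move=> n2; have /andP[n0 n1] := nuk01 R hk.
apply: ler_sqr_nonneg; first exact: xk_ge0.
rewrite (xk_sqr n2) expr1n; have p2 := pi_ge2 R.
have : 4 <= pi ^+ 2 :> R by rewrite expr2; nra.
by move: (pi ^+ 2 : R) => p; nra.
Qed.

Lemma besselI2E (s X : R) : 0 <= s -> (s / 2) ^+ 2 = X ->
  besselI 2 s = limn (series (fun r : nat => X ^+ r.+1 / (r`!%:R * r.+2`!%:R))).
Proof.
move=> s0 <-; rewrite /besselI; congr (limn (series _)); apply/funext => r.
have -> : r%:R + 2 + 1 = r.+2%:R + 1 :> R by rewrite -[r.+2]addn2 natrD.
rewrite Gamma_fact.
have -> : 2 * r%:R + 2 = (2 * r.+1)%:R :> R by rewrite natrM -[r.+1%:R]natr1; ring.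
by rewrite powR_mulrn ?divr_ge0// exprM mulrC.
Qed.

(** With N = n + 1 - nu, the argument of the Bessel function is 2 sqrt (A N), so that I_2 is N / A
    times the series [bes], and the prefactor is A / (2 pi N). *)
Lemma main_term n : 2 <= n.+1%:R :> R ->
  (5 * k%:R + 2) * pi ^+ 3 / (18 * (2 * k%:R + 1) * xk R k n.+1 ^+ 2) *
     besselI 2 (Num.sqrt ord * xk R k n.+1) = re (bes (Ak R k) (nuk R k) n) / (2 * pi).
Proof.
move=> n2; have [A1 _ _] := Ak_bounds R hk; have A0 : 0 < Ak R k by lra.
have n01 := nuk01 R hk; have /andP[nu0 nu1] := n01.
have ord0 := ord_gt0.
pose N : R := n.+1%:R - nuk R k; have N0 : 0 < N by rewrite /N; lra.
have s0 : 0 <= Num.sqrt ord * xk R k n.+1 by rewrite mulr_ge0 ?sqrtr_ge0 ?xk_ge0.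
have hX : (Num.sqrt ord * xk R k n.+1 / 2) ^+ 2 = Ak R k * N.
  rewrite expr_div_n [(_ * xk _ _ _) ^+ 2]exprMn (xk_sqr n2) sqr_sqrtr ?(ltW ord0)// /Ak -/N.
  by move: (pi : R) ord => p o; field.
rewrite (besselI2E s0 hX).
have [be b0] := besE n A0 n01.
have hb := besP A0 n01 n; rewrite be in hb.
have hb2 := has_csumZ (N / Ak R k)%:C%C hb; rewrite -rmorphM in hb2.
rewrite (@limn_series_csum _ (N / Ak R k * re (bes (Ak R k) (nuk R k) n))); last 2 first.
- by move=> r; rewrite divr_ge0 ?mulr_ge0// exprn_ge0// mulr_ge0 ?ltW.
- apply: eq_has_csum hb2 => r; rewrite -rmorphM /=; congr (_%:C%C).
  rewrite /alpha /bterm /nshift -/N.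
  have An : Ak R k != 0 by rewrite gt_eqF.
  have f1 : (r`!%:R : R) != 0 by rewrite pnatr_eq0 -lt0n fact_gt0.
  have f2 : (r.+2`!%:R : R) != 0 by rewrite pnatr_eq0 -lt0n fact_gt0.
  move: (Ak R k) (N) (r`!%:R : R) (r.+2`!%:R : R) An f1 f2 => a c d e a0 d0 e0.
  rewrite !exprS exprMn; move: (a ^+ r) (c ^+ r) => ar cr.
  by field; rewrite a0 d0 e0.
rewrite (xk_sqr n2) -/N /Ak.
have p0 : (pi : R) != 0 by rewrite gt_eqF// pi_gt0.
have Nn : N != 0 by rewrite gt_eqF.
have k1 : 2 * k%:R + 1 != 0 :> R by rewrite gt_eqF// ltr_wpDl// mulr_ge0.
have k2 : 5 * k%:R + 2 != 0 :> R by rewrite gt_eqF// ltr_wpDl// mulr_ge0.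
move: (pi : R) (N) (k%:R : R) (re _) p0 Nn k1 k2 => p c x b p0 c0 x1 x2.
by field; rewrite p0 c0 x1 x2.
Qed.

Local Notation slope := (Num.sqrt (5 * k%:R + 2) / (2 * Num.sqrt (2 * k%:R + 1)) : R).

Lemma slope_sqr : slope ^+ 2 = ord / 4.
Proof.
have h1 : 0 < 2 * k%:R + 1 :> R by rewrite ltr_wpDl// mulr_ge0.
have h2 : 0 <= 5 * k%:R + 2 :> R by rewrite addr_ge0// mulr_ge0.
rewrite expr_div_n exprMn !sqr_sqrtr// ?(ltW h1)//.
by move: (lt0r_neq0 h1); move: (2 * k%:R + 1 : R) (5 * k%:R + 2 : R) => a b a0; field.
Qed.

Lemma slope_gt0 : 0 < slope.
Proof.
have h1 : 0 < 2 * k%:R + 1 :> R by rewrite ltr_wpDl// mulr_ge0.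
have h2 : 0 < 5 * k%:R + 2 :> R by rewrite ltr_wpDl// mulr_ge0.
by rewrite divr_gt0 ?mulr_gt0 ?sqrtr_gt0.
Qed.

(** Chosen so that slope x - 2 sqrt (B N) >= gap x: with a = slope x, the difference of squares is
    a^2 - 4 B N = (A - 4 B) N = 4 N / 25, and it is divided by 2 a, where x^2 = 2 pi^2 N / 3. *)
Definition gap : R := 3 / (25 * pi ^+ 2 * slope).

(** The factor 24 / gap^4 pays for the power of x: e^{gap x} >= (gap x)^4 / 24, and x^{-4} <=
    x^{-7/2} as x >= 1. *)
Definition final_cst : R := diff_cst R k * expR 1 * (24 / gap ^+ 4).

Lemma diff_cst_gt0 : 0 < diff_cst R k.
Proof.
have [A1 _ _] := Ak_bounds R hk; rewrite /diff_cst.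
have := expR_gt0 (24 : R); have := expR_gt0 (Ak R k * 4); have := expR_gt0 (27 * 486 : R).
have := mulr_gt0 (expR_gt0 (1 : R)) (expR_gt0 (2 * (Ak R k + 1) + 9 * (Ak R k + 1) ^+ 2 / Bk R k)).
move: (expR 1 * _) (expR (27 * 486)) (expR (Ak R k * 4)) (expR 24) => a b c d; lra.
Qed.

Lemma gap_gt0 : 0 < gap.
Proof. by rewrite divr_gt0// mulr_gt0 ?slope_gt0// mulr_gt0// exprn_gt0// pi_gt0. Qed.

Lemma final_cst_gt0 : 0 < final_cst.
Proof.
by rewrite mulr_gt0 ?divr_gt0 ?exprn_gt0 ?gap_gt0// mulr_gt0 ?expR_gt0 ?diff_cst_gt0.
Qed.

(* The optimal [y] is [sqrt (Bk k / N)], which turns the exponent into [2 * sqrt (Bk k * N)]. *)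
Lemma dcoef_optimized n : 256 * Bk R k + 2 <= n%:R -> exists2 t : R,
  0 <= t /\ t ^+ 2 = Bk R k * (n%:R - nuk R k) &
  normc (dcoef R k n) <= diff_cst R k * expR (1 + 2 * t).
Proof.
move=> nB; have B0 := Bk_gt0 R hk; have /andP[nu0 nu1] := nuk01 R hk.
(* N >= 256 B is the condition y <= 1/16 of [dcoef_le]. *)
set N := n%:R - nuk R k; have N1 : 256 * Bk R k <= N by rewrite /N; lra.
have N0 : 0 < N by rewrite /N; lra.
pose y := Num.sqrt (Bk R k / N); have y0 : 0 < y by rewrite sqrtr_gt0 divr_gt0.
have y2 : y ^+ 2 = Bk R k / N by rewrite sqr_sqrtr// divr_ge0// ltW.
have y1 : y <= 1 / 16.
  apply: ler_sqr_nonneg; first by lra.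
  rewrite y2 ler_pdivrMr//; lra.
exists (N * y).
  split; first by rewrite mulr_ge0// ltW.
  by rewrite exprMn y2; field; rewrite gt_eqF.
apply: le_trans (dcoef_le n hk y0 y1) _.
rewrite ler_pM2l ?diff_cst_gt0// ler_expR.
have -> : Bk R k / y = N * y.
  apply: (mulIf (lt0r_neq0 y0)); rewrite divfK ?lt0r_neq0// -mulrA -expr2 y2.
  by rewrite mulrC divfK ?lt0r_neq0.
(* Only nu y <= 1 is lost by replacing n with N; it is the 1 in the exponent. *)
have -> : n%:R = N + nuk R k by rewrite /N subrK.
nra.
Qed.

(** The optimized exponent 2 t falls short of the allowed one by at least [gap * x], and this
    exponential saving absorbs the factor x^{-7/2}. *)
Lemma dcoef_final n : 256 * Bk R k + 2 <= n%:R ->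
  normc (dcoef R k n) <= final_cst * (xk R k n `^ (- (7 / 2)) * expR (slope * xk R k n)).
Proof.
move=> nB; have B0 := Bk_gt0 R hk; have /andP[nu0 nu1] := nuk01 R hk.
have n2 : 2 <= n%:R :> R by lra.
have [t [t0 t2] ht] := dcoef_optimized nB; apply: le_trans ht _.
have x1 := xk_ge1 n2; have x2 := xk_sqr n2; move: t2 x2.
set N := n%:R - nuk R k; set x := xk R k n in x1 *; move=> t2 x2.
have x0 : 0 < x by lra.
have N0 : 0 < N by rewrite /N; lra.
have s0 := slope_gt0; have s2 := slope_sqr; have g0 := gap_gt0.
set a := slope * x; have a0 : 0 < a by rewrite mulr_gt0.
have p0 := pi_gt0 R.
have a2 : a ^+ 2 = Ak R k * N.
  by rewrite exprMn s2 x2 /Ak; move: ord (pi : R) => o p; field.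
have ta : 2 * t <= a.
  apply: ler_sqr_nonneg; first exact: ltW.
  by rewrite exprMn t2 a2 /Bk; nra.
have gx : gap * x * (2 * a) = 4 / 25 * N.
  have -> : gap * x * (2 * a) = 6 / (25 * pi ^+ 2) * x ^+ 2.
    rewrite /a /gap; move: (slope) (pi : R) (lt0r_neq0 s0) (lt0r_neq0 p0) => s p sn pn.
    by field; rewrite sn pn.
  by rewrite x2; move: (pi : R) (lt0r_neq0 p0) => p pn; field.
have key : 2 * t + gap * x <= a.
  have a2p : 0 < 2 * a by lra.
  rewrite -lerBrDl -(ler_pM2r a2p) gx.
  have -> : 4 / 25 * N = (a - 2 * t) * (a + 2 * t).
    have -> : (a - 2 * t) * (a + 2 * t) = a ^+ 2 - 4 * t ^+ 2 by ring.
    by rewrite a2 t2 /Bk; field.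
  by apply: ler_wpM2l; lra.
have pw : x ^- 4 <= x `^ (- (7 / 2)).
  rewrite powRN lef_pV2 ?posrE ?powR_gt0 ?exprn_gt0// -powR_mulrn ?(ltW x0)//.
  by apply: ler_powR => //; lra.
have ex : (gap * x) ^+ 4 / 24 <= expR (gap * x).
  have := @expR_ge1Dxn _ (gap * x) 3 (mulr_ge0 (ltW g0) (ltW x0)).
  by rewrite -[(4`!)%:R]/(24%:R); lra.
have low : gap ^+ 4 / 24 * expR (2 * t) <= x `^ (- (7 / 2)) * expR a.
  apply: le_trans (_ : x ^- 4 * (expR (2 * t) * expR (gap * x)) <= _); last first.
    apply: ler_pM.
    - by rewrite invr_ge0 exprn_ge0// ltW.
    - by rewrite mulr_ge0 ?expR_ge0.
    - exact: pw.
    - by rewrite -expRD ler_expR.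
  have -> : gap ^+ 4 / 24 * expR (2 * t) = x ^- 4 * (expR (2 * t) * ((gap * x) ^+ 4 / 24)).
    by move: (expR _) (gap) (x) (lt0r_neq0 x0) => e g c c0; field.
  rewrite ler_wpM2l ?invr_ge0 ?exprn_ge0 ?(ltW x0)//.
  by rewrite ler_wpM2l ?expR_ge0.
apply: le_trans (ler_wpM2l (ltW final_cst_gt0) low).
rewrite /final_cst expRD.
have -> : diff_cst R k * expR 1 * (24 / gap ^+ 4) * (gap ^+ 4 / 24 * expR (2 * t)) =
  diff_cst R k * (expR 1 * expR (2 * t)).
  move: (lt0r_neq0 (exprn_gt0 4 g0)); move: (gap ^+ 4) (expR 1) (expR (2 * t)) (diff_cst R k) => g e f d gn.
  by field.
exact: lexx.
Qed.

End MainTerm.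

Theorem theorem1p2 (R : realType) (k : nat) (hk : k = 1%N \/ k = 2%N) :
  (fun n : nat => (Delta k n)%:~R : R^o) =
  (fun n : nat =>
     (5 * k%:R + 2) * pi ^+ 3 / (18 * (2 * k%:R + 1) * xk R k n ^+ 2) *
     besselI 2 (Num.sqrt ((5 * k%:R + 2) / (2 * k%:R + 1)) * xk R k n) : R^o)
  +O_\oo
  (fun n : nat =>
     xk R k n `^ (- (7 / 2)) *
     expR (Num.sqrt (5 * k%:R + 2) / (2 * Num.sqrt (2 * k%:R + 1)) * xk R k n)
     : R^o).
Proof.
apply/eqaddOP; apply/bigO_exP; exists (final_cst R k); first exact: final_cst_gt0.
apply: filterS (nbhs_infty_ger (256 * Bk R k + 2)) => n nB.
have B0 := Bk_gt0 R hk; have n2 : 2 <= n%:R :> R by lra.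
(* The argument is written as a successor because [main_term] relates the theorem's term at n + 1 to
   [bes] at n. *)
case: n nB n2 => [|n] nB n2; first by move: n2; rewrite (ler_nat R 2 0).
have h := dcoef_final hk nB.
rewrite [X in _ <= _ * X]ger0_norm ?mulr_ge0 ?powR_ge0 ?expR_ge0//.
apply: le_trans h; rewrite -[X in X <= _]/(`|(Delta k n.+1)%:~R - _|) main_term//.
have [A1 _ _] := Ak_bounds R hk; have A0 : 0 < Ak R k by lra.
have [be _] := besE n A0 (nuk01 R hk).
have -> : dcoef R k n.+1 = ((Delta k n.+1)%:~R - re (bes (Ak R k) (nuk R k) n) / (2 * pi))%:C%C.
  have eT : ((2 * pi : R)%:C%C)^-1 = ((2 * pi : R)^-1)%:C%C by rewrite fmorphV.
  have eD : (Delta k n.+1)%:~R = ((Delta k n.+1)%:~R : R)%:C%C :> R[i] by rewrite rmorph_int.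
  by rewrite /dcoef be eT eD -rmorphM -rmorphB.
by rewrite normcR.
Qed.
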